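(* Suppose that $0<a_k<\infty$ and $0<b_k<\infty$ for all $k\in\mathbb{N}$, that $\sum_{k\in\mathbb{N}}(1/a_k)=\infty$, that $\mathcal{V}\ne\emptyset$, that $\sum_{k\in\mathbb{Z}_+}\alpha_k<\infty$, and that $X(0)\in\mathbb{X}_{\mathrm F}$. Then there is a probability measure $\pi_\alpha$ on $\mathbb{Z}$ such that, for every finite $A\subset\mathbb{Z}$, $$\lim_{t\to\infty}\frac1t\int_0^t\mathbf{1}\{X_1(s)\in A\}\,\mathrm{d}s=\pi_\alpha(A)\quad\text{almost surely}.$$
   Context: $\mathbb{N}=\{1,2,\dots\}$, $\mathbb{Z}_+=\{0,1,2,\dots\}$. Particle system: $\mathbb{X}=\{(x_1,x_2,\dots)\in\mathbb{Z}^{\mathbb{N}}:x_1<x_2<\cdots\}$ and $\mathbb{X}_{\mathrm F}=\{x\in\mathbb{X}:x_{k+1}-x_k=1\text{ for all but finitely many }k\}$. $X(t)=(X_1(t),X_2(t),\dots)$, started from the fixed configuration $X(0)$, is the continuous-time Markov chain in which the $k$th particle from the left, at location $X_k(t)$, attempts to jump one step left at rate $a_k$ and one step right at rate $b_k$, an attempted jump being suppressed if the destination site is occupied. Under $\sum_k 1/a_k=\infty$ and $X(0)\in\mathbb{X}_{\mathrm F}$, this is a well-defined non-explosive Markov chain on the countable set $\mathbb{X}_{\mathrm F}$. Definitions: $\alpha_0=1$, $\beta_0=0$, and for $k\in\mathbb{N}$, $\alpha_k=\frac{a_1\cdots a_k}{b_1\cdots b_k}$, $\beta_k=\frac1{b_k}+\frac{a_k}{b_kb_{k-1}}+\cdots+\frac{a_k\cdots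 a_2}{b_k\cdots b_1}$. $\mathcal{V}$ is the set of $v\in\mathbb{R}$ such that $\alpha_k+v\beta_k\in(0,1)$ for all $k\in\mathbb{N}$. *)

(* Defs.v *)
From HB Require Import structures.
From mathcomp Require Import all_boot all_order all_algebra.
From mathcomp Require Import all_classical all_reals all_analysis.

Set Implicit Arguments.
Unset Strict Implicit.
Unset Printing Implicit Defensive.

Import Order.TTheory GRing.Theory Num.Theory.
Import numFieldNormedType.Exports.

Local Open Scope classical_set_scope.
Local Open Scope ring_scope.

HB.instance Definition _ := isPointed.Build int 0.

HB.instance Definition _ := @isMeasurable.Build default_measure_display int
  discrete_measurable discrete_measurable0
  discrete_measurableC discrete_measurableU.

(* Particles and their rates are indexed from 0: [a k], [b k] and [x k] are the
   a_{k+1}, b_{k+1} and x_{k+1} of a numbering of the particles by 1, 2, ...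
   The index of [alpha], [beta] is not shifted (alpha_0 = 1, beta_0 = 0). *)

Section AlphaBeta.
Variables (R : realType) (a b : nat -> R).

Definition alpha (k : nat) : R := (\prod_(i < k) a i) / (\prod_(i < k) b i).

(* The [j]-th summand is (a_{j+2} ... a_k) / (b_{j+1} ... b_k) in the numbering
   from 1. *)
Definition beta (k : nat) : R :=
  \sum_(j < k) (\prod_(j.+1 <= i < k) a i) / (\prod_(j <= i < k) b i).

Definition admissible_v : set R :=
  [set v | forall k, (0 < k)%N -> 0 < alpha k + v * beta k < 1].

End AlphaBeta.

Definition conf := nat -> int.

Definition XX : set conf := [set x | forall k, x k < x k.+1].

Definition XF : set conf :=
  XX `&` [set x | finite_set [set k | x k.+1 - x k != 1]].

Definition move (x : conf) (k : nat) (d : int) : conf :=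
  fun i => if i == k then x k + d else x i.

(* Jump rate from [x] to [y]: at most one [k] contributes, and none if
   [y = x]. *)
Definition rate (R : realType) (a b : nat -> R) (x y : conf) : R :=
  \sum_(k \in [set k | ~ range x (x k - 1) /\ y = move x k (- 1)]) a k +
  \sum_(k \in [set k | ~ range x (x k + 1) /\ y = move x k 1]) b k.

Section MarkovChain.
Context {d : measure_display} {T : measurableType d} {R : realType}.
Context {S : choiceType}.
Variables (P : probability T R) (E : set S) (q : S -> S -> R) (x0 : S).

Definition exit_rate (x : S) : R := fine (\esum_(y in E) (q x y)%:E).

Definition starts_with (Y : nat -> T -> S) (n : nat) (y : nat -> S) : set T :=
  [set w | forall i, (i <= n)%N -> Y i w = y i].

Definition jump_time (H : nat -> T -> R) (n : nat) (w : T) : R :=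
  \sum_(i < n) H i w.

(* Jump chain / holding time definition of the continuous-time Markov chain
   with off-diagonal rates [q] ([q x x = 0]) on the countable state space [E],
   started from [x0], when no state is absorbing: [Y] is the jump chain and,
   given [Y], the holding times [H] are independent exponential variables with
   parameters [exit_rate (Y n)].  Explosion is not excluded: [X] is determined
   before the explosion time sup_n [jump_time H n] only. *)
Definition is_ctmc (X : R -> T -> S) : Prop :=
  exists (Y : nat -> T -> S) (H : nat -> T -> R),
  [/\ (forall n w, E (Y n w)) /\
        (forall n x, E x -> measurable [set w | Y n w = x]),
      forall n, measurable_fun setT (H n),
      P [set w | Y 0%N w = x0] = 1%E /\
        (forall n (y : nat -> S), (forall i, E (y i)) ->
          P (starts_with Y n.+1 y) =
            (P (starts_with Y n y) *
              (q (y n) (y n.+1) / exit_rate (y n))%:E)%E),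
      forall n (y : nat -> S) (t : nat -> R),
        (forall i, E (y i)) -> (forall i, 0 <= t i) ->
        P (starts_with Y n y `&`
             [set w | forall i, (i <= n)%N -> t i < H i w]) =
          (P (starts_with Y n y) *
            (\prod_(i < n.+1) expR (- (exit_rate (y i) * t i)))%:E)%E
    & {ae P, forall w, forall n t,
        jump_time H n w <= t < jump_time H n.+1 w -> X t w = Y n w}].

End MarkovChain.

(* Main.v *)
Require Import Defs.
From HB Require Import structures.
From mathcomp Require Import all_boot all_order all_algebra.
From mathcomp Require Import all_classical all_reals all_analysis.
From mathcomp Require Import measurable_realfun ring lra zify.

Set Implicit Arguments.
Unset Strict Implicit.
Unset Printing Implicit Defensive.

Import Order.TTheory GRing.Theory Num.Theory.
Import numFieldNormedType.Exports.

Local Open Scope classical_set_scope.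
Local Open Scope ring_scope.

(** The exclusion process is reversible. In terms of the gaps between
consecutive particles, the product of the powers alpha_{k+1} ^ (gap x k)
satisfies detailed balance with the jump rates ([weight_rate_sym]). The
admissible set being non-empty, every alpha_k with k > 0 is smaller than 1
([alpha_lt1]), and then the summability of alpha makes this measure finite
([weight_summable]). Its normalisation is a stationary law, and the limiting
measure is the law of the first particle under it. What remains is an ergodic
theorem for a chain that is reversible, whose state space is countable, and
whose exit rates are unbounded in general. They may be so large that the
reversible measure of the jump chain has infinite mass, that is, the jump chain
may be null recurrent although the process has a finite stationary measure. For
this reason the number of returns of the jump chain to its starting point, and
not its number of jumps, is the clock of the proof.

Recurrence of the jump chain. The probability of not yet having returned to the
root decreases to a function that is harmonic off the root. Tested against
finitely supported functions close to 1 and of small energy, harmonicity forces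
this function to be constant along edges, hence to vanish
([recurrence_criterion]). Two cutoffs are multiplied. One depends on the number
of particles to the left of the packed ones: when it equals n, it increases
only by the jump to the left of the first packed particle, at rate a_n, so that
the system behaves like conductors a_0, a_1, ... in series, and the divergence
of the sum of the 1 / a_n gives energies tending to 0 ([energy_level_cut]). The
other one depends on the distance of the first particle from its packed
position, which only the first particle can change, at bounded rate
([energy_spread_cut]).

Occupation of states by the jump chain. For a state z different from the root,
the Green function of the chain killed at the root, truncated at a finite time,
almost solves the Poisson equation whose right-hand side is the indicator of z
minus a multiple of the indicator of the root ([green_poisson]); the defect has
small integral by recurrence. The sum of an exact defect u - P u along the path
is a martingale up to a bounded term, and its second moment at the n-th return
is at most linear in n ([mart_L2_bound]), so that its averages tend to 0 along
the returns of square index ([L2_squares_cvg0]). A maximal inequality for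
Markov chains with a possibly infinite invariant measure ([maximal_ineq])
converts functions of small integral into functions of small averages
([averages_to_approx]). The outcome is the ratio limit theorem
[averages_to_total] for integrable functions.

Real time. Given the jump chain the holding times are independent exponentials,
and the second moment argument replaces them by their means ([noise_cvg0]); the
exit rates are bounded below since the first particle may always jump left.
This yields the time spent in a set during the first (n+1)^2 excursions,
divided by (n+1)^2 ([time_average]). The time integral being monotone between
these epochs, and the ratio of consecutive squares tending to 1, the average
over [0, t] converges as t tends to infinity ([sandwich_cvg]). *)

(** * Reversible networks and expectations over paths *)

(** A locally finite weighted graph. Storing the neighbours as lists turns the
expectation of a function of finitely many steps of the walk into a finite sum.
*)
Record network (R : realType) (S : choiceType) := Network {
  nbr : S -> seq S;
  cond : S -> S -> R;
  nbr_uniq : forall x, uniq (nbr x);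
  nbr_sym : forall x y, (y \in nbr x) = (x \in nbr y);
  nbr_neq0 : forall x, nbr x != [::];
  cond_sym : forall x y, cond x y = cond y x;
  cond_gt0 : forall x y, y \in nbr x -> 0 < cond x y;
  cond_eq0 : forall x y, y \notin nbr x -> cond x y = 0 }.

Section Paths.
Context {R : realType} {S : choiceType} (N : network R S).
Implicit Types (x y z o : S) (l : seq S) (n k m K : nat) (F G : S -> R).

(** The reversible measure of the walk. Its total mass may be infinite. *)
Definition wt x : R := \sum_(y <- nbr N x) cond N x y.

Definition trans x y : R := cond N x y / wt x.

Definition avg F x : R := \sum_(y <- nbr N x) trans x y * F y.

(** Expectation of g(Y_1, ..., Y_n) for the walk Y started from x. *)
Fixpoint pathE n x (g : seq S -> R) : R :=
  if n is m.+1 then avg (fun y => pathE m y (fun l => g (y :: l))) x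
  else g [::].

Lemma cond_ge0 x y : 0 <= cond N x y.
Proof.
by have [/cond_gt0/ltW//|/cond_eq0 ->] := boolP (y \in nbr N x).
Qed.

Lemma wt_gt0 x : 0 < wt x.
Proof.
rewrite /wt; have := @nbr_neq0 _ _ N x; have := @cond_gt0 _ _ N x.
case: (nbr N x) => // y s pos _; rewrite big_cons ltr_pwDl ?pos ?mem_head//.
by apply: sumr_ge0 => i _; exact: cond_ge0.
Qed.

Lemma trans_ge0 x y : 0 <= trans x y.
Proof. by rewrite divr_ge0 ?cond_ge0// ltW// wt_gt0. Qed.

Lemma trans_eq0 x y : y \notin nbr N x -> trans x y = 0.
Proof. by move=> /cond_eq0; rewrite /trans => ->; rewrite mul0r. Qed.

Lemma trans_sum1 x : \sum_(y <- nbr N x) trans x y = 1.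
Proof. by rewrite -mulr_suml divff// gt_eqF// wt_gt0. Qed.

Lemma wt_trans x y : wt x * trans x y = cond N x y.
Proof. by rewrite /trans mulrCA divff ?mulr1// gt_eqF// wt_gt0. Qed.

Lemma detailed_balance x y : wt x * trans x y = wt y * trans y x.
Proof. by rewrite !wt_trans cond_sym. Qed.

Lemma eq_avg F G x : (forall y, y \in nbr N x -> F y = G y) ->
  avg F x = avg G x.
Proof. by move=> FG; apply: eq_big_seq => y /FG ->. Qed.

Lemma le_avg F G x : (forall y, y \in nbr N x -> F y <= G y) ->
  avg F x <= avg G x.
Proof.
move=> FG; rewrite /avg big_seq [leRHS]big_seq; apply: ler_sum => y /FG.
by move=> ?; rewrite ler_wpM2l ?trans_ge0.
Qed.

Lemma avgD F G x : avg (fun y => F y + G y) x = avg F x + avg G x.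
Proof. by rewrite /avg -big_split; apply: eq_bigr => y _; rewrite mulrDr. Qed.

Lemma avgZ (a : R) F x : avg (fun y => a * F y) x = a * avg F x.
Proof. by rewrite /avg mulr_sumr; apply: eq_bigr => y _; rewrite mulrCA. Qed.

Lemma avg_cst (a : R) x : avg (fun=> a) x = a.
Proof. by rewrite /avg -mulr_suml trans_sum1 mul1r. Qed.

Lemma avg_sum I (r : seq I) (F : I -> S -> R) x :
  avg (fun y => \sum_(i <- r) F i y) x = \sum_(i <- r) avg (F i) x.
Proof.
by rewrite /avg exchange_big/=; apply: eq_bigr => y _; rewrite mulr_sumr.
Qed.

Lemma avg_ge0 F x : (forall y, 0 <= F y) -> 0 <= avg F x.
Proof. by move=> F0; apply: sumr_ge0 => y _; rewrite mulr_ge0 ?trans_ge0. Qed.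

Lemma avg_pred1 x y : avg (fun z => (z == y)%:R) x = trans x y.
Proof.
have [yx|yx] := boolP (y \in nbr N x); last first.
  rewrite (trans_eq0 yx) /avg big_seq big1// => z zx.
  case: eqVneq => [zy|_]; last by rewrite mulr0.
  by rewrite -zy zx in yx.
rewrite /avg (bigD1_seq y)//= ?nbr_uniq// eqxx mulr1 big1 ?addr0//.
by move=> z /negPf ->; rewrite mulr0.
Qed.

Definition step : rel S := fun x y => y \in nbr N x.

Lemma le_pathE n x f g :
  (forall l, size l = n -> path step x l -> f l <= g l) ->
  pathE n x f <= pathE n x g.
Proof.
elim: n x f g => [|n IH] x f g fg /=; first exact: fg.
apply: le_avg => y xy; apply: IH => l ln yl.
by apply: fg => /=; rewrite ?ln// /step xy.
Qed.

Lemma eq_pathE n x f g :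
  (forall l, size l = n -> path step x l -> f l = g l) ->
  pathE n x f = pathE n x g.
Proof.
by move=> fg; apply: le_anti; rewrite !le_pathE// => l ln xl; rewrite fg.
Qed.

Lemma pathED n x f g :
  pathE n x (fun l => f l + g l) = pathE n x f + pathE n x g.
Proof.
elim: n x f g => [//|n IH] x f g /=; rewrite -avgD.
by apply: eq_avg => y _; exact: IH.
Qed.

Lemma pathEZ (a : R) n x f :
  pathE n x (fun l => a * f l) = a * pathE n x f.
Proof.
elim: n x f => [//|n IH] x f /=; rewrite -avgZ.
by apply: eq_avg => y _; exact: IH.
Qed.

Lemma pathE_cst (a : R) n x : pathE n x (fun=> a) = a.
Proof. by elim: n x => [//|n IH] x /=; under eq_avg do rewrite IH; exact: avg_cst. Qed.

Lemma pathE_sum I (r : seq I) n x (f : I -> seq S -> R) :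
  pathE n x (fun l => \sum_(i <- r) f i l) = \sum_(i <- r) pathE n x (f i).
Proof.
elim: n x f => [//|n IH] x f /=; rewrite -avg_sum.
by apply: eq_avg => y _; exact: IH.
Qed.

Lemma pathE_ge0 n x f :
  (forall l, size l = n -> path step x l -> 0 <= f l) -> 0 <= pathE n x f.
Proof. by move=> f0; rewrite -(pathE_cst 0 n x); exact: le_pathE. Qed.

Lemma pathE_cat n m x g : pathE (n + m) x g =
  pathE n x (fun l => pathE m (last x l) (fun l' => g (l ++ l'))).
Proof. by elim: n x g => [//|n IH] x g /=; apply: eq_avg => y _; exact: IH. Qed.

Lemma pathE_rcons n x g : pathE n.+1 x g =
  pathE n x (fun l => avg (fun y => g (rcons l y)) (last x l)).
Proof.
rewrite -addn1 pathE_cat; apply: eq_pathE => l _ _ /=.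
by apply: eq_avg => y _; rewrite cats1.
Qed.

(** The law of the walk from z after k steps, applied to the transition matrix;
the weight f depends on the past and serves to kill the walk. *)
Lemma sum_trans_last x k z (f : seq S -> R) :
  \sum_(y <- nbr N x) trans y x * pathE k z (fun l => f l * (last z l == y)%:R)
  = pathE k z (fun l => f l * trans (last z l) x).
Proof.
under eq_bigr do rewrite -pathEZ.
rewrite -pathE_sum; apply: eq_pathE => l _ _.
have [lx|lx] := boolP (last z l \in nbr N x); last first.
  rewrite trans_eq0; last by rewrite nbr_sym.
  rewrite mulr0 big_seq big1// => y yx; case: eqVneq => [ly|]; rewrite ?mulr0//.
  by rewrite ly yx in lx.
rewrite (bigD1_seq (last z l))//= ?nbr_uniq// eqxx mulr1 mulrC big1 ?addr0//.
by move=> y; rewrite eq_sym => /negPf ->; rewrite !mulr0.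
Qed.

(** F has integral at most C against the reversible measure, for non-negative
F. Integrals over the countable state space are only ever bounded through
finite lists of distinct states. *)
Definition bdd_total F (C : R) :=
  forall D : seq S, uniq D -> \sum_(x <- D) wt x * F x <= C.

Lemma sub_sum_uniq (D D' : seq S) F : uniq D -> uniq D' -> {subset D <= D'} ->
  (forall x, 0 <= F x) -> \sum_(x <- D) F x <= \sum_(x <- D') F x.
Proof.
move=> uD uD' DD' F0.
rewrite [leRHS](bigID (mem D))/= -[leLHS]addr0 lerD//; last by rewrite sumr_ge0.
rewrite -[X in _ <= X]big_filter le_eqVlt; apply/orP; left; apply/eqP.
apply: perm_big; apply: uniq_perm; rewrite ?filter_uniq// => x.
by rewrite mem_filter; case: (boolP (x \in D)) => // /DD' ->.
Qed.

(** Invariance of the reversible measure, in the form available for finite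
lists: a partial integral of P F is below a partial integral of F. *)
Lemma sum_wt_avg (D : seq S) F : uniq D -> (forall x, 0 <= F x) ->
  exists2 D' : seq S, uniq D' &
   \sum_(x <- D) wt x * avg F x <= \sum_(x <- D') wt x * F x.
Proof.
move=> uD F0; set D' := undup (flatten [seq nbr N x | x <- D]).
exists D'; first exact: undup_uniq.
have -> : \sum_(x <- D) wt x * avg F x =
    \sum_(x <- D) \sum_(y <- D') cond N x y * F y.
  apply: eq_big_seq => x xD; rewrite /avg mulr_sumr.
  under eq_bigr do rewrite mulrA wt_trans.
  rewrite [RHS](bigID (mem (nbr N x)))/= [X in _ = _ + X]big1 ?addr0; last first.
    by move=> y yx; rewrite cond_eq0 ?mul0r.
  rewrite -[RHS]big_filter; apply: perm_big; apply: uniq_perm.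
  - exact: nbr_uniq.
  - by rewrite filter_uniq ?undup_uniq.
  - move=> y; rewrite mem_filter; case: (boolP (y \in nbr N x)) => //= yx.
    rewrite mem_undup; apply/esym/flattenP; exists (nbr N x) => //.
    exact: map_f.
rewrite exchange_big/= ; apply: ler_sum => y _.
rewrite -mulr_suml ler_wpM2r//.
have -> : wt y = \sum_(x <- nbr N y) cond N x y.
  by apply: eq_bigr => x _; rewrite cond_sym.
rewrite (bigID (mem (nbr N y)))/= [X in _ + X <= _]big1 ?addr0; last first.
  by move=> x xy; rewrite cond_sym cond_eq0.
rewrite -[leLHS]big_filter; apply: sub_sum_uniq => //.
- by rewrite filter_uniq.
- exact: nbr_uniq.
- by move=> x; rewrite mem_filter => /andP[].
- by move=> x; exact: cond_ge0.
Qed.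

Lemma bdd_total_avg F C : (forall x, 0 <= F x) -> bdd_total F C ->
  bdd_total (avg F) C.
Proof.
move=> F0 FC D uD; have [D' uD' /le_trans] := sum_wt_avg uD F0.
by apply; exact: FC.
Qed.

(** Largest sum of psi over a prefix of the list, the empty prefix included.
The recursion is the one behind the maximal inequality: a positive maximum is
the first value plus the maximum for the shifted path. *)
Definition maxsum (psi : S -> R) l : R :=
  foldr (fun x r => Num.max 0 (psi x + r)) 0 l.

Lemma maxsum_ge0 psi l : 0 <= maxsum psi l.
Proof. by case: l => //= x l; rewrite le_max lexx. Qed.

Lemma maxsum_rcons psi l y : maxsum psi l <= maxsum psi (rcons l y).
Proof.
elim: l => [|x l IH]; first exact: maxsum_ge0.
by rewrite /= ge_max !le_max lexx/= lerD2l IH orbT.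
Qed.

Lemma maxsum_prefix psi l l' :
  \sum_(x <- l) psi x <= maxsum psi (l ++ l').
Proof.
elim: l => [|x l IH]; first by rewrite big_nil maxsum_ge0.
by rewrite big_cons /= le_max lerD2l IH orbT.
Qed.

(** Hopf maximal inequality for the ratio of the sums of w to the number of
visits to o, over the first n steps. Integrating the recursion of [maxsum]
against the invariant measure, the integrals of the maximum over n and over n -
1 steps compare in the right direction and cancel. Although the measure may be
infinite, they are finite: by the recursion itself, at most n + 1 times the
integral of w. *)
Lemma maximal_ineq o (w : S -> R) (lam C : R) n : 0 < lam ->
  (forall x, 0 <= w x) -> bdd_total w C ->
  lam * wt o *
    pathE n o (fun l => (0 < maxsum (fun x => w x - lam * (x == o)%:R) (o :: l))%R%:R)
  <= C.
Proof.
move=> lam0 w0 wC.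
set psi := fun x => _.
pose m k x := pathE k x (fun l => maxsum psi (x :: l)).
pose m' k x := if k is j.+1 then m j x else 0.
pose Pr k x := pathE k x (fun l => (0 < maxsum psi (x :: l))%R%:R : R).
have m_ge0 k x : 0 <= m k x by apply: pathE_ge0 => *; exact: maxsum_ge0.
have m'_ge0 k x : 0 <= m' k x by case: k => /=.
have Pr_ge0 k x : 0 <= Pr k x by apply: pathE_ge0.
(* Garsia: on the event that the maximum is positive it equals psi plus the
maximum of the shifted path; elsewhere it is 0. *)
have key k x : m k x + lam * (x == o)%:R * Pr k x <= w x + avg (m' k) x.
  have -> : w x + avg (m' k) x =
      pathE k x (fun l => w x + maxsum psi l).
    rewrite pathED pathE_cst; congr (_ + _); case: k => [|k] //=.
    by rewrite avg_cst.
  rewrite -pathEZ -pathED; apply: le_pathE => l _ _ /=.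
  case: (ltP 0 (psi x + maxsum psi l)) => h.
    by rewrite h mulr1 {1}/psi; lra.
  by rewrite ltxx mulr0 addr0 addr_ge0// maxsum_ge0.
have mm' k x : m' k x <= m k x.
  case: k => [|k] //=; rewrite /m pathE_rcons; apply: le_pathE => l _ _.
  rewrite -[leLHS](avg_cst _ (last x l)); apply: le_avg => y _.
  by rewrite -rcons_cons maxsum_rcons.
have bdd k : exists B, bdd_total (m' k) B.
  elim: k => [|k [B IH]].
    by exists 0 => D _; rewrite big1// => x _; rewrite mulr0.
  exists (C + B) => D uD /=.
  apply: (@le_trans _ _ (\sum_(x <- D) wt x * (w x + avg (m' k) x))).
    apply: ler_sum => x _; rewrite ler_wpM2l ?(ltW (wt_gt0 _))//.
    apply: le_trans (key k x); rewrite lerDl mulr_ge0// mulr_ge0//.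
    exact: ltW.
  under eq_bigr do rewrite mulrDr.
  by rewrite big_split/= lerD ?wC//; apply: bdd_total_avg.
(* The integral of the maximum, as a supremum over finite lists: finiteness is
what allows it to be cancelled below. *)
have [B HB] := bdd n.+1.
pose A : set R := [set r | exists2 D : seq S, uniq D & r = \sum_(x <- D) wt x * m n x].
have supA : has_sup A.
  split; first by exists 0, [::]; rewrite ?big_nil.
  by exists B => _ [D uD ->]; exact: HB.
have Asup D : uniq D -> \sum_(x <- D) wt x * m n x <= sup A.
  by move=> uD; apply: (sup_upper_bound supA); exists D.
suff : sup A <= C - lam * wt o * Pr n o + sup A by rewrite /Pr; lra.
apply: ge_sup; first by case: supA.
move=> _ [D uD ->].
pose D1 := undup (o :: D).
have uD1 : uniq D1 by exact: undup_uniq.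
have oD1 : o \in D1 by rewrite mem_undup mem_head.
apply: (@le_trans _ _ (\sum_(x <- D1) wt x * m n x)).
  apply: sub_sum_uniq => //.
    by move=> x xD; rewrite mem_undup inE xD orbT.
  by move=> x; rewrite mulr_ge0// ltW// wt_gt0.
rewrite addrAC lerBrDr.
have -> : lam * wt o * Pr n o =
    \sum_(x <- D1) wt x * (lam * (x == o)%:R * Pr n x).
  rewrite (bigD1_seq o)//= eqxx mulr1 big1 ?addr0; first by rewrite mulrA (mulrC lam).
  by move=> x /negPf ->; rewrite mulr0 mul0r mulr0.
rewrite -big_split/=.
apply: (@le_trans _ _ (\sum_(x <- D1) (wt x * w x + wt x * avg (m' n) x))).
  apply: ler_sum => x _.
  by rewrite -!mulrDr ler_wpM2l ?(ltW (wt_gt0 _))//; exact: key.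
rewrite big_split/= lerD ?wC//.
have [D' uD' /le_trans] := sum_wt_avg uD1 (m'_ge0 n).
apply; apply: le_trans (Asup _ uD').
by apply: ler_sum => x _; rewrite ler_wpM2l ?(ltW (wt_gt0 _)).
Qed.

End Paths.

(** * Occupation, martingales and Green functions between returns to the root *)

Section Excursions.
Context {R : realType} {S : choiceType} (N : network R S).
Implicit Types (x y z o : S) (l : seq S) (n k m K : nat) (F G s u : S -> R).
Local Notation wt := (wt N).
Local Notation trans := (trans N).
Local Notation avg := (avg N).
Local Notation pathE := (pathE N).
Local Notation bdd_total := (bdd_total N).

Lemma count_mem_rcons o l y :
  count_mem o (rcons l y) = (count_mem o l + (y == o))%N.
Proof. by rewrite -cats1 count_cat /= addn0. Qed.

(** Counting visits to o as long as there have been at most n of them gives at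
most n. The start counts as the first visit. *)
Lemma occupation_root o K n :
  \sum_(i < K) pathE i o (fun l => ((count_mem o (o :: l) <= n)%N && (last o l == o))%:R)
  <= n%:R.
Proof.
suff H : forall K, \sum_(i < K.+1) pathE i o
    (fun l => ((count_mem o (o :: l) <= n)%N && (last o l == o))%:R)
    <= pathE K o (fun l => (minn (count_mem o (o :: l)) n)%:R).
  case: K => [|K]; first by rewrite big_ord0.
  apply: le_trans (H K) _; rewrite -[leRHS](pathE_cst N _ K o).
  by apply: le_pathE => l _ _; rewrite ler_nat geq_minr.
elim=> [|{}K IH].
  by rewrite big_ord1 /= eqxx andbT ler_nat; lia.
rewrite big_ord_recr !pathE_rcons.
apply: le_trans (lerD IH (lexx _)) _; rewrite -pathED.
apply: le_pathE => l _ _; rewrite -[X in X + _](avg_cst N _ (last o l)) -avgD.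
apply: le_avg => y _; rewrite last_rcons -rcons_cons count_mem_rcons.
rewrite -natrD ler_nat; case: (y == o) => /=; lia.
Qed.

(** The visits to y during the first n excursions are counted up to time K
only, which allows an induction on K: for y <> o, a visit to y at time i + 1
arises from a position x at time i in the same excursion, and wt is invariant.
The truncation makes the occupation measure subinvariant, which is enough, and
avoids assuming recurrence. *)
Lemma occupation_bound o K n y :
  \sum_(i < K) pathE i o
     (fun l => (count_mem o (o :: l) <= n)%N%:R * (last o l == y)%:R)
  <= n%:R * (wt y / wt o).
Proof.
elim: K => [|K IHx] in y *.
  by rewrite big_ord0 mulr_ge0// divr_ge0// ltW// wt_gt0.
have [->|yo] := eqVneq y o.
  rewrite divff ?gt_eqF ?wt_gt0// mulr1; apply: le_trans (occupation_root o K.+1 n).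
  by apply: ler_sum => i _; apply: le_pathE => l _ _; rewrite -natrM mulnb.
rewrite big_ord_recl [X in X + _]/= (eq_sym o y) (negPf yo) mulr0 add0r.
have E i : pathE i.+1 o
      (fun l => (count_mem o (o :: l) <= n)%N%:R * (last o l == y)%:R) =
    \sum_(x <- nbr N y) trans x y * pathE i o
      (fun l => (count_mem o (o :: l) <= n)%N%:R * (last o l == x)%:R).
  rewrite sum_trans_last pathE_rcons; apply: eq_pathE => l _ _.
  rewrite -avg_pred1 -avgZ; apply: eq_avg => y' _.
  rewrite last_rcons -rcons_cons count_mem_rcons.
  case: (eqVneq y' y) => [->|]; last by rewrite !mulr0.
  by rewrite (negPf yo) addn0.
under eq_bigr do rewrite lift0 E.
rewrite exchange_big/=.
apply: (@le_trans _ _ (\sum_(x <- nbr N y) n%:R / wt o * (wt x * trans x y))).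
  apply: ler_sum => x _; rewrite -mulr_sumr.
  apply: le_trans (ler_wpM2l (trans_ge0 N x y) (IHx x)) _.
  by rewrite le_eqVlt; apply/orP; left; apply/eqP; ring.
rewrite -mulr_sumr.
under eq_bigr do rewrite detailed_balance.
rewrite -mulr_sumr trans_sum1 mulr1 le_eqVlt; apply/orP; left; apply/eqP.
by ring.
Qed.

(** States that can be reached in exactly n steps; they make the occupation of
the whole space a finite sum. *)
Fixpoint sphere n x : seq S :=
  if n is m.+1 then flatten [seq sphere m y | y <- nbr N x] else [:: x].

Lemma mem_sphere x l : path (step N) x l -> last x l \in sphere (size l) x.
Proof.
elim: l x => [|y l IH] x /=; first by rewrite mem_seq1 eqxx.
by move=> /andP[xy /IH yl]; apply/flattenP; exists (sphere (size l) y) => //; exact: map_f.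
Qed.

Lemma occupation_total o K n s C : (forall x, 0 <= s x) -> bdd_total s C ->
  \sum_(i < K) pathE i o (fun l => (count_mem o (o :: l) <= n)%N%:R * s (last o l))
  <= n%:R * (C / wt o).
Proof.
move=> s0 sC; pose D := undup (flatten [seq sphere i o | i <- iota 0 K]).
have uD : uniq D by exact: undup_uniq.
rewrite (eq_bigr (fun i : 'I_K => \sum_(y <- D) s y * pathE i o (fun l =>
    (count_mem o (o :: l) <= n)%N%:R * (last o l == y)%:R))); last first.
  move=> i _; under [RHS]eq_bigr do rewrite -pathEZ.
  rewrite -pathE_sum; apply: eq_pathE => l li ol.
  have lD : last o l \in D.
    rewrite mem_undup; apply/flattenP; exists (sphere i o).
      by apply: map_f; rewrite mem_iota /=.
    by rewrite -li mem_sphere.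
  rewrite (bigD1_seq (last o l))// (eqxx (last o l)) mulr1 mulrC big1 /= ?addr0//.
  by move=> y; rewrite eq_sym => /negPf ->; rewrite !mulr0.
rewrite exchange_big/=.
apply: (@le_trans _ _ (\sum_(y <- D) n%:R / wt o * (wt y * s y))).
  apply: ler_sum => y _; rewrite -mulr_sumr.
  apply: le_trans (ler_wpM2l (s0 y) (occupation_bound o K n y)) _.
  by rewrite le_eqVlt; apply/orP; left; apply/eqP; ring.
rewrite -mulr_sumr mulrA [in leRHS]mulrAC ler_wpM2l ?sC//.
by rewrite divr_ge0// ltW// wt_gt0.
Qed.

(** The martingale of the increments u(Y_{i+1}) - P u(Y_i) along the path o ::
l, stopped at the (n+1)-st visit to o. *)
Definition mart o n u l : R := \sum_(i < size l)
  (count_mem o (take i.+1 (o :: l)) <= n)%N%:R *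
    (u (nth o l i) - avg u (nth o (o :: l) i)).

Lemma mart_rcons o n u l y : mart o n u (rcons l y) =
  mart o n u l + (count_mem o (o :: l) <= n)%N%:R * (u y - avg u (last o l)).
Proof.
rewrite /mart size_rcons big_ord_recr/=; congr (_ + _).
  apply: eq_bigr => -[i /= il] _.
  rewrite -cats1 takel_cat ?(ltnW il)// nth_cat il.
  by rewrite -cat_cons nth_cat /= ltnS (ltnW il).
rewrite -cats1 take_size_cat// nth_cat ltnn subnn -cat_cons nth_cat /= ltnSn.
by rewrite -last_nth.
Qed.

(** Orthogonality of the increments; a conditional variance is at most a
conditional second moment. *)
Lemma mart_L2 o n u K : pathE K o (fun l => mart o n u l ^+ 2) <=
  \sum_(i < K) pathE i o (fun l => (count_mem o (o :: l) <= n)%N%:R *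
     avg (fun y => u y ^+ 2) (last o l)).
Proof.
elim: K => [|K IH]; first by rewrite big_ord0 /= /mart big_ord0 expr0n.
rewrite big_ord_recr pathE_rcons; apply: le_trans (lerD IH (lexx _)).
rewrite -pathED; apply: le_pathE => l _ _.
set z := last o l; set t := (X in _ + X * _); set Z := mart o n u l.
have tt : t ^+ 2 = t by rewrite /t; case: (_ <= _)%N; rewrite ?expr1n ?expr0n.
rewrite (_ : avg _ z = Z ^+ 2 + t * avg (fun y => u y ^+ 2) z - t * (avg u z) ^+ 2); last first.
  rewrite (eq_avg (G := fun y => (Z ^+ 2 - 2 * Z * t * avg u z + t * avg u z ^+ 2)
      + ((2 * Z * t - 2 * t * avg u z) * u y + t * u y ^+ 2))); last first.
    by move=> y _; rewrite mart_rcons -/z -/t -/Z sqrrD exprMn tt; ring.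
  by rewrite avgD avg_cst avgD !avgZ; ring.
by rewrite gerBl mulr_ge0 ?sqr_ge0// ler0n.
Qed.

Lemma mart_L2_bound o n u K C : bdd_total (fun y => u y ^+ 2) C ->
  pathE K o (fun l => mart o n u l ^+ 2) <= n%:R * (C / wt o).
Proof.
move=> uC; apply: le_trans (mart_L2 _ _ _ _) _.
apply: occupation_total; first by move=> x; apply: avg_ge0 => y; exact: sqr_ge0.
by apply: bdd_total_avg => // y; exact: sqr_ge0.
Qed.

(** Probability that the walk from z avoids o at the times 1, ..., k. *)
Definition surv o k z : R := pathE k z (fun l => (o \notin l)%:R).

(** Density with respect to wt of the walk from z killed at o, at time k, up to
the factor wt z. By reversibility it is also the probability of being at z at
time k when starting from x without having been at o before, whence it is at
most 1. *)
Definition killed o z k x : R := wt z / wt x *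
  pathE k z (fun l => (o \notin l)%:R * (last z l == x)%:R).

Lemma surv_ge0 o k z : 0 <= surv o k z.
Proof. exact: pathE_ge0. Qed.

Lemma surv_le1 o k z : surv o k z <= 1.
Proof. by rewrite -(pathE_cst N 1 k z); apply: le_pathE => l _ _; rewrite lern1 leq_b1. Qed.

Lemma survS o k z : surv o k.+1 z = avg (fun y => (y != o)%:R * surv o k y) z.
Proof.
apply: eq_avg => y _; rewrite -pathEZ; apply: eq_pathE => l _ _.
by rewrite inE negb_or -natrM mulnb eq_sym.
Qed.

Lemma surv_rcons o k z : surv o k.+1 z =
  surv o k z - pathE k z (fun l => (o \notin l)%:R * trans (last z l) o).
Proof.
apply/eqP; rewrite eq_sym subr_eq; apply/eqP; rewrite /surv pathE_rcons -pathED.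
apply: eq_pathE => l _ _; rewrite -avg_pred1 -avgZ -avgD.
rewrite -[LHS](avg_cst N _ (last z l)); apply: eq_avg => y _.
rewrite mem_rcons inE negb_or (eq_sym o y).
by case: (y == o) => /=; rewrite ?mulr1 ?mulr0 ?add0r ?addr0.
Qed.

Lemma surv_nincr o k z : surv o k.+1 z <= surv o k z.
Proof.
rewrite surv_rcons gerBl; apply: pathE_ge0 => l _ _.
by rewrite mulr_ge0 ?trans_ge0.
Qed.

Lemma killed_ge0 o z k x : 0 <= killed o z k x.
Proof.
apply: mulr_ge0; first by rewrite divr_ge0// ltW// wt_gt0.
by apply: pathE_ge0 => l _ _; rewrite mulr_ge0.
Qed.

Lemma killed0 o z x : killed o z 0 x = (x == z)%:R.
Proof.
rewrite /killed /= mul1r eq_sym; case: eqVneq => [->|]; rewrite ?mulr0// mulr1.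
by rewrite divff// gt_eqF ?wt_gt0.
Qed.

Lemma killed_root o z k : z != o -> killed o z k o = 0.
Proof.
move=> zo; rewrite /killed (eq_pathE (g := fun=> 0)) ?pathE_cst ?mulr0//.
move=> l _ _; case: (eqVneq (last z l) o) => [lo|]; last by rewrite mulr0.
rewrite -lo (_ : _ \notin l = false) ?mul0r//; apply/negbTE; rewrite negbK.
have := mem_last z l; rewrite inE => /orP[|//]; rewrite lo => /eqP oz.
by rewrite oz eqxx in zo.
Qed.

Lemma avg_killed o z k x : avg (killed o z k) x = wt z / wt x *
  pathE k z (fun l => (o \notin l)%:R * trans (last z l) x).
Proof.
rewrite -sum_trans_last mulr_sumr; apply: eq_bigr => y _.
have /gt_eqF/negbT wx := wt_gt0 N x; have /gt_eqF/negbT wy := wt_gt0 N y.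
have e : trans x y * (wt z / wt y) = wt z / wt x * trans y x.
  by rewrite -[trans x y](mulKf wx) detailed_balance; field; rewrite wx wy.
by rewrite /killed mulrA e -mulrA.
Qed.

(** By reversibility the densities of the killed walk evolve by P itself. *)
Lemma avg_killedS o z k x : x != o -> avg (killed o z k) x = killed o z k.+1 x.
Proof.
move=> xo; rewrite avg_killed /killed; congr (_ * _).
rewrite pathE_rcons; apply: eq_pathE => l _ _.
rewrite -avg_pred1 -avgZ; apply: eq_avg => y _.
rewrite last_rcons mem_rcons inE negb_or.
case: (eqVneq y x) => [->|]; last by rewrite !mulr0.
by rewrite eq_sym xo.
Qed.

Lemma avg_killed_root o z k :
  avg (killed o z k) o = wt z / wt o * (surv o k z - surv o k.+1 z).
Proof. by rewrite avg_killed surv_rcons; congr (_ * _); ring. Qed.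

Lemma killed_le1 o z k x : z != o -> killed o z k x <= 1.
Proof.
move=> zo; elim: k => [|k IH] in x *; first by rewrite killed0 lern1 leq_b1.
have [->|xo] := eqVneq x o; first by rewrite killed_root.
rewrite -avg_killedS// -(avg_cst N 1 x); apply: le_avg => y _; exact: IH.
Qed.

(** The integral of the density is the survival probability, which tends to 0
for a recurrent walk. *)
Lemma bdd_total_killed o z k : bdd_total (killed o z k) (wt z * surv o k z).
Proof.
move=> D uD.
rewrite (eq_bigr (fun x => wt z * pathE k z
    (fun l => (o \notin l)%:R * (last z l == x)%:R))); last first.
  move=> x _; rewrite /killed; have /gt_eqF/negbT wx := wt_gt0 N x.
  by rewrite mulrA [wt x * _]mulrC divfK.
rewrite -mulr_sumr ler_wpM2l ?(ltW (wt_gt0 _ _))// -pathE_sum.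
apply: le_pathE => l _ _; rewrite -mulr_sumr ler_piMr//.
have [lD|lD] := boolP (last z l \in D).
  rewrite (bigD1_seq (last z l))//= eqxx big1 ?addr0//.
  by move=> y; rewrite eq_sym => /negPf ->.
rewrite big_seq big1// => y yD; case: eqVneq => // ly.
by rewrite ly yD in lD.
Qed.

Definition green o z m x : R := \sum_(i < m) killed o z i x.

Lemma green_ge0 o z m x : 0 <= green o z m x.
Proof. by apply: sumr_ge0 => i _; exact: killed_ge0. Qed.

Lemma green_le o z m x : z != o -> green o z m x <= m%:R.
Proof.
move=> zo; rewrite -[leRHS]mulr1 mulr_natl -[in leRHS](card_ord m) -sumr_const.
by apply: ler_sum => i _; exact: killed_le1.
Qed.

(** The sum over k < m of [killed] k minus its image under P telescopes: off
the root, P maps [killed] k to [killed] k+1; at the root it collects the mass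
that is killed, namely the decrements of the survival probability. *)
Lemma green_poisson o z m x : z != o ->
  green o z m x - avg (green o z m) x =
  (x == z)%:R - wt z / wt o * (1 - surv o m z) * (x == o)%:R - killed o z m x.
Proof.
move=> zo; rewrite /green avg_sum -sumrB.
have [->|xo] := eqVneq x o.
  rewrite eq_sym (negPf zo) mulr1 sub0r killed_root// subr0.
  rewrite (eq_bigr (fun i : 'I_m => - (wt z / wt o * (surv o i z - surv o i.+1 z)))); last first.
    by move=> i _; rewrite killed_root// avg_killed_root sub0r.
  rewrite sumrN -mulr_sumr; congr (- (_ * _)).
  elim: m => [|m IH]; first by rewrite big_ord0 /surv /= subrr.
  by rewrite big_ord_recr/= IH; ring.
rewrite mulr0 subr0 -(killed0 o).
elim: m => [|m IH]; first by rewrite big_ord0 subrr.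
by rewrite big_ord_recr/= IH avg_killedS//; ring.
Qed.

(** The function is at most m and its integral at most m wt z. *)
Lemma bdd_total_green2 o z m : z != o ->
  bdd_total (fun x => green o z m x ^+ 2) (m%:R * (m%:R * wt z)).
Proof.
move=> zo D uD.
apply: (@le_trans _ _ (m%:R * \sum_(x <- D) wt x * green o z m x)).
  rewrite mulr_sumr; apply: ler_sum => x _.
  rewrite [leRHS]mulrCA; apply: ler_wpM2l; first exact/ltW/wt_gt0.
  by rewrite expr2; apply: ler_wpM2r; rewrite ?green_ge0 ?green_le.
rewrite ler_wpM2l//.
under eq_bigr do rewrite /green mulr_sumr.
rewrite exchange_big/= mulr_natl -[in leRHS](card_ord m) -sumr_const.
apply: ler_sum => i _; apply: le_trans (bdd_total_killed o z i uD) _.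
by rewrite ler_piMr ?surv_le1// ltW// wt_gt0.
Qed.

End Excursions.

(** * Recurrence from cutoffs of small energy *)

Lemma cvg_sum_seq (R : realType) (I : Type) (r : seq I) (f : I -> nat -> R) (l : I -> R) :
  (forall i, f i n @[n --> \oo] --> l i) ->
  \sum_(i <- r) f i n @[n --> \oo] --> \sum_(i <- r) l i.
Proof.
move=> fl; elim: r => [|i r IH].
  rewrite big_nil; under eq_fun do rewrite big_nil; exact: cvg_cst.
by rewrite big_cons; under eq_fun do rewrite big_cons; exact: cvgD.
Qed.

Section Recurrence.
Context {R : realType} {S : choiceType} (N : network R S).
Implicit Types (x y z o : S) (D : seq S) (phi u : S -> R).
Local Notation wt := (wt N).
Local Notation avg := (avg N).
Local Notation surv := (surv N).

(** Every edge is counted twice, once from each end. *)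
Definition energy phi D : R :=
  \sum_(x <- D) \sum_(y <- D) cond N x y * (phi x - phi y) ^+ 2.

Definition surv_lim o x : R := inf (range (fun k => surv o k x)).

Lemma surv_cvg o x : surv o k x @[k --> \oo] --> surv_lim o x.
Proof.
apply: nonincreasing_cvgn.
  by apply/nonincreasing_seqP => k; exact: surv_nincr.
by exists 0 => _ [k _ <-]; exact: surv_ge0.
Qed.

Lemma surv_lim_ge0 o x : 0 <= surv_lim o x.
Proof.
apply: lb_le_inf; first by exists (surv o 0 x), 0%N.
by move=> _ [k _ <-]; exact: surv_ge0.
Qed.

Lemma surv_lim_le1 o x : surv_lim o x <= 1.
Proof.
apply: le_trans (surv_le1 N o 0 x); apply: ge_inf; last by exists 0%N.
by exists 0 => _ [k _ <-]; exact: surv_ge0.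
Qed.

(** The probability of never returning, set to 0 at the root, is harmonic off
the root. *)
Lemma surv_lim_harmonic o x :
  surv_lim o x = avg (fun y => (y != o)%:R * surv_lim o y) x.
Proof.
have h1 : surv o k.+1 x @[k --> \oo] --> surv_lim o x.
  by have := @surv_cvg o x; rewrite -(cvg_shiftS (fun k => surv o k x)).
apply: (norm_cvg_unique h1).
rewrite (_ : (fun k => _) = fun k => avg (fun y => (y != o)%:R * surv o k y) x).
  apply: cvg_sum_seq => y; apply: cvgMl_tmp; apply: cvgMl_tmp.
  exact: surv_cvg.
by apply/funext => k; rewrite survS.
Qed.

(** For u harmonic off o and null at o, summation by parts shows that the
energy of phi u equals the sum of cond x y * u x * u y * (phi x - phi y) ^ 2,
so that it is at most the energy of phi when u has values in [0, 1]. The terms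
that vanish by harmonicity are T and its mirror image T'. *)
Lemma caccioppoli o u phi D (eps : R) : uniq D ->
  (forall x, x != o -> u x = avg u x) -> u o = 0 ->
  (forall x, 0 <= u x <= 1) ->
  (forall x, x \notin D -> phi x = 0) ->
  (forall D', uniq D' -> energy phi D' <= eps) ->
  forall x y, cond N x y * (phi x * u x - phi y * u y) ^+ 2 <= eps.
Proof.
move=> uD uh uo u01 phiD en x0 y0.
have [->|xy0] := eqVneq x0 y0.
  by rewrite subrr expr0n mulr0; apply: le_trans (en [::] isT); rewrite /energy big_nil.
pose D' := undup ([:: x0; y0] ++ D ++ flatten [seq nbr N x | x <- D]).
have uD' : uniq D' by exact: undup_uniq.
have x0D : x0 \in D' by rewrite mem_undup mem_head.
have y0D : y0 \in D' by rewrite mem_undup !inE eqxx orbT.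
pose T := \sum_(x <- D') \sum_(y <- D') cond N x y * (u x - u y) * (phi x ^+ 2 * u x).
have T0 : T = 0.
  rewrite /T big1 // => x _; rewrite -mulr_suml.
  have [->|xo] := eqVneq x o; first by rewrite uo !mulr0.
  have [xD|xD] := boolP (x \in D); last by rewrite phiD// expr0n !mul0r mulr0.
  suff -> : \sum_(y <- D') cond N x y * (u x - u y) = wt x * (u x - avg u x).
    by rewrite -uh// subrr mulr0 mul0r.
  rewrite (bigID (mem (nbr N x)))/= [X in _ + X]big1 ?addr0; last first.
    by move=> y yx; rewrite cond_eq0 ?mul0r.
  transitivity (\sum_(y <- nbr N x) cond N x y * (u x - u y)).
    rewrite -[LHS]big_filter; apply: perm_big; apply: uniq_perm.
    - by rewrite filter_uniq.
    - exact: nbr_uniq.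
    - move=> y; rewrite mem_filter; case: (boolP (y \in nbr N x)) => //= yx.
      rewrite mem_undup !mem_cat; apply/orP; right; apply/orP; right.
      by apply/flattenP; exists (nbr N x) => //; exact: map_f.
  rewrite mulrBr /avg mulr_sumr {1}/wt mulr_suml -sumrB.
  by apply: eq_bigr => y _; rewrite mulrA wt_trans mulrBr.
pose T' := \sum_(x <- D') \sum_(y <- D') cond N x y * (u y - u x) * (phi y ^+ 2 * u y).
have T0' : T' = 0.
  rewrite -[RHS]T0 /T /T' [LHS]exchange_big/=; apply: eq_bigr => x _.
  by apply: eq_bigr => y _; rewrite cond_sym.
have E : \sum_(x <- D') \sum_(y <- D') cond N x y * (phi x * u x - phi y * u y) ^+ 2 =
    \sum_(x <- D') \sum_(y <- D') cond N x y * (u x * u y * (phi x - phi y) ^+ 2).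
  transitivity (\sum_(x <- D') \sum_(y <- D')
      cond N x y * (u x * u y * (phi x - phi y) ^+ 2) + (T + T')); last first.
    by rewrite T0 T0' !addr0.
  rewrite /T /T' -!big_split/=; apply: eq_bigr => x _.
  by rewrite -!big_split/=; apply: eq_bigr => y _; ring.
apply: (@le_trans _ _ (energy phi D')); last exact: en.
apply: (@le_trans _ _ (\sum_(x <- D') \sum_(y <- D')
    cond N x y * (phi x * u x - phi y * u y) ^+ 2)).
  rewrite (bigD1_seq x0)//= (bigD1_seq y0)//= -addrA lerDl addr_ge0//.
    by apply: sumr_ge0 => y _; rewrite mulr_ge0 ?cond_ge0 ?sqr_ge0.
  by apply: sumr_ge0 => x _; apply: sumr_ge0 => y _; rewrite mulr_ge0 ?cond_ge0 ?sqr_ge0.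
rewrite E /energy; apply: ler_sum => x _; apply: ler_sum => y _.
rewrite ler_wpM2l ?cond_ge0// ler_piMl ?sqr_ge0//.
have /andP[? ?] := u01 x; have /andP[? ?] := u01 y; exact: mulr_ile1.
Qed.

(** Liouville argument. Apply [caccioppoli] to the probability u of never
returning: if phi is close to 1 near an edge and has small energy, then u has a
small increment along this edge. Hence u is constant on the component C, and 0
as at the root. *)
Lemma recurrence_criterion o (C : set S) : C o ->
  (forall x y, C x -> y \in nbr N x -> C y) ->
  (forall u, (forall x y, C x -> y \in nbr N x -> u x = u y) ->
    forall x, C x -> u x = u o :> R) ->
  (forall eps x y, 0 < eps -> C x -> C y -> exists phi D,
    [/\ uniq D, forall z, z \notin D -> phi z = 0,
      1 - eps <= phi x <= 1, 1 - eps <= phi y <= 1 &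
      forall D', uniq D' -> energy phi D' <= eps]) ->
  forall x, C x -> surv o k x @[k --> \oo] --> (0 : R).
Proof.
move=> Co Ccl irr cut.
pose u x := (x != o)%:R * surv_lim o x.
have uo : u o = 0 by rewrite /u eqxx mul0r.
have ux x : x != o -> u x = surv_lim o x by move=> xo; rewrite /u xo mul1r.
have uh x : x != o -> u x = avg u x by move=> xo; rewrite ux// surv_lim_harmonic.
have u01 x : 0 <= u x <= 1.
  rewrite /u; case: (x == o); rewrite /= ?mul0r ?lexx ?ler01// mul1r.
  by rewrite surv_lim_ge0 surv_lim_le1.
have edge x y : C x -> y \in nbr N x -> u x = u y.
  move=> Cx xy; apply/eqP; apply: contraT; rewrite -subr_eq0 -normr_gt0.
  set del := `|_| => del0.
  have cxy := cond_gt0 xy.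
  pose eps := Num.min (del / 4) (cond N x y * del ^+ 2 / 8).
  have eps0 : 0 < eps by rewrite lt_min !divr_gt0// mulr_gt0// exprn_gt0.
  have [phi [D [uD pD /andP[x1 x2] /andP[y1 y2] en]]] := cut eps x y eps0 Cx (Ccl _ _ Cx xy).
  have := caccioppoli uD uh uo u01 pD en x y.
  have /andP[ux0 ux1] := u01 x; have /andP[uy0 uy1] := u01 y.
  have e1 : eps <= del / 4 by rewrite /eps ge_min lexx.
  have e2 : eps <= cond N x y * del ^+ 2 / 8 by rewrite /eps ge_min lexx orbT.
  have hx : 0 <= (1 - phi x) * u x <= eps.
    apply/andP; split; first by rewrite mulr_ge0// subr_ge0.
    by apply: le_trans (_ : eps * 1 <= _); [apply: ler_pM => //; lra|lra].
  have hy : 0 <= (1 - phi y) * u y <= eps.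
    apply/andP; split; first by rewrite mulr_ge0// subr_ge0.
    by apply: le_trans (_ : eps * 1 <= _); [apply: ler_pM => //; lra|lra].
  have : del / 2 <= `|phi x * u x - phi y * u y|.
    have : del <= `|phi x * u x - phi y * u y| + `|(1 - phi x) * u x - (1 - phi y) * u y|.
      have e : u x - u y = (phi x * u x - phi y * u y) + ((1 - phi x) * u x - (1 - phi y) * u y).
        by ring.
      by rewrite /del {1}e; exact: ler_normD.
    have : `|(1 - phi x) * u x - (1 - phi y) * u y| <= eps by rewrite ler_norml; lra.
    lra.
  move=> h1 h2.
  have h3 : (del / 2) ^+ 2 <= (phi x * u x - phi y * u y) ^+ 2.
    by rewrite -[leRHS]real_normK ?num_real// lerXn2r// ?nnegrE// divr_ge0// ltW.
  have h4 : cond N x y * (del / 2) ^+ 2 <= cond N x y * del ^+ 2 / 8.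
    by apply: le_trans e2; apply: le_trans h2; rewrite ler_wpM2l// ltW.
  have h5 : 0 < cond N x y * del ^+ 2 by rewrite mulr_gt0// exprn_gt0.
  suff : cond N x y * (del / 2) ^+ 2 = cond N x y * del ^+ 2 / 4 by lra.
  by field.
have u0 x : C x -> u x = 0 by move=> /(irr u edge) ->.
move=> x Cx; suff <- : surv_lim o x = 0 by exact: surv_cvg.
rewrite surv_lim_harmonic -[RHS](avg_cst N 0 x); apply: eq_avg => y xy.
by apply: u0; apply: Ccl Cx xy.
Qed.

End Recurrence.

(** * Averages along squares under a second moment bound *)

Section SquareSubsequence.
Context d (T : measurableType d) (R : realType) (P : probability T R).

Lemma sum_inv_square_le2 N : \sum_(n < N) (n.+1%:R ^- 2 : R) <= 2.
Proof.
suff H m : \sum_(n < m.+1) (n.+1%:R ^- 2 : R) <= 2 - m.+1%:R^-1.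
  case: N => [|N]; first by rewrite big_ord0.
  by apply: le_trans (H N) _; rewrite gerBl invr_ge0.
elim: m => [|m IH]; first by rewrite big_ord1 expr1n !invr1; lra.
rewrite big_ord_recr/=; apply: le_trans (lerD IH (lexx _)) _.
set a : R := m.+1%:R; have a0 : 0 < a by rewrite ltr0n.
rewrite (_ : m.+2%:R = a + 1 :> R); last by rewrite natr1.
rewrite -lerBrDl -subr_ge0.
rewrite (_ : _ - _ = (a * (a + 1) ^+ 2)^-1); first by rewrite invr_ge0 mulr_ge0 ?sqr_ge0// ltW.
by field; rewrite !gt_eqF// addr_gt0.
Qed.

Lemma le_limn_einf (u : nat -> \bar R) (a : \bar R) K0 :
  (forall K, (K0 <= K)%N -> (a <= u K)%E) -> (a <= limn_einf u)%E.
Proof.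
move=> h; rewrite limn_einf_lim; apply: lime_ge.
  exact: is_cvg_einfs.
exists K0 => // n /= K0n; apply: le_ereal_inf_tmp => _ [m /= nm <-].
by apply: h; exact: leq_trans nm.
Qed.

Lemma limn_einf_le (u : nat -> \bar R) (a : \bar R) :
  (forall K, (u K <= a)%E) -> (limn_einf u <= a)%E.
Proof.
move=> h; rewrite limn_einf_lim; apply: lime_le.
  exact: is_cvg_einfs.
near=> n; apply: le_trans (h n); apply: ereal_inf_lbound.
by exists n => //=.
Unshelve. all: by end_near. Qed.

(** With second moments at most C n, the sum over n of the squares of
Z_{(n+1)^2} / (n+1)^2 has expectation at most 2 C, so that it is almost surely
finite and its terms tend to 0. The bound is available only for the truncation
Z n K at time K of the limit object, and is carried over by Fatou. *)
Lemma L2_squares_cvg0 (Z : nat -> nat -> T -> R) (Zoo : nat -> T -> R) (C : R) :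
  (forall n K, measurable_fun setT (Z n K)) ->
  (forall n K, (\int[P]_w (Z n K w ^+ 2)%:E <= (n%:R * C)%:E)%E) ->
  {ae P, forall w, forall n, exists K0, forall K, (K0 <= K)%N -> Z n K w = Zoo n w} ->
  {ae P, forall w, Zoo (n.+1 ^ 2)%N w / (n.+1 ^ 2)%:R @[n --> \oo] --> 0}.
Proof.
move=> mZ ZC ZZ.
pose F K w : \bar R :=
  (\sum_(n < K) (((n.+1 ^ 2)%:R ^- 2)%:E * (Z (n.+1 ^ 2)%N K w ^+ 2)%:E))%E.
have mF K : measurable_fun setT (F K).
  apply: emeasurable_sum => n; apply: measurable_funeM; apply/measurable_EFinP.
  exact: measurable_funX.
have F0 K w : (0 <= F K w)%E.
  by apply: sume_ge0 => n _; rewrite -EFinM lee_fin mulr_ge0 ?invr_ge0 ?sqr_ge0// exprn_ge0.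
have iF K : (\int[P]_w F K w <= (2 * `|C|)%:E)%E.
  rewrite ge0_integral_sum//; last 2 first.
  - move=> n; apply: measurable_funeM; apply/measurable_EFinP.
    exact: measurable_funX.
  - by move=> n w _; rewrite -EFinM lee_fin mulr_ge0 ?invr_ge0 ?sqr_ge0// exprn_ge0.
  apply: (@le_trans _ _ (\sum_(n < K) ((n.+1%:R ^- 2 * `|C|)%:E))%E).
    apply: lee_sum => n _; rewrite ge0_integralZl//; last 2 first.
    - by apply/measurable_EFinP; exact: measurable_funX.
    - by move=> w _; rewrite lee_fin sqr_ge0.
    apply: (@le_trans _ _ (((n.+1 ^ 2)%:R ^- 2)%:E * ((n.+1 ^ 2)%:R * C)%:E)%E).
      by rewrite lee_wpmul2l// lee_fin invr_ge0 exprn_ge0.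
    rewrite -EFinM lee_fin natrX.
    have a0 : 0 < n.+1%:R :> R by rewrite ltr0n.
    rewrite (_ : _ * _ = n.+1%:R ^- 2 * C); last by field; rewrite gt_eqF.
    by rewrite ler_wpM2l ?ler_norm// invr_ge0 exprn_ge0// ltW.
  by rewrite sumEFin lee_fin -mulr_suml ler_wpM2r// sum_inv_square_le2.
have iL : (\int[P]_w limn_einf (F ^~ w) <= (2 * `|C|)%:E)%E.
  apply: le_trans (fatou P measurableT mF (fun n x _ => F0 n x)) _.
  exact: limn_einf_le.
have mL : measurable_fun setT (fun w => limn_einf (F ^~ w)).
  apply: (emeasurable_fun_cvg (fun n w => einfs (F ^~ w) n)).
    by move=> n; exact: measurable_fun_einfs.
  by move=> w _; rewrite limn_einf_lim; exact: is_cvg_einfs.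
have L0 w : (0 <= limn_einf (F ^~ w))%E by apply: (@le_limn_einf _ _ 0).
have intL : P.-integrable setT (fun w => limn_einf (F ^~ w)).
  apply/integrableP; split => //.
  under eq_integral do rewrite gee0_abs//.
  by apply: le_lt_trans iL _; rewrite ltry.
have := integrable_ae measurableT intL.
apply: filterS2 ZZ => w Zw /(_ I) fL.
pose a n : R := (Zoo (n.+1 ^ 2)%N w / (n.+1 ^ 2)%:R) ^+ 2.
have a0 n : 0 <= a n by rewrite sqr_ge0.
have sumle N : \sum_(0 <= n < N) a n <= fine (limn_einf (F ^~ w)).
  have [K0 HK0] : exists K0 : nat -> nat, forall n K, (K0 n <= K)%N -> Z n K w = Zoo n w.
    by have /choice[K0 ?] := Zw; exists K0.
  rewrite -lee_fin fineK//.
  apply: (@le_limn_einf _ _ (maxn N (\max_(n < N) K0 (n.+1 ^ 2)%N))) => K.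
  rewrite geq_max => /andP[NK /bigmax_leqP K0K].
  rewrite /F -(big_mkord xpredT (fun n =>
      ((n.+1 ^ 2)%:R ^- 2)%:E * (Z (n.+1 ^ 2)%N K w ^+ 2)%:E)%E).
  rewrite (big_cat_nat _ NK)//= -[leLHS]adde0 leeD//; last first.
    apply: sume_ge0 => n _.
    by rewrite -EFinM lee_fin mulr_ge0 ?invr_ge0 ?sqr_ge0// exprn_ge0.
  rewrite -sumEFin [leLHS]big_nat [leRHS]big_nat; apply: lee_sum => n /= nN.
  rewrite (HK0 _ K) ?(K0K (Ordinal nN))// -EFinM lee_fin /a expr_div_n.
  by rewrite mulrC.
have ca : cvgn (series a).
  apply: nondecreasing_is_cvgn.
    by apply/nondecreasing_seqP => n; rewrite /series/= big_nat_recr//= lerDl.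
  by exists (fine (limn_einf (F ^~ w))) => _ [n _ <-]; exact: sumle.
have /cvgrPdist_lt a_0 := cvg_series_cvg_0 ca.
apply/cvgrPdist_lt => e e0; near=> n.
have : `|0 - a n| < e ^+ 2 by near: n; apply: a_0; rewrite exprn_gt0.
rewrite !sub0r !normrN /a normrX => h.
by rewrite ltNge; apply/negP => /(lerXn2r 2 (ltW e0 : e \in Num.nneg) (normr_ge0 _))
    /(lt_le_trans h); rewrite ltxx.
Unshelve. all: by end_near. Qed.
End SquareSubsequence.

(** * Moments of exponential variables from their tails *)

Section LayerCake.
Context d (T : measurableType d) (R : realType) (P : probability T R).
Local Open Scope ereal_scope.
Local Notation leb := (@lebesgue_measure R).
Local Notation D := (`[0%R, +oo[%classic : set R).

(** Tonelli. The factor G allows the formula to be iterated. *)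
Lemma layer_cake (G : T -> \bar R) (H : T -> R) :
  measurable_fun setT G -> (forall w, 0 <= G w) ->
  measurable_fun setT H -> (forall w, 0 <= H w)%R ->
  \int[P]_w (G w * (H w)%:E) =
  \int[leb]_(t in D) \int[P]_w (G w * (\1_[set w | (t < H w)%R] w)%:E).
Proof.
move=> mG G0 mH H0.
pose M := measurableTypeR R.
pose E : set (T * M) := [set p | (0 <= p.2 :> R)%R /\ (p.2 < H p.1 :> R)%R].
have mE : measurable E.
  rewrite (_ : E = (fun p : T * M => 0 <= p.2 :> R)%R @^-1` [set true] `&`
      (fun p : T * M => p.2 < H p.1 :> R)%R @^-1` [set true]).
    apply: measurableI.
    - have : measurable_fun setT (fun p : T * M => 0 <= p.2 :> R)%R.
        exact: measurable_fun_ler.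
      by move=> /(_ measurableT [set true]); rewrite setTI; exact.
    - have : measurable_fun setT (fun p : T * M => p.2 < H p.1 :> R)%R.
        by apply: measurable_fun_ltr => //; apply: measurableT_comp.
      by move=> /(_ measurableT [set true]); rewrite setTI; exact.
  by apply/seteqP; split => p /=.
pose f (p : T * M) := G p.1 * (\1_E p)%:E.
have mf : measurable_fun setT f.
  apply: emeasurable_funM; first exact: measurableT_comp.
  by apply/measurable_EFinP; exact: measurable_indic.
have f0 p : 0 <= f p by rewrite mule_ge0// lee_fin.
have := fubini_tonelli (m1 := P) (m2 := leb) f mf f0.
have inner w : \int[leb]_y f (w, y) = G w * (H w)%:E.
  transitivity (\int[leb]_y (G w * (\1_(`[0%R, H w[%classic) y)%:E)).
    apply: eq_integral => t _; rewrite /f /= !indicE.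
    suff -> : ((w, t) \in E) = (t \in (`[0%R, H w[%classic : set R)) by [].
    by apply/idP/idP; rewrite !inE /E /= in_itv /= => /andP.
  have m1 : measurable_fun setT (fun y : R => (\1_(`[0%R, H w[%classic) y)%:E : \bar R).
    by apply/measurable_EFinP; exact: measurable_indic.
  rewrite ge0_integralZl//.
  rewrite integral_indic// setIT [X in _ * X]
      (lebesgue_measure_itv (Interval (BLeft 0%R) (BLeft (H w)))) /= lte_fin.
  case: ltP => h; first by rewrite oppr0 adde0.
  by congr (_ * _%:E); apply/le_anti; rewrite h H0.
rewrite (eq_integral (fun w => G w * (H w)%:E)); last by move=> w _; exact: inner.
move=> ->; rewrite [RHS]integral_mkcond; apply: eq_integral => t _.
rewrite patchE; case: ifPn => [|tD].
  rewrite inE /= in_itv/= andbT => t0; apply: eq_integral => w _.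
  rewrite /f /= !indicE.
  suff -> : ((w, t) \in E) = (w \in [set w | (t < H w)%R]) by [].
  by apply/idP/idP; rewrite !inE /E /=; [case|split].
apply: integral0_eq => w _; rewrite /f /= indicE (_ : _ \in E = false) ?mule0//.
apply/negP; rewrite inE /E /= => -[t0 _]; move/negP: tD; apply.
by rewrite inE /= in_itv/= t0.
Qed.

Lemma integral_tail (B : set T) (H : T -> R) : measurable B ->
  measurable_fun setT H -> (forall w, 0 <= H w)%R ->
  \int[P]_(w in B) (H w)%:E = \int[leb]_(t in D) P (B `&` [set w | (t < H w)%R]).
Proof.
move=> mB mH H0.
have mlt t : measurable [set w | (t < H w)%R].
  have : measurable_fun setT (fun w => t < H w)%R by exact: measurable_fun_ltr.
  by move=> /(_ measurableT [set true]); rewrite setTI; exact.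
rewrite integral_mkcond.
transitivity (\int[P]_w ((\1_B w)%:E * (H w)%:E)).
  apply: eq_integral => w _; rewrite patchE indicE.
  by case: ifPn => wB; rewrite ?mul1e ?mul0e.
rewrite layer_cake//; last first.
  by apply/measurable_EFinP; exact: measurable_indic.
apply: eq_integral => t _.
rewrite -[X in P X]setIT -integral_indic//; last exact: measurableI.
by apply: eq_integral => w _; rewrite -EFinM indicI.
Qed.

Lemma integral_tail2 (B : set T) (H1 H2 : T -> R) : measurable B ->
  measurable_fun setT H1 -> (forall w, 0 <= H1 w)%R ->
  measurable_fun setT H2 -> (forall w, 0 <= H2 w)%R ->
  \int[P]_(w in B) (H1 w * H2 w)%:E =
  \int[leb]_(t in D) \int[leb]_(s in D)
     P (B `&` [set w | (t < H2 w)%R] `&` [set w | (s < H1 w)%R]).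
Proof.
move=> mB mH1 H10 mH2 H20.
have mlt t : measurable [set w | (t < H2 w)%R].
  have : measurable_fun setT (fun w => t < H2 w)%R by exact: measurable_fun_ltr.
  by move=> /(_ measurableT [set true]); rewrite setTI; exact.
rewrite integral_mkcond.
transitivity (\int[P]_w ((\1_B w)%:E * (H1 w)%:E * (H2 w)%:E)).
  apply: eq_integral => w _; rewrite patchE indicE.
  by case: ifPn => wB; rewrite ?mul1e ?mul0e// EFinM.
rewrite layer_cake//; last 2 first.
- apply: emeasurable_funM; last exact/measurable_EFinP.
  by apply/measurable_EFinP; exact: measurable_indic.
- by move=> w; rewrite mule_ge0// lee_fin.
apply: eq_integral => t _.
rewrite -integral_tail//; last exact: measurableI.
rewrite [RHS]integral_mkcond; apply: eq_integral => w _.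
rewrite patchE -!EFinM.
rewrite mulrAC; rewrite (_ : \1_B w * _ = \1_(B `&` [set w | (t < H2 w)%R]) w)%R; last first.
  by rewrite indicI.
by rewrite indicE; case: ifPn => _; rewrite ?mul1r ?mul0r.
Qed.

Lemma integral_expR (q c : R) : (0 < q)%R -> (0 <= c)%R ->
  \int[leb]_(t in D) (c * expR (- (q * t)))%:E = (c / q)%:E.
Proof.
move=> q0 c0.
transitivity (\int[leb]_(t in D) ((c / q)%:E * (exponential_pdf q t)%:E)).
  apply: eq_integral => t; rewrite inE /= in_itv/= andbT => t0.
  rewrite exponential_pdfE// -EFinM mulNr; congr EFin.
  by field; rewrite gt_eqF.
rewrite ge0_integralZl//; last 3 first.
- by apply/measurable_EFinP/measurable_funTS; exact: measurable_exponential_pdf.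
- by move=> t _; rewrite lee_fin exponential_pdf_ge0// ltW.
- by rewrite lee_fin divr_ge0// ltW.
rewrite integral_mkcond -[RHS]mule1 -(integral_exponential_pdf q0); congr (_ * _).
apply: eq_integral => t _; rewrite patchE; case: ifPn => //.
move=> tD; have t0 : (t < 0)%R.
  by rewrite ltNge; apply: contra tD => t0; rewrite inE /= in_itv/= t0.
by rewrite lt0_exponential_pdf.
Qed.

Lemma measurable_exp_rate d' (U : measurableType d') (g : U -> R) (c q : R) :
  measurable_fun setT g ->
  measurable_fun setT (fun w => c * expR (- (q * g w)))%R.
Proof.
move=> mg; apply: measurable_funM => //; apply: measurableT_comp => //.
by apply: measurable_funN; apply: measurable_funM.
Qed.

Lemma exp_moment1 (B : set T) (H : T -> R) (q c : R) : measurable B ->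
  measurable_fun setT H -> (forall w, 0 <= H w)%R -> (0 < q)%R -> (0 <= c)%R ->
  (forall t, (0 <= t)%R -> P (B `&` [set w | (t < H w)%R]) = (c * expR (- (q * t)))%:E) ->
  \int[P]_(w in B) (H w)%:E = (c / q)%:E.
Proof.
move=> mB mH H0 q0 c0 tail; rewrite integral_tail// -integral_expR//.
by apply: eq_integral => t; rewrite inE /= in_itv/= andbT => /tail.
Qed.

(** The variables are only known through their joint tails on the event B of
probability c, so that products are integrated by the layer cake formula. *)
Lemma exp_moment2 (B : set T) (H1 H2 : T -> R) (q1 q2 c : R) : measurable B ->
  measurable_fun setT H1 -> (forall w, 0 <= H1 w)%R ->
  measurable_fun setT H2 -> (forall w, 0 <= H2 w)%R ->
  (0 < q1)%R -> (0 < q2)%R -> (0 <= c)%R ->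
  (forall t s, (0 <= t)%R -> (0 <= s)%R ->
    P (B `&` [set w | (t < H2 w)%R] `&` [set w | (s < H1 w)%R])
    = (c * expR (- (q2 * t)) * expR (- (q1 * s)))%:E) ->
  \int[P]_(w in B) (H1 w * H2 w)%:E = (c / q1 / q2)%:E.
Proof.
move=> mB mH1 H10 mH2 H20 q10 q20 c0 tail.
rewrite integral_tail2// -integral_expR ?divr_ge0 ?(ltW q10)//.
apply: eq_integral => t; rewrite inE /= in_itv/= andbT => t0.
rewrite mulrAC -integral_expR ?mulr_ge0 ?expR_ge0//.
by apply: eq_integral => s; rewrite inE /= in_itv/= andbT => s0; exact: tail.
Qed.

(** The exact value has 2 in place of 4. The bound only uses the computation
for independent variables: the joint tail is exp (- q max (t, u)), and the
maximum is at least (t + u) / 2, as for two independent variables of rate q /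
2. *)
Lemma exp_moment2_le (B : set T) (H : T -> R) (q c : R) : measurable B ->
  measurable_fun setT H -> (forall w, 0 <= H w)%R -> (0 < q)%R -> (0 <= c)%R ->
  (forall t, (0 <= t)%R -> P (B `&` [set w | (t < H w)%R]) = (c * expR (- (q * t)))%:E) ->
  \int[P]_(w in B) (H w * H w)%:E <= (4 * (c / q / q))%:E.
Proof.
move=> mB mH H0 q0 c0 tail.
have mlt t : measurable [set w | (t < H w)%R].
  have : measurable_fun setT (fun w => t < H w)%R by exact: measurable_fun_ltr.
  by move=> /(_ measurableT [set true]); rewrite setTI; exact.
have q2 : (0 < q / 2)%R by rewrite divr_gt0.
rewrite integral_tail2//.
have -> : (4 * (c / q / q) = c / (q / 2) / (q / 2))%R by field; rewrite gt_eqF.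
have tail2 t u : (0 <= t)%R -> (0 <= u)%R ->
    P (B `&` [set w | (t < H w)%R] `&` [set w | (u < H w)%R]) =
    (c * expR (- (q * Num.max t u)))%:E.
  move=> t0 u0; rewrite -tail ?le_max ?t0// -setIA; congr (P (_ `&` _)).
  by apply/seteqP; split => w /=; rewrite gt_max => /andP.
pose f (p : measurableTypeR R * measurableTypeR R) : \bar R :=
  (\1_D p.2 * (c * expR (- (q * Num.max p.1 p.2))))%:E.
have mf : measurable_fun setT f.
  apply/measurable_EFinP; apply: measurable_funM.
    by apply: measurableT_comp => //; exact: measurable_indic.
  by apply: measurable_exp_rate; apply: measurable_maxr.
have f0 p : 0 <= f p by rewrite lee_fin mulr_ge0// mulr_ge0// expR_ge0.
have -> : \int[leb]_(t in D) \int[leb]_(u in D)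
     P (B `&` [set w | (t < H w)%R] `&` [set w | (u < H w)%R]) =
   \int[leb]_(t in D) \int[leb]_u f (t, u).
  apply: eq_integral => t; rewrite inE /= in_itv/= andbT => t0.
  rewrite integral_mkcond; apply: eq_integral => u _.
  rewrite patchE /f /= indicE; case: ifPn => uD; last by rewrite mul0r.
  by rewrite mul1r tail2//; move: uD; rewrite inE /= in_itv/= andbT.
rewrite -integral_expR ?divr_ge0 ?(ltW q2)//.
apply: ge0_le_integral => //.
- by move=> t _; apply: integral_ge0.
- apply: measurable_funTS.
  exact: (measurable_fun_fubini_tonelli_F (m2 := leb) f mf f0).
- by apply/measurable_EFinP/measurable_funTS; exact: measurable_exp_rate.
- move=> t; rewrite /= in_itv/= andbT => t0.
  rewrite mulrAC -integral_expR ?mulr_ge0 ?expR_ge0// [leRHS]integral_mkcond.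
  apply: ge0_le_integral => //.
  + exact: measurableT_comp mf _.
  + apply/(measurable_restrictT _ _).1 => //.
    by apply/measurable_EFinP/measurable_funTS; exact: measurable_exp_rate.
  + move=> u _; rewrite patchE /f/= indicE; case: ifPn => uD; rewrite ?mul0r//.
    rewrite lee_fin mul1r -[leRHS]mulrA -expRD ler_wpM2l// ler_expR.
    have : (t <= Num.max t u)%R by rewrite le_max lexx.
    have : (u <= Num.max t u)%R by rewrite le_max lexx orbT.
    by nra.
Unshelve. exact: ltW.
Qed.

End LayerCake.

(** * Independent exponential variables around their means *)

Section Noise.
Context d (T : measurableType d) (R : realType) (P : probability T R).

(** Variance of a weighted sum of independent exponentials on an event B, with
3 instead of 1 as constant since the second moments are estimated by 4 / q ^ 2.
Only joint tails on B of all the variables at once are given; the tail of a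
subfamily follows by taking the other thresholds equal to 0, because the
variables are almost surely positive on B. *)
Lemma exponential_noise_L2 (B : set T) (H : nat -> T -> R) (q c : nat -> R)
    (p : R) K :
  measurable B -> (forall i, measurable_fun setT (H i)) ->
  (forall i w, 0 <= H i w) -> (forall i, 0 < q i) -> (forall i, 0 <= c i) ->
  0 <= p -> P B = p%:E ->
  (forall t : nat -> R, (forall i, 0 <= t i) ->
    P (B `&` [set w | forall i, (i < K)%N -> t i < H i w]) =
    (p * \prod_(i < K) expR (- (q i * t i)))%:E) ->
  (\int[P]_(w in B) ((\sum_(i < K) c i * (H i w - (q i)^-1)) ^+ 2)%:E <=
   (3 * p * \sum_(i < K) c i ^+ 2 * (q i ^+ 2)^-1)%:E)%E.
Proof.
move=> mB mH H0 q0 c0 p0 PB tails.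
have mlt i t : measurable [set w | t < H i w].
  have : measurable_fun setT (fun w => t < H i w) by exact: measurable_fun_ltr.
  by move=> /(_ measurableT [set true]); rewrite setTI; exact.
pose pos := [set w | forall i, (i < K)%N -> 0 < H i w].
have mall (t : nat -> R) : measurable [set w | forall i, (i < K)%N -> t i < H i w].
  rewrite (_ : mkset _ = \bigcap_(i in [set i | (i < K)%N]) [set w | t i < H i w]).
    exact: bigcap_measurableType.
  by apply/seteqP; split => w.
have Ppos : P (B `\` pos) = 0%E.
  transitivity (P B - P (B `&` pos))%E.
    apply: measureD => //; first exact: (mall (fun=> 0)).
    by rewrite ltey_eq fin_num_measure.
  rewrite PB /pos (tails (fun=> 0))// big1 ?mulr1 ?subee// => i _.
  by rewrite mulr0 oppr0 expR0.
have tail_pos A : measurable A -> P (B `&` A) = P (B `&` (A `&` pos)).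
  move=> mA; rewrite (measureDI P _ (mall (fun=> 0))); last exact: measurableI.
  rewrite -/pos -[RHS]add0e setIA; congr (_ + _)%E.
  apply: (@subset_measure0 _ _ _ P _ (B `\` pos)) => //.
  - by apply: measurableD; [exact: measurableI|exact: mall].
  - by apply: measurableD => //; exact: mall.
  - by move=> w [[Bw Aw] pw].
have tail1 i t : (i < K)%N -> 0 <= t ->
    P (B `&` [set w | t < H i w]) = (p * expR (- (q i * t)))%:E.
  move=> iK t0; rewrite tail_pos//.
  have := tails (fun j => if j == i then t else 0).
  rewrite (bigD1 (Ordinal iK))//= eqxx big1 ?mulr1; last first.
    move=> j; rewrite -val_eqE /= => /negPf ->.
    by rewrite mulr0 oppr0 expR0.
  move=> <-; last by move=> j; case: ifP.
  congr (P (_ `&` _)); apply/seteqP; split => w /=.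
    by move=> [tw pw] j jK; case: eqP => [->|_] //; exact: pw.
  move=> h; split; first by have := h i iK; rewrite eqxx.
  by move=> j jK; have := h j jK; case: ifP => // _; apply: le_lt_trans.
have tail2 i j t u : (i < K)%N -> (j < K)%N -> i != j -> 0 <= t -> 0 <= u ->
    P (B `&` [set w | t < H j w] `&` [set w | u < H i w]) =
    (p * expR (- (q j * t)) * expR (- (q i * u)))%:E.
  move=> iK jK ij t0 u0; rewrite -setIA tail_pos//; last exact: measurableI.
  have := tails (fun k => if k == j then t else if k == i then u else 0).
  rewrite (bigD1 (Ordinal jK))//= eqxx (bigD1 (Ordinal iK))//=.
  rewrite (negPf ij) eqxx big1 ?mulr1; last first.
    move=> k; rewrite -!val_eqE /= => /andP[/negPf -> /negPf ->].
    by rewrite mulr0 oppr0 expR0.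
  rewrite mulrA => <-; last by move=> k; case: ifP => // _; case: ifP.
  congr (P (_ `&` _)); apply/seteqP; split => w /=.
    move=> [[tw uw] pw] k kK; case: eqP => [->|_] //; case: eqP => [->|_]//.
    exact: pw.
  move=> h; split; first split.
  - by have := h j jK; rewrite eqxx.
  - by have := h i iK; rewrite (negPf ij) eqxx.
  - move=> k kK; have := h k kK; case: ifP => _; first exact: le_lt_trans.
    by case: ifP => // _; exact: le_lt_trans.
pose S w := \sum_(i < K) c i * H i w.
pose m := \sum_(i < K) c i / q i.
pose V := \sum_(i < K) c i ^+ 2 * (q i ^+ 2)^-1.
have S0 w : 0 <= S w by apply: sumr_ge0 => i _; rewrite mulr_ge0.
have m0 : 0 <= m by apply: sumr_ge0 => i _; rewrite divr_ge0// ltW.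
have mS : measurable_fun setT S by apply: measurable_sum => i; exact: measurable_funM.
have iS : (\int[P]_(w in B) (S w)%:E = (p * m)%:E)%E.
  under eq_integral do rewrite /S -sumEFin.
  rewrite ge0_integral_sum//; last 2 first.
  - by move=> i; apply/measurable_EFinP/measurable_funTS; exact: measurable_funM.
  - by move=> i w _; rewrite lee_fin mulr_ge0.
  rewrite /m mulr_sumr -sumEFin; apply: eq_bigr => i _.
  under eq_integral do rewrite EFinM.
  rewrite ge0_integralZl//; last 3 first.
  - by apply/measurable_EFinP/measurable_funTS.
  - by move=> w _; rewrite lee_fin.
  - by rewrite lee_fin.
  rewrite (@exp_moment1 _ _ _ _ _ _ (q i) p)//; last by move=> t t0; exact: tail1.
  by rewrite -EFinM; congr EFin; ring.
have iSS : (\int[P]_(w in B) (S w * S w)%:E <= (p * (m ^+ 2 + 3 * V))%:E)%E.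
  have E w : (S w * S w)%:E =
      (\sum_(i < K) \sum_(j < K) (c i * c j)%:E * (H i w * H j w)%:E)%E.
    rewrite /S mulr_suml -sumEFin; apply: eq_bigr => i _.
    rewrite mulr_sumr -sumEFin; apply: eq_bigr => j _.
    by rewrite -EFinM; congr EFin; ring.
  under eq_integral do rewrite E.
  have mHH i j : measurable_fun B (fun w => (H i w * H j w)%:E).
    by apply/measurable_EFinP/measurable_funTS; exact: measurable_funM.
  have HH0 i j w : (0 <= (H i w * H j w)%:E)%E by rewrite lee_fin mulr_ge0.
  have cc0 i j : (0 <= (c i * c j)%:E)%E by rewrite lee_fin mulr_ge0.
  rewrite ge0_integral_sum//; last 2 first.
  - by move=> i; apply: emeasurable_sum => j; exact: measurable_funeM.
  - by move=> i w _; apply: sume_ge0 => j _; rewrite mule_ge0.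
  apply: (@le_trans _ _ (\sum_(i < K) \sum_(j < K)
     (p * (c i / q i * (c j / q j) + (i == j)%:R * (3 * (c i ^+ 2 * (q i ^+ 2)^-1))))%:E)%E).
    apply: lee_sum => i _; rewrite ge0_integral_sum//; last 2 first.
    - by move=> j; exact: measurable_funeM.
    - by move=> j w _; rewrite mule_ge0.
    apply: lee_sum => j _; rewrite ge0_integralZl//.
    have [->|ij] := eqVneq i j.
      apply: (@le_trans _ _ ((c j * c j)%:E * (4 * (p / q j / q j))%:E)%E).
        rewrite lee_wpmul2l//; apply: exp_moment2_le => // t t0.
        exact: tail1.
      rewrite -EFinM lee_fin mul1r le_eqVlt; apply/orP; left; apply/eqP.
      by field; rewrite gt_eqF.
    rewrite (@exp_moment2 _ _ _ _ _ _ _ (q i) (q j) p)//; last first.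
      by move=> t u t0 u0; apply: tail2.
    rewrite -EFinM lee_fin mul0r addr0 le_eqVlt; apply/orP; left; apply/eqP.
    by field; rewrite !gt_eqF.
  under eq_bigr do rewrite sumEFin.
  rewrite sumEFin lee_fin.
  under eq_bigr do rewrite -mulr_sumr big_split/=.
  rewrite -mulr_sumr big_split/= ler_wpM2l// lerD//.
    rewrite expr2 {1}/m mulr_suml; apply: ler_sum => i _.
    by rewrite /m mulr_sumr.
  rewrite /V mulr_sumr; apply: ler_sum => i _.
  by rewrite (bigD1 i)//= eqxx mul1r big1 ?addr0// => j /negPf; rewrite eq_sym => ->; rewrite mul0r.
have dev w : (\sum_(i < K) c i * (H i w - (q i)^-1)) = S w - m.
  by rewrite /S /m -sumrB; apply: eq_bigr => i _; rewrite mulrBr.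
under eq_integral do rewrite dev.
have mX : measurable_fun B (fun w => ((S w - m) ^+ 2)%:E).
  by apply/measurable_EFinP/measurable_funTS; apply: measurable_funX; exact: measurable_funB.
have iX : (\int[P]_(w in B) ((S w - m) ^+ 2)%:E + (2 * m * (p * m))%:E =
    \int[P]_(w in B) (S w * S w)%:E + (m ^+ 2 * p)%:E)%E.
  have -> : ((2 * m * (p * m))%:E = \int[P]_(w in B) ((2 * m)%:E * (S w)%:E))%E.
    rewrite ge0_integralZl ?iS// ?lee_fin ?mulr_ge0//.
    - exact/measurable_EFinP/measurable_funTS.
    - by move=> w _; rewrite lee_fin.
  have -> : ((m ^+ 2 * p)%:E = \int[P]_(w in B) (cst (m ^+ 2)%:E w))%E.
    by rewrite integral_cst// EFinM; congr (_ * _)%E; exact/esym.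
  have n1 w : B w -> (0 <= ((S w - m) ^+ 2)%:E)%E by rewrite lee_fin sqr_ge0.
  have n2 w : B w -> (0 <= (2 * m)%:E * (S w)%:E)%E by rewrite -EFinM lee_fin !mulr_ge0.
  have n3 w : B w -> (0 <= (S w * S w)%:E)%E by rewrite lee_fin mulr_ge0.
  have n4 w : B w -> (0 <= cst (m ^+ 2)%:E w)%E by rewrite lee_fin sqr_ge0.
  have m2 : measurable_fun B (fun w => (2 * m)%:E * (S w)%:E)%E.
    by apply: measurable_funeM; exact/measurable_EFinP/measurable_funTS.
  have m3 : measurable_fun B (fun w => (S w * S w)%:E).
    by apply/measurable_EFinP/measurable_funTS; exact: measurable_funM.
  rewrite -!ge0_integralD//.
  apply: eq_integral => w _; rewrite -EFinM -!EFinD; congr EFin.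
  by rewrite /cst; ring.
have : (\int[P]_(w in B) ((S w - m) ^+ 2)%:E + (2 * m * (p * m))%:E <=
   (3 * p * V)%:E + (2 * m * (p * m))%:E)%E.
  rewrite iX; apply: le_trans (leeD iSS (lexx _)) _.
  rewrite -!EFinD lee_fin le_eqVlt; apply/orP; left; apply/eqP; ring.
by rewrite leeD2rE.
Qed.
End Noise.

(** * Visits of a sequence to the root *)

Section Visits.
Context {S : choiceType} (o : S).
Implicit Types (y : nat -> S) (n i K : nat).

Definition visits y i : nat := count_mem o (mkseq y i).

Definition visits_io y := forall n, exists i, (n < visits y i.+1)%N.

(** Time of the visit numbered n + 1, hence the end of the first n excursions
when the sequence starts at o; the default 0 is for sequences with fewer
visits. *)
Definition tau y n : nat :=
  if pselect (exists i, (n < visits y i.+1)%N) is left h then ex_minn h else 0%N.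

Lemma visitsS y i : visits y i.+1 = (visits y i + (y i == o))%N.
Proof. by rewrite /visits mkseqS count_mem_rcons. Qed.

Lemma visits_homo y : {homo visits y : i j / (i <= j)%N}.
Proof.
move=> i j /subnKC <-; elim: (j - i)%N => [|k IH]; first by rewrite addn0.
by rewrite addnS visitsS; apply: leq_trans IH _; exact: leq_addr.
Qed.

Lemma ltn_tau y n i : visits_io y -> (i < tau y n)%N = (visits y i.+1 <= n)%N.
Proof.
move=> ry; rewrite /tau; case: pselect => [h|]; last by move=> []; exact: ry.
case: ex_minnP => m mn mmin; apply/idP/idP => [im|].
  by rewrite leqNgt; apply/negP => /mmin; rewrite leqNgt im.
apply: contraTT; rewrite -leqNgt -ltnNge => mi; apply: leq_trans mn _.
exact: visits_homo.
Qed.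

Lemma visits_tau y n : visits_io y -> visits y (tau y n) = n.
Proof.
move=> ry; apply/eqP; rewrite eqn_leq; apply/andP; split.
  case E: (tau y n) => [|k] //.
  by rewrite -ltn_tau// E.
have : (n < visits y (tau y n).+1)%N by rewrite ltnNge -ltn_tau// ltnn.
by rewrite visitsS; case: (_ == o); lia.
Qed.

Lemma tau_homo y : visits_io y -> {homo tau y : n m / (n <= m)%N}.
Proof.
move=> ry n m nm; rewrite leqNgt; apply/negP => h.
by move: (h); rewrite ltn_tau// => /leq_trans/(_ nm); rewrite -ltn_tau// ltnn.
Qed.

(** A sum up to the random time tau, as a sum up to a fixed time with weights
determined by the past: the form in which stopped sums are estimated. *)
Lemma sum_visits (R : realType) y n K (phi : nat -> R) : visits_io y -> (tau y n <= K)%N ->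
  \sum_(i < K) (visits y i.+1 <= n)%N%:R * phi i = \sum_(i < tau y n) phi i.
Proof.
move=> ry tK; rewrite (big_ord_widen _ phi tK) [RHS]big_mkcond/=.
by apply: eq_bigr => i _; rewrite ltn_tau//; case: leqP; rewrite ?mul1r ?mul0r.
Qed.

Lemma sum_tau_root (R : realType) y n : visits_io y ->
  \sum_(i < tau y n) (y i == o)%:R = n%:R :> R.
Proof.
move=> ry; rewrite -[in RHS](visits_tau n ry).
elim: (tau y n) => [|k IH]; first by rewrite big_ord0.
by rewrite big_ord_recr/= IH visitsS natrD.
Qed.

End Visits.

(** * Enumeration of the paths of given length *)

Section PathLists.
Context {R : realType} {S : choiceType} (N : network R S).
Implicit Types (x y : S) (l : seq S) (n K : nat).

Fixpoint paths n x : seq (seq S) :=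
  if n is m.+1 then flatten [seq [seq y :: l | l <- paths m y] | y <- nbr N x]
  else [:: [::]].

Fixpoint pathw x l : R :=
  if l is y :: l' then trans N x y * pathw y l' else 1.

Lemma pathw_ge0 x l : 0 <= pathw x l.
Proof. by elim: l x => [|y l IH] x //=; rewrite mulr_ge0 ?trans_ge0. Qed.

Lemma pathw_rcons x l y : pathw x (rcons l y) = pathw x l * trans N (last x l) y.
Proof. by elim: l x => [|z l IH] x /=; rewrite ?mulr1 ?mul1r// IH mulrA. Qed.

Lemma pathE_paths n x g : pathE N n x g = \sum_(l <- paths n x) pathw x l * g l.
Proof.
elim: n x g => [|n IH] x g /=; first by rewrite big_seq1 mul1r.
rewrite big_flatten/= big_map; apply: eq_bigr => y _.
by rewrite big_map IH mulr_sumr; apply: eq_bigr => l _; rewrite mulrA.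
Qed.

Lemma mem_paths n x l : (l \in paths n x) = (size l == n) && path (step N) x l.
Proof.
elim: n x l => [|n IH] x [|y l] //=.
- apply/negbTE/negP => /flattenP[s /mapP[y _ ->]] /mapP[l _].
  by [].
- rewrite eqSS; apply/flattenP/idP => [[s /mapP[z zx ->]] /mapP[l' l'z [-> ->]]|].
    by move: l'z; rewrite IH => /andP[-> ->]; rewrite /step zx.
  move=> /andP[ln /andP[xy yl]]; exists [seq y :: l | l <- paths n y].
    by apply/mapP; exists y.
  by apply/mapP; exists l => //; rewrite IH ln.
Qed.

Lemma uniq_paths n x : uniq (paths n x).
Proof.
elim: n x => [//|n IH] x /=.
have := nbr_uniq N x; elim: (nbr N x) => //= y s IHs /andP[ys us].
rewrite cat_uniq IHs// andbT map_inj_uniq ?IH; last by move=> ? ? [].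
apply/hasPn => l /flattenP[t /mapP[z zs ->]] /mapP[l' _ ->].
by apply/negP => /mapP[l2 _ [zy _]]; move: ys; rewrite -zy zs.
Qed.

End PathLists.

(** * A random walk on a network *)

Lemma negligible_small d (T : measurableType d) (R : realType)
    (P : probability T R) (A : set T) :
  (forall e : R, 0 < e -> exists B, [/\ measurable B, A `<=` B & (P B <= e%:E)%E]) ->
  P.-negligible A.
Proof.
move=> h.
have /choice[B HB] : forall n : nat, exists B,
    [/\ measurable B, A `<=` B & (P B <= (n.+1%:R^-1)%:E)%E].
  by move=> n; apply: h.
have mB n : measurable (B n) by case: (HB n).
exists (\bigcap_n B n); split.
- exact: bigcapT_measurable.
- apply/eqP; rewrite eq_le measure_ge0 andbT; apply/lee_addgt0Pr => e e0.
  rewrite add0e.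
  have [n ne] : exists n : nat, n.+1%:R^-1 < e.
    have /cvgrPdist_lt /(_ e e0) := @cvg_harmonic R.
    move=> [n _ /(_ n (leqnn n))]; rewrite /= sub0r normrN ger0_norm// => ?.
    by exists n.
  case: (HB n) => _ _ Bn; apply: le_trans (_ : P (B n) <= _)%E.
    by apply: le_measure; rewrite ?inE//; [exact: bigcapT_measurable|exact: bigcap_inf].
  by apply: le_trans Bn _; rewrite lee_fin ltW.
- by move=> w Aw n _; case: (HB n) => _ AB _; exact: AB.
Qed.

Section Process.
Context {d} {T : measurableType d} {R : realType} (P : probability T R).
Context {S : choiceType} (N : network R S) (o : S) (Y : nat -> T -> S).
Implicit Types (l : seq S) (K n : nat) (w : T).
Local Notation paths := (paths N).
Local Notation pathw := (pathw N).
Local Notation pathE := (pathE N).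
Local Notation avg := (avg N).

Definition follows l : set T := [set w | mkseq (fun i => Y i w) (size l).+1 = o :: l].

(** Y is the walk on the network started from o, specified through the
probabilities of finite paths. *)
Definition chain_law : Prop := (forall l, measurable (follows l)) /\
  (forall l, path (step N) o l -> P (follows l) = (pathw o l)%:E).

Hypothesis Ychain : chain_law.

Let mfollows l : measurable (follows l). Proof. by case: Ychain. Qed.

Lemma trivIset_follows K (g : pred (seq S)) :
  trivIset [set` [seq l <- paths K o | g l]] follows.
Proof.
move=> l l' /=; rewrite !mem_filter !mem_paths.
move=> /andP[_ /andP[/eqP lK _]] /andP[_ /andP[/eqP l'K _]] [w [/=]].
by rewrite /follows /= lK l'K => -> [].
Qed.

(** The event that the first K steps form a path satisfying g. *)
Definition event K (g : pred (seq S)) : set T :=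
  \big[setU/set0]_(l <- [seq l <- paths K o | g l]) follows l.

Lemma measurable_event K g : measurable (event K g).
Proof. exact: bigsetU_measurable. Qed.

Lemma eventP K g w : event K g w <->
  exists l, [/\ l \in paths K o, g l & follows l w].
Proof.
rewrite /event -bigcup_seq; split => [[l /=]|[l [lK gl lw]]].
  by rewrite mem_filter => /andP[gl lK] lw; exists l.
by exists l => //=; rewrite mem_filter gl.
Qed.

Lemma prob_event K g : P (event K g) = (pathE K o (fun l => (g l)%:R))%:E.
Proof.
rewrite -[LHS]mul1e -integral_cst; last exact: measurable_event.
rewrite ge0_integral_bigsetU//=; last 2 first.
- by rewrite filter_uniq// uniq_paths.
- exact: trivIset_follows.
rewrite pathE_paths -sumEFin big_filter [RHS](bigID g)/=
    [X in _ = (_ + X)%E]big1 ?adde0; last first.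
  by move=> l /negPf ->; rewrite mulr0.
rewrite big_seq_cond [RHS]big_seq_cond; apply: eq_bigr => l /andP[+ gl].
rewrite mem_paths => /andP[_ ol].
rewrite integral_cst// mul1e gl mulr1; case: Ychain => _; exact.
Qed.

(** The event that the first K steps are along edges of the network, starting
from o. It has probability 1 but may differ from the whole space. *)
Definition full K := event K predT.

Lemma prob_full K : P (full K) = 1%E.
Proof. by rewrite prob_event /= pathE_cst. Qed.

Lemma prob_fullC K : P (~` full K) = 0%E.
Proof.
rewrite probability_setC; last exact: measurable_event.
by rewrite -/(full K) prob_full subee.
Qed.

Lemma integral_paths K (h : T -> \bar R) : measurable_fun setT h ->
  (forall w, 0 <= h w)%E ->
  (\int[P]_w h w = \sum_(l <- paths K o) \int[P]_(w in follows l) h w)%E.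
Proof.
move=> mh h0.
rewrite (@ge0_negligible_integral _ _ _ P _ (~` full K))//; last 2 first.
- by apply: measurableC; exact: measurable_event.
- exact: prob_fullC.
rewrite setTD setCK /full /event filter_predT ge0_integral_bigsetU//.
- exact: uniq_paths.
- by have := @trivIset_follows K predT; rewrite filter_predT.
- exact: measurable_funTS.
Qed.

Lemma ae_full : {ae P, forall w, forall K, full K w}.
Proof.
apply: ae_foralln => K; exists (~` full K); split.
- by apply: measurableC; exact: measurable_event.
- exact: prob_fullC.
- by [].
Qed.

(** The random variable equal to h l on the event that the first K steps are l.
Since h l may itself be random, this covers the holding times. *)
Definition pathvar K (h : seq S -> T -> R) w : R :=
  \sum_(l <- paths K o) \1_(follows l) w * h l w.

Lemma pathvarE K h l w : l \in paths K o -> follows l w -> pathvar K h w = h l w.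
Proof.
move=> lK lw; rewrite /pathvar (bigD1_seq l)//= ?uniq_paths//.
rewrite indicE mem_set// mul1r big_seq_cond big1 ?addr0// => l' /andP[l'K l'l].
rewrite indicE memNset ?mul0r// => l'w; move/negP: l'l; apply; apply/eqP.
apply: (@trivIset_follows K predT); rewrite ?filter_predT//=.
by exists w.
Qed.

Lemma measurable_pathvar K h : (forall l, measurable_fun setT (h l)) ->
  measurable_fun setT (pathvar K h).
Proof.
by move=> mh; apply: measurable_sum => l; apply: measurable_funM => //; exact: measurable_indic.
Qed.

Lemma integral_pathvar2 K h : (forall l, measurable_fun setT (h l)) ->
  (\int[P]_w (pathvar K h w ^+ 2)%:E =
   \sum_(l <- paths K o) \int[P]_(w in follows l) (h l w ^+ 2)%:E)%E.
Proof.
move=> mh; rewrite (integral_paths K); last 2 first.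
- by apply/measurable_EFinP; apply: measurable_funX; exact: measurable_pathvar.
- by move=> w; rewrite lee_fin sqr_ge0.
apply: eq_big_seq => l lK; apply: eq_integral => w; rewrite inE => lw.
by rewrite (pathvarE _ lK).
Qed.

Lemma full_follows K w : full K w -> exists l,
  [/\ l \in paths K o, follows l w, size l = K & mkseq (fun i => Y i w) K.+1 = o :: l].
Proof.
move=> /eventP[l [lK _ lw]]; exists l.
have sl : size l = K by move: lK; rewrite mem_paths => /andP[/eqP].
by split=> //; rewrite -sl.
Qed.

(** The probability of not being at o between the times n and n + m is the
expectation of the survival probability from Y_n. It is a finite sum of terms
tending to 0 as m grows. *)
Lemma ae_visits_io : (forall l, path (step N) o l ->
    surv N o k (last o l) @[k --> \oo] --> 0) ->
  {ae P, forall w, visits_io o (fun i => Y i w)}.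
Proof.
move=> rec.
have ae1 : {ae P, forall w, forall n, exists2 i, (n < i)%N & Y i w = o}.
  apply: ae_foralln => n.
  suff : P.-negligible [set w | forall i, (n < i)%N -> Y i w <> o].
    apply: negligibleS => w /= h i ni Yi; apply: h; exists i => //.
  apply: negligible_small => e e0.
  have a_cvg : pathE n o (fun l => surv N o m (last o l)) @[m --> \oo] --> 0.
    pose lim_ l := if l \in paths n o then 0 else pathw o l * surv_lim N o (last o l).
    have lim0 : \sum_(l <- paths n o) lim_ l = 0.
      by rewrite big_seq big1// => l lK; rewrite /lim_ lK.
    have : \sum_(l <- paths n o) pathw o l * surv N o m (last o l) @[m --> \oo]
        --> \sum_(l <- paths n o) lim_ l.
      apply: cvg_sum_seq => l; rewrite /lim_; case: ifPn => [|_].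
        rewrite mem_paths => /andP[_ ol]; rewrite -(mulr0 (pathw o l)).
        by apply: cvgMl_tmp; exact: rec.
      by apply: cvgMl_tmp; exact: surv_cvg.
    by rewrite lim0; under [in X in _ -> X]eq_fun do rewrite pathE_paths.
  have [m am] : exists m, pathE n o (fun l => surv N o m (last o l)) < e.
    move/cvgrPdist_lt : a_cvg => /(_ e e0)[m _ /(_ m (leqnn m))] /=.
    by rewrite sub0r normrN => /(le_lt_trans (ler_norm _)) ?; exists m.
  exists (event (n + m) (fun l => o \notin drop n l) `|` ~` full (n + m)); split.
  - by apply: measurableU; [exact: measurable_event|apply: measurableC; exact: measurable_event].
  - move=> w /= h; have [fw|] := pselect (full (n + m) w); last by right.
    left; apply/eventP; have [l [lK lw sl ml]] := full_follows fw.
    exists l; split => //; apply/negP => /(nthP o)[j]; rewrite size_drop sl => jm.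
    rewrite nth_drop => no; apply: (h (n + j).+1); first by rewrite ltnS leq_addr.
    move: (congr1 (fun s => nth o s (n + j).+1) ml); rewrite nth_mkseq/=; last first.
      by rewrite !ltnS; lia.
    by rewrite no.
  - rewrite (_ : P _ = P (event (n + m) (fun l => o \notin drop n l))); last first.
      apply: measureU0; [exact: measurable_event| |exact: prob_fullC].
      by apply: measurableC; exact: measurable_event.
    rewrite prob_event lee_fin; apply: le_trans (ltW am).
    rewrite pathE_cat; apply: le_pathE => l ln _; apply: le_pathE => l' _ _.
    by rewrite -ln drop_size_cat.
apply: filterS2 ae1 ae_full => w inf fw n.
elim: n => [|n [i IH]].
  have [l [_ _ _ ml]] := full_follows (fw 0%N).
  exists 0%N; rewrite visitsS; move: (congr1 (fun s => nth o s 0) ml) => /= ->.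
  by rewrite eqxx addn1.
have [j ij Yj] := inf i.
exists j; rewrite visitsS Yj eqxx addn1 ltnS; apply: leq_trans IH _.
exact: visits_homo.
Qed.

End Process.

(** * Averages of functions of the walk over its excursions *)

Section Averages.
Context {d} {T : measurableType d} {R : realType} (P : probability T R).
Context {S : choiceType} (N : network R S) (o : S) (Y : nat -> T -> S).
Implicit Types (l : seq S) (K n : nat) (w : T) (x : S) (F r u : S -> R).
Local Notation paths := (paths N).
Local Notation pathw := (pathw N).
Local Notation pathE := (pathE N).
Local Notation avg := (avg N).
Local Notation wt := (wt N).
Local Notation bdd_total := (bdd_total N).

Hypothesis Ychain : chain_law P N o Y.
Hypothesis Yrec : {ae P, forall w, visits_io o (fun i => Y i w)}.

Definition tauY w n : nat := tau o (fun i => Y i w) n.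
Definition occsum F w n : R := \sum_(i < tauY w n) F (Y i w).

Lemma take_mkseq (U : Type) (y : nat -> U) i K : (i <= K)%N -> take i (mkseq y K) = mkseq y i.
Proof. by move=> iK; rewrite /mkseq -map_take take_iota (minn_idPl iK). Qed.

Lemma mart_visits (y : nat -> S) u n K l : mkseq y K.+1 = o :: l -> size l = K ->
  mart N o n u l = \sum_(i < K) (visits o y i.+1 <= n)%N%:R * (u (y i.+1) - avg u (y i)).
Proof.
move=> yl lK; rewrite /mart lK; apply: eq_bigr => -[i iK] _.
have -> : nth o l i = nth o (o :: l) i.+1 by [].
by rewrite -yl take_mkseq ?nth_mkseq//; exact: ltnW.
Qed.

(** The bound [mart_L2_bound] does not depend on the time K of truncation, and
the truncated martingale is eventually constant in K by recurrence. *)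
Lemma mart_cvg0 u C : bdd_total (fun y => u y ^+ 2) C ->
  {ae P, forall w,
    (\sum_(i < tauY w (n.+1 ^ 2)) (u (Y i.+1 w) - avg u (Y i w))) / (n.+1 ^ 2)%:R
      @[n --> \oo] --> 0}.
Proof.
move=> uC; pose Z n K := pathvar N o Y K (fun l (_ : T) => mart N o n u l).
apply: (@L2_squares_cvg0 _ _ _ P Z
  (fun n w => \sum_(i < tauY w n) (u (Y i.+1 w) - avg u (Y i w))) (C / wt o)).
- by move=> n K; apply: (measurable_pathvar Ychain) => // l; exact: measurable_cst.
- move=> n K; rewrite (integral_pathvar2 Ychain)//.
  apply: (@le_trans _ _ (pathE K o (fun l => mart N o n u l ^+ 2))%:E); last first.
    by rewrite lee_fin; exact: mart_L2_bound.
  rewrite pathE_paths -sumEFin big_seq [leRHS]big_seq; apply: lee_sum => l.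
  rewrite mem_paths => /andP[_ ol]; case: Ychain => mfollows /(_ l ol) Pl.
  apply: (@le_trans _ _ ((mart N o n u l ^+ 2)%:E * P (follows o Y l))%E).
    by rewrite integral_cst.
  by rewrite Pl -EFinM mulrC.
- apply: filterS2 (ae_full Ychain) Yrec => w fw rw n.
  exists (tauY w n) => K tK; have [l [lK lw sl yl]] := full_follows (fw K).
  rewrite /Z (pathvarE _ lK lw) (mart_visits _ _ yl sl).
  exact: (sum_visits (fun i => u (Y i.+1 w) - avg u (Y i w)) rw tK).
Qed.

Lemma pathE_take K i g : (i <= K)%N -> pathE K o (fun l => g (take i l)) = pathE i o g.
Proof.
move=> iK; rewrite -(subnKC iK) pathE_cat; apply: eq_pathE => l li _.
rewrite -[RHS](pathE_cst N _ (K - i) (last o l)); apply: eq_pathE => l' _ _.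
by rewrite -li take_size_cat.
Qed.

(** Given the walk, the H i are independent exponentials of rates q (Y i). *)
Definition holding_law (q : S -> R) (H : nat -> T -> R) : Prop :=
  forall l (t : nat -> R), path (step N) o l -> (forall i, 0 <= t i) ->
  P (follows o Y l `&` [set w | forall i, (i <= size l)%N -> t i < H i w]) =
  (pathw o l * \prod_(i < (size l).+1) expR (- (q (nth o (o :: l) i) * t i)))%:E.

(** Given the path, the second moment of the fluctuation is at most three times
the sum of the f ^ 2 / q ^ 2 along the path ([exponential_noise_L2]), and the
expectation of this sum over n excursions is linear in n ([occupation_total]).
*)
Lemma noise_cvg0 (q f : S -> R) (H : nat -> T -> R) C :
  (forall i, measurable_fun setT (H i)) -> (forall i w, 0 <= H i w) ->
  holding_law q H -> (forall x, 0 < q x) -> (forall x, 0 <= f x) ->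
  bdd_total (fun x => f x ^+ 2 * (q x ^+ 2)^-1) C ->
  {ae P, forall w,
    (\sum_(i < tauY w (n.+1 ^ 2)) f (Y i w) * (H i w - (q (Y i w))^-1)) / (n.+1 ^ 2)%:R
      @[n --> \oo] --> 0}.
Proof.
move=> mH H0 Hlaw q0 f0 fC.
pose c n l i : R := (count_mem o (take i.+1 (o :: l)) <= n)%N%:R * f (nth o (o :: l) i).
pose h n l w := \sum_(i < (size l).+1) c n l i * (H i w - (q (nth o (o :: l) i))^-1).
pose Z n K := pathvar N o Y K (h n).
have mh n l : measurable_fun setT (h n l).
  by apply: measurable_sum => i; apply: measurable_funM => //; exact: measurable_funB.
apply: (@L2_squares_cvg0 _ _ _ P Z
  (fun n w => \sum_(i < tauY w n) f (Y i w) * (H i w - (q (Y i w))^-1)) (3 * (C / wt o))).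
- by move=> n K; apply: (measurable_pathvar Ychain).
- move=> n K; rewrite (integral_pathvar2 Ychain)//.
  apply: (@le_trans _ _ (pathE K o (fun l => 3 *
      \sum_(i < K.+1) c n l i ^+ 2 * (q (nth o (o :: l) i) ^+ 2)^-1))%:E).
    rewrite pathE_paths -sumEFin big_seq [leRHS]big_seq; apply: lee_sum => l.
    rewrite mem_paths => /andP[/eqP lK ol].
    rewrite mulrCA mulrA -lK.
    apply: (exponential_noise_L2 (c := c n l) (q := fun i => q (nth o (o :: l) i))) => //.
    + by case: Ychain.
    + by move=> i; rewrite mulr_ge0.
    + exact: pathw_ge0.
    + by case: Ychain => _; exact.
    + by move=> t t0; exact: Hlaw.
  rewrite pathEZ lee_fin mulrCA ler_wpM2l// pathE_sum.
  apply: (le_trans _ (occupation_total (s := fun x => f x ^+ 2 * (q x ^+ 2)^-1)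
      o K.+1 n _ fC)); last first.
    by move=> x; rewrite mulr_ge0 ?invr_ge0 ?sqr_ge0.
  apply: ler_sum => -[i /= iK] _.
  have iK' : (i <= K)%N by rewrite -ltnS.
  rewrite -(pathE_take _ iK'); apply: le_pathE => l lK _.
  have li : (i < (size l).+1)%N by rewrite lK.
  rewrite /c /= [last o _](_ : _ = nth o (o :: l) i); last first.
    rewrite (last_nth o) size_takel ?lK//.
    by case: (i) => //= j; rewrite nth_take.
  rewrite exprMn -mulrA; case: (_ <= n)%N; rewrite ?expr1n ?expr0n ?mul1r ?mul0r//.
- apply: filterS2 (ae_full Ychain) Yrec => w fw rw n.
  exists (tauY w n) => K tK; have [l [lK lw sl yl]] := full_follows (fw K).
  rewrite /Z (pathvarE _ lK lw) /h sl.
  rewrite -(sum_visits (fun i => f (Y i w) * (H i w - (q (Y i w))^-1)) rw (leqW tK)).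
  apply: eq_bigr => -[i iK] _.
  by rewrite /c -yl take_mkseq// nth_mkseq// mulrA.
Qed.

(** The bound of the maximal inequality for the first K steps does not depend
on K, so that a single exceptional event controls the sums over n excursions
for all n. *)
Lemma occsum_large r C (lam : R) : 0 < lam -> (forall x, 0 <= r x) -> bdd_total r C ->
  exists B, [/\ measurable B, (P B <= (C / (lam * wt o))%:E)%E &
    forall w, (forall K, full N o Y K w) -> visits_io o (fun i => Y i w) ->
      ~ B w -> forall n, occsum r w n <= lam * n%:R].
Proof.
move=> lam0 r0 rC.
pose psi x := r x - lam * (x == o)%:R.
pose Full := \bigcap_K full N o Y K.
have mFull : measurable Full.
  by apply: bigcapT_measurable => K; exact: (measurable_event Ychain).
pose E K := event N o Y K (fun l => 0 < maxsum psi (o :: l)).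
have mE K : measurable (E K) by exact: (measurable_event Ychain).
pose B K := Full `&` E K.
have mB K : measurable (B K) by exact: measurableI.
have PB K : (P (B K) <= (C / (lam * wt o))%:E)%E.
  apply: (@le_trans _ _ (P (E K))).
    by apply: le_measure; rewrite ?inE//; exact: subIsetr.
  rewrite (prob_event Ychain) lee_fin ler_pdivlMr ?mulr_gt0 ?wt_gt0// mulrC.
  exact: maximal_ineq.
have Bincr : nondecreasing_seq B.
  apply/nondecreasing_seqP => K; apply/subsetPset => w [Fw /eventP[l [lK l0 lw]]].
  split => //; apply/eventP; have [l' [l'K l'w sl' yl']] := full_follows (Fw K.+1 I).
  have sl : size l = K by move: lK; rewrite mem_paths => /andP[/eqP].
  exists l'; split => //; apply: (lt_le_trans l0).
  move: lw; rewrite /follows /= sl => yl.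
  move: yl'; rewrite mkseqS yl rcons_cons => -[<-].
  exact: (maxsum_rcons psi (o :: l)).
exists (\bigcup_K B K); split.
- exact: bigcupT_measurable.
- have cB : P (B K) @[K --> \oo] --> P (\bigcup_K B K).
    by apply: nondecreasing_cvg_mu => //; exact: bigcupT_measurable.
  rewrite -(cvg_lim _ cB)//; apply: lime_le; last exact: nearW.
  by apply/cvg_ex; eexists; exact: cB.
(* The time tau of the n-th return is one of the times over which the maximum
is taken, and there the number of visits to o is exactly n. *)
- move=> w fw rw Bw n; rewrite leNgt; apply/negP => h; apply: Bw.
  pose k := tauY w n; exists k => //; split; first by move=> K _; exact: fw.
  have [l [lK lw sl yl]] := full_follows (fw k).
  apply/eventP; exists l; split => //.
  rewrite -(cat_take_drop k (o :: l)); apply: lt_le_trans (maxsum_prefix _ _ _).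
  rewrite -yl take_mkseq// big_map -[X in iota 0 X]subn0 big_mkord.
  rewrite /psi sumrB -mulr_sumr subr_gt0 (sum_tau_root R n rw).
  exact: h.
Qed.

(** Only excursion numbers that are squares are considered, for which the
second moment bounds suffice. *)
Definition averages_to F (c : R) : Prop :=
  {ae P, forall w, occsum F w (n.+1 ^ 2) / (n.+1 ^ 2)%:R @[n --> \oo] --> c}.

Lemma averages_toD F G (a b : R) : averages_to F a -> averages_to G b ->
  averages_to (fun x => F x + G x) (a + b).
Proof.
move=> gF gG; apply: filterS2 gF gG => w Fw Gw.
rewrite (_ : (fun n => occsum _ w (n.+1 ^ 2) / _) =
    (fun n => occsum F w (n.+1 ^ 2) / (n.+1 ^ 2)%:R + occsum G w (n.+1 ^ 2) / (n.+1 ^ 2)%:R)).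
  exact: cvgD.
by apply/funext => n; rewrite /occsum big_split mulrDl.
Qed.

Lemma averages_toZ F (a b : R) : averages_to F a -> averages_to (fun x => b * F x) (b * a).
Proof.
apply: filterS => w Fw.
rewrite (_ : (fun n => occsum _ w (n.+1 ^ 2) / _) =
    (fun n => b * (occsum F w (n.+1 ^ 2) / (n.+1 ^ 2)%:R))).
  exact: cvgMl_tmp.
by apply/funext => n; rewrite /occsum -mulr_sumr mulrA.
Qed.

Lemma averages_to0 : averages_to (fun=> 0) 0.
Proof.
apply: nearW => w; rewrite (_ : (fun n => occsum _ w (n.+1 ^ 2) / _) = fun=> 0);
    first exact: cvg_cst.
by apply/funext => n; rewrite /occsum big1 ?mul0r.
Qed.

Lemma averages_to_sum (I : Type) (s : seq I) (F : I -> S -> R) (c : I -> R) :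
  (forall i, averages_to (F i) (c i)) ->
  averages_to (fun x => \sum_(i <- s) F i x) (\sum_(i <- s) c i).
Proof.
move=> gF; elim: s => [|i s IH].
  have -> : (fun x => \sum_(i <- [::]) F i x) = fun=> 0.
    by apply/funext => x; rewrite big_nil.
  by rewrite big_nil; exact: averages_to0.
have -> : (fun x => \sum_(i <- i :: s) F i x) = fun x => F i x + \sum_(i <- s) F i x.
  by apply/funext => x; rewrite big_cons.
by rewrite big_cons; exact: averages_toD.
Qed.

(** One visit to the root per excursion. *)
Lemma averages_to_root : averages_to (fun x => (x == o)%:R) 1.
Proof.
apply: filterS Yrec => w rw; rewrite (_ : (fun n => occsum _ w (n.+1 ^ 2) / _) = fun=> 1);
    first exact: cvg_cst.
by apply/funext => n; rewrite /occsum (sum_tau_root R _ rw) divff// pnatr_eq0 expn_eq0.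
Qed.

(** The sum of u - P u telescopes up to the martingale and to the two boundary
values of u. *)
Lemma averages_to_poisson u (M C : R) : (forall x, `|u x| <= M) ->
  bdd_total (fun x => u x ^+ 2) C -> averages_to (fun x => u x - avg u x) 0.
Proof.
move=> uM uC; apply: filterS (mart_cvg0 uC) => w mw.
have b0 : (u (Y 0 w) - u (Y (tauY w (n.+1 ^ 2)) w)) / (n.+1 ^ 2)%:R @[n --> \oo] --> 0.
  apply: (@squeeze_cvgr _ _ _ _ (fun n => - (2 * M) * harmonic n) (fun n => 2 * M * harmonic n)).
  - apply: nearW => n; rewrite mulNr -ler_norml normrM.
    apply: ler_pM => //.
      by apply: le_trans (ler_normB _ _) _; rewrite mulr_natl mulr2n lerD.
    rewrite ger0_norm ?invr_ge0// /harmonic /= lef_pV2 ?posrE ?ltr0n ?expn_gt0//.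
    by rewrite ler_nat -[X in (X <= _)%N]expn1 leq_pexp2l.
  - by rewrite -(mulr0 (- (2 * M))); apply: cvgMl_tmp; exact: cvg_harmonic.
  - by rewrite -(mulr0 (2 * M)); apply: cvgMl_tmp; exact: cvg_harmonic.
rewrite -(addr0 0) (_ : (fun n => occsum _ w (n.+1 ^ 2) / _) = (fun n =>
   (u (Y 0 w) - u (Y (tauY w (n.+1 ^ 2)) w)) / (n.+1 ^ 2)%:R +
   (\sum_(i < tauY w (n.+1 ^ 2)) (u (Y i.+1 w) - avg u (Y i w))) / (n.+1 ^ 2)%:R)).
  exact: cvgD.
apply/funext => n; rewrite -mulrDl /occsum; congr (_ / _).
elim: (tauY _ _) => [|k IH]; first by rewrite !big_ord0 subrr addr0.
by rewrite !big_ord_recr/= IH; ring.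
Qed.

(** The functions with convergent averages are closed under approximation in
L^1 of the reversible measure: by [occsum_large] the averages of the error are
uniformly small off an event of small probability. Errors 1 / (k + 1) are used,
and almost every w lies outside the exceptional events of infinitely many k. *)
Lemma averages_to_approx F (c : R) :
  (forall e : R, 0 < e -> exists G r (c' : R), [/\ averages_to G c', `|c - c'| <= e,
     forall x, `|F x - G x| <= r x & bdd_total r e]) ->
  averages_to F c.
Proof.
move=> happ.
have happ' : forall k : nat, exists Grc : (S -> R) * (S -> R) * R,
    [/\ averages_to Grc.1.1 Grc.2, `|c - Grc.2| <= k.+1%:R^-1,
     forall x, `|F x - Grc.1.1 x| <= Grc.1.2 x &
     exists B, [/\ measurable B, (P B <= (k.+1%:R^-1)%:E)%E &
    forall w, (forall K, full N o Y K w) -> visits_io o (fun i => Y i w) ->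
      ~ B w -> forall n, occsum Grc.1.2 w n <= k.+1%:R^-1 * n%:R]].
  move=> k; have k0 : 0 < k.+1%:R :> R by [].
  pose e : R := Num.min (k.+1%:R^-1) (k.+1%:R^-1 * (k.+1%:R^-1 * wt o)).
  have e0 : 0 < e by rewrite lt_min invr_gt0 k0/= !mulr_gt0 ?invr_gt0// wt_gt0.
  have [G [r [c' [gG cc' FG re]]]] := happ e e0.
  exists (G, r, c'); split => //=.
    by apply: le_trans cc' _; rewrite /e ge_min lexx.
  have r0 x : 0 <= r x by apply: le_trans (FG x).
  have ki : 0 < k.+1%:R^-1 :> R by rewrite invr_gt0.
  have [B [mB PB HB]] := occsum_large ki r0 re.
  exists B; split => //; apply: le_trans PB _.
  rewrite lee_fin ler_pdivrMr ?mulr_gt0 ?wt_gt0//.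
  by rewrite /e ge_min lexx orbT.
have [Grc HG] := choice happ'.
have /choice[B HB] := fun k => let: And4 _ _ _ h := HG k in h.
have aeB : {ae P, forall w, forall m, exists2 k, (m <= k)%N & ~ B k w}.
  apply: ae_foralln => m.
  suff : P.-negligible (\bigcap_(k in [set k | (m <= k)%N]) B k).
    apply: negligibleS => w /= h k mk; apply: contrapT => Bkw; apply: h.
    by exists k.
  apply: negligible_small => e e0.
  have [k ke] : exists k : nat, k.+1%:R^-1 < e.
    have /cvgrPdist_lt /(_ e e0) := @cvg_harmonic R.
    move=> [k _ /(_ k (leqnn k))]; rewrite /= sub0r normrN ger0_norm// => ?.
    by exists k.
  exists (B (maxn m k)); case: (HB (maxn m k)) => mB PB _; split => //.
  - by move=> w; apply; rewrite /= leq_maxl.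
  - apply: le_trans PB _; rewrite lee_fin; apply: le_trans (ltW ke).
    by rewrite lef_pV2 ?posrE// ler_nat ltnS leq_maxr.
have aeG : {ae P, forall w, forall k,
    occsum (Grc k).1.1 w (n.+1 ^ 2) / (n.+1 ^ 2)%:R @[n --> \oo] --> (Grc k).2}.
  by apply: ae_foralln => k; case: (HG k).
have aeFR : {ae P, forall w, (forall K, full N o Y K w) /\ visits_io o (fun i => Y i w)}.
  by apply: filterS2 (ae_full Ychain) Yrec.
apply: filterS3 aeB aeG aeFR => w Bw Gw [fw rw].
apply/cvgrPdist_le => e e0.
have [m me] : exists m : nat, m.+1%:R^-1 < e / 3.
  have e3 : 0 < e / 3 by rewrite divr_gt0.
  have /cvgrPdist_lt /(_ _ e3) := @cvg_harmonic R.
  move=> [k _ /(_ k (leqnn k))]; rewrite /= sub0r normrN ger0_norm// => ?.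
  by exists k.
have [k mk Bkw] := Bw m.
have ke : k.+1%:R^-1 < e / 3 :> R.
  by apply: le_lt_trans me; rewrite lef_pV2 ?posrE// ler_nat ltnS.
case: (HG k) => _ cck FG _; case: (HB k) => _ _ /(_ w fw rw Bkw) occ.
have e3 : 0 < e / 3 by rewrite divr_gt0.
have /cvgrPdist_lt /(_ _ e3) := Gw k.
apply: filterS => n /= hn.
set NN : R := (n.+1 ^ 2)%:R in hn *; have NN0 : 0 < NN by rewrite ltr0n expn_gt0.
have d1 : `|occsum F w (n.+1 ^ 2) - occsum (Grc k).1.1 w (n.+1 ^ 2)| <= k.+1%:R^-1 * NN.
  apply: le_trans (occ _); rewrite /occsum -sumrB.
  by apply: le_trans (ler_norm_sum _ _ _) _; apply: ler_sum => i _; exact: FG.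
have d2 : `|occsum F w (n.+1 ^ 2) / NN - occsum (Grc k).1.1 w (n.+1 ^ 2) / NN| <= k.+1%:R^-1.
  rewrite -mulrBl normrM [`|NN^-1|]gtr0_norm ?invr_gt0//.
  by rewrite ler_pdivrMr.
set B1 := occsum F w _ / NN in d2 *; set B2 := occsum _ w _ / NN in d2 hn *.
rewrite (_ : c - B1 = (c - (Grc k).2) + ((Grc k).2 - B2) - (B1 - B2)); last by ring.
apply: le_trans (ler_normB _ _) _; apply: le_trans (lerD (ler_normD _ _) (lexx _)) _.
have -> : e = e / 3 + e / 3 + e / 3 by field.
apply: lerD; last exact: le_trans d2 (ltW ke).
by apply: lerD; [exact: le_trans cck (ltW ke)|exact: ltW].
Qed.

End Averages.

(** * Ratio limit theorem and time averages *)

Section Limits.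
Context {d} {T : measurableType d} {R : realType} (P : probability T R).
Context {S : choiceType} (N : network R S) (o : S) (Y : nat -> T -> S).
Implicit Types (l : seq S) (K n : nat) (w : T) (x z : S) (F r u : S -> R).
Local Notation wt := (wt N).
Local Notation bdd_total := (bdd_total N).
Local Notation surv := (surv N).
Local Notation averages_to := (averages_to P o Y).

Hypothesis Ychain : chain_law P N o Y.
Hypothesis Yrec : {ae P, forall w, visits_io o (fun i => Y i w)}.

(** By [green_poisson] the indicator of z is, up to [killed], the sum of a
function u - P u, whose averages vanish, and of a multiple of the indicator of
the root. The integral of [killed] is wt z times a survival probability, which
is small. *)
Lemma averages_to_state z : surv o k z @[k --> \oo] --> 0 ->
  averages_to (fun x => (x == z)%:R) (wt z / wt o).
Proof.
move=> sz; have [->|zo] := eqVneq z o.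
  by rewrite divff ?gt_eqF ?wt_gt0//; exact: averages_to_root.
apply: (averages_to_approx Ychain Yrec) => e e0.
have wz := wt_gt0 N z; have wo := wt_gt0 N o.
pose e' := Num.min (e / wt z) (e / (wt z / wt o)).
have e'0 : 0 < e' by rewrite lt_min !divr_gt0.
have [m me] : exists m, surv o m z < e'.
  move/cvgrPdist_lt : sz => /(_ _ e'0)[m _ /(_ m (leqnn m))] /=.
  by rewrite sub0r normrN => /(le_lt_trans (ler_norm _)) ?; exists m.
have [me1 me2] : surv o m z <= e / wt z /\ surv o m z <= e / (wt z / wt o).
  by split; apply: le_trans (ltW me) _; rewrite /e' ge_min lexx ?orbT.
exists (fun x => (green N o z m x - avg N (green N o z m) x) +
    (wt z / wt o * (1 - surv o m z)) * (x == o)%:R), (killed N o z m),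
  (0 + wt z / wt o * (1 - surv o m z) * 1); split.
- apply: averages_toD; last by apply: averages_toZ; exact: averages_to_root.
  apply: (averages_to_poisson Ychain Yrec (M := m%:R)); last exact: bdd_total_green2.
  by move=> x; rewrite ger0_norm ?green_ge0// green_le.
- rewrite add0r mulr1 mulrBr mulr1 opprB addrC subrK.
  rewrite ger0_norm; last by rewrite mulr_ge0 ?surv_ge0// divr_ge0// ltW.
  by rewrite mulrC -ler_pdivlMr// divr_gt0.
- move=> x; rewrite green_poisson//.
  rewrite [X in `|X|](_ : _ = killed N o z m x); last by ring.
  by rewrite ger0_norm// killed_ge0.
- move=> D uD; apply: le_trans (@bdd_total_killed _ _ N o z m D uD) _.
  by rewrite mulrC -ler_pdivlMr.
Qed.

(** F has integral exactly c against the reversible measure, for non-negative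
F. *)
Definition has_total F (c : R) : Prop := bdd_total F c /\
  forall e : R, 0 < e -> exists2 D : seq S, uniq D & c - e <= \sum_(x <- D) wt x * F x.

(** Approximate F by its restrictions to finite sets. Recurrence is asked where
F does not vanish, so that the theorem applies to functions supported by a
single component of the network. *)
Lemma averages_to_total F c : (forall x, 0 <= F x) -> has_total F c ->
  (forall x, F x = 0 \/ surv o k x @[k --> \oo] --> 0) -> averages_to F (c / wt o).
Proof.
move=> F0 [Fc cF] Frec; apply: (averages_to_approx Ychain Yrec) => e e0.
have wo := wt_gt0 N o.
pose e' := Num.min e (e * wt o).
have e'0 : 0 < e' by rewrite lt_min e0 mulr_gt0.
have [D uD cD] := cF e' e'0.
pose G x := \sum_(z <- D) F z * (x == z)%:R.
have GE x : G x = (x \in D)%:R * F x.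
  rewrite /G; have [xD|xD] := boolP (x \in D).
    rewrite (bigD1_seq x)//= eqxx mulr1 mul1r big1 ?addr0// => z.
    by rewrite eq_sym => /negPf ->; rewrite mulr0.
  rewrite mul0r big_seq big1// => z zD; case: eqVneq => [xz|]; rewrite ?mulr0//.
  by rewrite xz zD in xD.
exists G, (fun x => F x - G x), (\sum_(z <- D) F z * (wt z / wt o)); split.
- apply: averages_to_sum => z; have [Fz|sz] := Frec z.
    rewrite Fz mul0r (_ : (fun x => _) = fun=> 0); first exact: averages_to0.
    by apply/funext => x; rewrite mul0r.
  by apply: averages_toZ; exact: averages_to_state.
- rewrite (_ : \sum_(z <- D) _ = (\sum_(z <- D) wt z * F z) / wt o); last first.
    by rewrite mulr_suml; apply: eq_bigr => z _; ring.
  rewrite -mulrBl ger0_norm; last by rewrite divr_ge0 ?subr_ge0 ?Fc// ltW.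
  rewrite ler_pdivrMr//; apply: (@le_trans _ _ e'); first lra.
  by rewrite /e' ge_min lexx orbT.
- move=> x; rewrite ger0_norm// GE subr_ge0; case: (x \in D); rewrite ?mul1r ?mul0r//.
- move=> D2 uD2.
  pose D3 := undup (D ++ D2); have uD3 : uniq D3 by exact: undup_uniq.
  apply: (@le_trans _ _ (\sum_(x <- D3) wt x * (F x - G x))).
    apply: sub_sum_uniq => //.
      by move=> x xD; rewrite mem_undup mem_cat xD orbT.
    move=> x; rewrite mulr_ge0 ?(ltW (wt_gt0 _ _))// GE subr_ge0.
    by case: (x \in D); rewrite ?mul1r ?mul0r.
  have E : \sum_(x <- D3) wt x * G x = \sum_(x <- D) wt x * F x.
    rewrite (bigID (mem D))/= [X in _ + X]big1 ?addr0; last first.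
      by move=> x xD; rewrite GE (negPf xD) mul0r mulr0.
    rewrite -[LHS]big_filter.
    transitivity (\sum_(x <- D) wt x * G x).
      apply: perm_big; apply: uniq_perm; rewrite ?filter_uniq// => x.
      rewrite mem_filter; case: (boolP (x \in D)) => //= xD.
      by rewrite mem_undup mem_cat xD.
    by apply: eq_big_seq => x xD; rewrite GE xD mul1r.
  under eq_bigr do rewrite mulrBr.
  rewrite sumrB E; apply: (@le_trans _ _ e').
    by have := Fc D3 uD3; lra.
  by rewrite /e' ge_min lexx.
Qed.

(** Replacing the holding times by their means turns f into f / q. The square
of this function is integrable because f / q is, and 1 / q is bounded. *)
Lemma time_average (q f : S -> R) (q0 : R) (H : nat -> T -> R) (c : R) :
  (forall i, measurable_fun setT (H i)) -> (forall i w, 0 <= H i w) ->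
  holding_law P N o Y q H -> 0 < q0 -> (forall x, q0 <= q x) ->
  (forall x, 0 <= f x <= 1) ->
  has_total (fun x => f x / q x) c ->
  (forall x, f x = 0 \/ surv o k x @[k --> \oo] --> 0) ->
  {ae P, forall w,
    (\sum_(i < tauY o Y w (n.+1 ^ 2)) f (Y i w) * H i w) / (n.+1 ^ 2)%:R
      @[n --> \oo] --> c / wt o}.
Proof.
move=> mH H0 Hlaw q00 qq f01 tot frec.
have q_gt0 x : 0 < q x by exact: lt_le_trans (qq x).
have f0 x : 0 <= f x by case/andP: (f01 x).
have fq0 x : 0 <= f x / q x by rewrite divr_ge0// ltW.
have g : averages_to (fun x => f x / q x) (c / wt o).
  apply: averages_to_total => // x; case: (frec x) => [->|]; last by right.
  by left; rewrite mul0r.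
have b2 : bdd_total (fun x => f x ^+ 2 * (q x ^+ 2)^-1) (q0^-1 * c).
  move=> D uD.
  apply: (@le_trans _ _ (\sum_(x <- D) q0^-1 * (wt x * (f x / q x)))).
    apply: ler_sum => x _; rewrite [leRHS]mulrCA; apply: ler_wpM2l; first exact/ltW/wt_gt0.
    have -> : f x ^+ 2 * (q x ^+ 2)^-1 = (f x / q x) * (f x / q x).
      by field; rewrite gt_eqF.
    apply: ler_wpM2r => //; case/andP: (f01 x) => _ f1.
    apply: (@le_trans _ _ (1 / q x)); first by rewrite ler_wpM2r// invr_ge0 ltW.
    by rewrite mul1r lef_pV2// posrE.
  rewrite -mulr_sumr ler_wpM2l//; first by rewrite invr_ge0 ltW.
  by case: tot => tot _; exact: tot.
have := noise_cvg0 Ychain Yrec mH H0 Hlaw q_gt0 f0 b2.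
apply: filterS2 g => w g nz.
rewrite -(add0r (c / wt o)).
rewrite (_ : (fun n => (\sum_(i < tauY o Y w (n.+1 ^ 2)) f (Y i w) * H i w) / (n.+1 ^ 2)%:R) =
  fun n => (\sum_(i < tauY o Y w (n.+1 ^ 2)) f (Y i w) * (H i w - (q (Y i w))^-1)) / (n.+1 ^ 2)%:R
    + occsum o Y (fun x => f x / q x) w (n.+1 ^ 2) / (n.+1 ^ 2)%:R); first exact: cvgD.
apply/funext => n; rewrite -mulrDl /occsum -big_split/=; congr (_ / _).
by apply: eq_bigr => i _; ring.
Qed.

End Limits.

(** * Integrals of step functions and interpolation between epochs *)

Section StepPath.
Context {R : realType} (h f : nat -> R) (g : R -> R).
Local Notation leb := (@lebesgue_measure R).

(** The path g has the value f n on a time interval of length h n, from epoch n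
to epoch n.+1. *)
Definition epoch n : R := \sum_(i < n) h i.
Definition accrued n : R := \sum_(i < n) f i * h i.

Hypothesis h0 : forall i, 0 <= h i.
Hypothesis f01 : forall i, 0 <= f i <= 1.
Hypothesis gstep : forall n t, epoch n <= t < epoch n.+1 -> g t = f n.

Lemma epochS n : epoch n.+1 = epoch n + h n.
Proof. by rewrite /epoch big_ord_recr. Qed.

Lemma epoch_homo : {homo epoch : n m / (n <= m)%N >-> n <= m}.
Proof.
apply: (@homo_leq _ _ (fun x y => x <= y)) => [//|y x z|n]; first exact: le_trans.
by rewrite epochS lerDl.
Qed.

Lemma epoch_cover n t : 0 <= t < epoch n ->
  exists2 i, (i < n)%N & epoch i <= t < epoch i.+1.
Proof.
elim: n => [|n IH] /andP[t0]; first by rewrite /epoch big_ord0 ltNge t0.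
move=> tn; have [nt|nt] := leP (epoch n) t; first by exists n; rewrite ?nt.
by case: IH => [|i ni ti]; [rewrite t0|exists i => //; exact: ltnW].
Qed.

Definition stepfun n (t : R) : R :=
  \sum_(i < n) f i * \1_(`[epoch i, epoch i.+1[%classic) t.

Lemma stepfunE n t : 0 <= t < epoch n -> g t = stepfun n t.
Proof.
move=> /epoch_cover[i ni ti]; rewrite (gstep ti) /stepfun.
rewrite (bigD1 (Ordinal ni))//= indicE mem_set/=; last by rewrite in_itv.
rewrite mulr1 big1 ?addr0// => j; rewrite -val_eqE /= => ji.
rewrite indicE memNset ?mulr0//= in_itv/= => /andP[tj1 tj2].
case/andP: ti => ti1 ti2; move: ji; rewrite neq_ltn => /orP[ji|ij].
  by have := epoch_homo ji; rewrite leNgt (le_lt_trans ti1).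
by have := epoch_homo ij; rewrite leNgt (le_lt_trans tj1).
Qed.

Lemma measurable_stepfun n : measurable_fun setT (stepfun n).
Proof.
apply: measurable_sum => i; apply: measurable_funM => //.
Qed.

Lemma stepfun_ge0 n t : 0 <= stepfun n t.
Proof. by apply: sumr_ge0 => i _; rewrite mulr_ge0//; case/andP: (f01 i). Qed.

Lemma stepfun_integral n m : (m <= n)%N ->
  (\int[leb]_(t in `[0%R, epoch m[) (stepfun n t)%:E = (accrued m)%:E)%E.
Proof.
move=> mn; under eq_integral do rewrite /stepfun -sumEFin.
rewrite ge0_integral_sum//; last 2 first.
- move=> i; apply/measurable_EFinP/measurable_funTS; exact: measurable_funM.
- by move=> i t _; rewrite lee_fin mulr_ge0//; case/andP: (f01 i).
rewrite -(big_mkord xpredT (fun i => \int[leb]_(t in `[0%R, epoch m[)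
    (f i * \1_(`[epoch i, epoch i.+1[%classic) t)%:E)%E).
rewrite (big_cat_nat _ mn)//= [X in (_ + X)%E]big_nat_cond [X in (_ + X)%E]big1 ?adde0; last first.
  move=> i /andP[/andP[mi _] _]; apply: integral0_eq => t /=.
  rewrite in_itv/= => /andP[_ tm]; rewrite indicE memNset ?mulr0//= in_itv/=.
  by move=> /andP[it _]; have := epoch_homo mi; rewrite leNgt (le_lt_trans it).
rewrite /accrued -(big_mkord xpredT (fun i => f i * h i)) -sumEFin.
rewrite big_nat [RHS]big_nat; apply: eq_bigr => i /= im.
have fi0 : 0 <= f i by case/andP: (f01 i).
under eq_integral do rewrite EFinM.
rewrite ge0_integralZl//; last by apply/measurable_EFinP; exact: measurable_indic.
rewrite integral_indic// EFinM; congr (_ * _)%E.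
transitivity (leb `[epoch i, epoch i.+1[%classic).
  congr (leb _); apply/seteqP; split => t /=; rewrite !in_itv/=; first by case.
  move=> /andP[t1 t2]; split; first by rewrite t1.
  rewrite (lt_le_trans t2 (epoch_homo im)) andbT; apply: le_trans t1.
  by rewrite -[leLHS](_ : epoch 0 = 0) ?epoch_homo// /epoch big_ord0.
rewrite lebesgue_measure_itv/= lte_fin epochS ltrDl.
case: ltP => hi; first by rewrite -EFinD addrAC subrr add0r.
by congr EFin; apply/le_anti; rewrite hi h0.
Qed.

Lemma integral_bounds n m t : (n <= m)%N -> epoch n <= t < epoch m ->
  accrued n <= \int[leb]_(s in `[0, t]) g s <= accrued m.
Proof.
move=> nm /andP[nt tm].
have e0 : 0 <= epoch n.
  by rewrite -[leLHS](_ : epoch 0 = 0) ?epoch_homo// /epoch big_ord0.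
have t0 := le_trans e0 nt.
have E : (\int[leb]_(s in `[0%R, t]) (g s)%:E = \int[leb]_(s in `[0%R, t]) (stepfun m s)%:E)%E.
  apply: eq_integral => s; rewrite inE /= in_itv/= => /andP[s0 st].
  by rewrite (@stepfunE m)// s0 (le_lt_trans st).
have ms : measurable_fun setT (fun s => (stepfun m s)%:E).
  by apply/measurable_EFinP; exact: measurable_stepfun.
have lo : ((accrued n)%:E <= \int[leb]_(s in `[0%R, t]) (g s)%:E)%E.
  rewrite E -(stepfun_integral nm); apply: ge0_subset_integral => //.
  - exact: measurable_funTS.
  - by move=> s _; rewrite lee_fin stepfun_ge0.
  - by move=> s /=; rewrite !in_itv/= => /andP[-> sn]; exact: le_trans (ltW sn) nt.
have up : (\int[leb]_(s in `[0%R, t]) (g s)%:E <= (accrued m)%:E)%E.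
  rewrite E -(stepfun_integral (leqnn m)); apply: ge0_subset_integral => //.
  - exact: measurable_funTS.
  - by move=> s _; rewrite lee_fin stepfun_ge0.
  - by move=> s /=; rewrite !in_itv/= => /andP[-> sn]; exact: le_lt_trans sn tm.
have fin : (\int[leb]_(s in `[0%R, t]) (g s)%:E)%E \is a fin_num.
  rewrite ge0_fin_numE; first by apply: le_lt_trans up _; rewrite ltry.
  by rewrite E; apply: integral_ge0 => s _; rewrite lee_fin stepfun_ge0.
by rewrite /Rintegral -!lee_fin fineK// lo up.
Qed.

(** Let B_n be the epoch k n and A_n the integral of g up to it. For t between
B_n and B_{n+1} the time average lies between A_n / B_{n+1} and A_{n+1} / B_n.
Both bounds have the same limit since (n+1)^2 / (n+2)^2 tends to 1. *)
Lemma sandwich_cvg (k : nat -> nat) (mf m1 : R) : 0 < m1 ->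
  {homo k : n m / (n <= m)%N} ->
  accrued (k n) / (n.+1 ^ 2)%:R @[n --> \oo] --> mf ->
  epoch (k n) / (n.+1 ^ 2)%:R @[n --> \oo] --> m1 ->
  (t^-1 * \int[leb]_(s in `[0, t]) g s : R) @[t --> +oo] --> mf / m1.
Proof.
move=> m10 kh Acv Bcv.
have ratio : n.+1%:R / n.+2%:R @[n --> \oo] --> (1 : R).
  rewrite (_ : (fun n => n.+1%:R / _) = fun n => 1 - @harmonic R n.+1).
    rewrite -{2}(subr0 1); apply: cvgB; first exact: cvg_cst.
    by have := @cvg_harmonic R; rewrite -(cvg_shiftS (@harmonic R : nat -> R^o)).
  apply/funext => n; rewrite /harmonic /=.
  by have -> : n.+2%:R = n.+1%:R + 1 :> R; [rewrite natr1|field; rewrite gt_eqF// ltr_wpDl].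
have ratio2 : (n.+1 ^ 2)%:R / (n.+2 ^ 2)%:R @[n --> \oo] --> (1 : R).
  rewrite (_ : (fun n => (n.+1 ^ 2)%:R / _) = fun n =>
      (n.+1%:R / n.+2%:R) * (n.+1%:R / n.+2%:R) :> R).
    by rewrite -[X in _ --> X](mulr1 1); exact: cvgM.
  by apply/funext => n; rewrite !natrX -expr_div_n expr2.
pose A n := accrued (k n); pose B n := epoch (k n).
pose a n := A n / (n.+1 ^ 2)%:R; pose b n := B n / (n.+1 ^ 2)%:R.
have acv : a n @[n --> \oo] --> mf by [].
have bcv : b n @[n --> \oo] --> m1 by [].
have acv1 : a n.+1 @[n --> \oo] --> mf.
  by have := acv; rewrite -(cvg_shiftS (a : nat -> R^o)).
have bcv1 : b n.+1 @[n --> \oo] --> m1.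
  by have := bcv; rewrite -(cvg_shiftS (b : nat -> R^o)).
have N0 n : (n.+1 ^ 2)%:R != 0 :> R by rewrite pnatr_eq0 expn_eq0.
have cross (u v x y : R) : x != 0 -> y != 0 -> u / v = u / x * (v / y)^-1 * (x / y).
  move=> x0 y0; rewrite invf_div.
  transitivity (u / v * (x^-1 * x) * (y / y)); last by ring.
  by rewrite mulVf// divff// !mulr1.
have lo_cv : A n / B n.+1 @[n --> \oo] --> mf / m1.
  rewrite (_ : (fun n => A n / _) = fun n => a n * (b n.+1)^-1 * ((n.+1 ^ 2)%:R / (n.+2 ^ 2)%:R)).
    rewrite -[X in _ --> X]mulr1; apply: cvgM => //; apply: cvgM => //.
    by apply: cvgV => //; rewrite gt_eqF.
  by apply/funext => n; exact: cross.
have hi_cv : A n.+1 / B n @[n --> \oo] --> mf / m1.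
  rewrite (_ : (fun n => A n.+1 / _) = fun n =>
      a n.+1 * (b n)^-1 * ((n.+1 ^ 2)%:R / (n.+2 ^ 2)%:R)^-1).
    rewrite -[X in _ --> X]mulr1 -{3}(invr1 R); apply: cvgM; last exact: cvgV.
    by apply: cvgM => //; apply: cvgV => //; rewrite gt_eqF.
  apply/funext => n; rewrite -[X in _ = _ * X^-1]invf_div invrK.
  exact: cross.
have B_homo : {homo B : n m / (n <= m)%N >-> n <= m}.
  by move=> n m nm; apply: epoch_homo; exact: kh.
have B0 n : 0 <= B n.
  by rewrite -[leLHS](_ : epoch 0 = 0) ?epoch_homo// /epoch big_ord0.
have A0 n : 0 <= A n.
  by apply: sumr_ge0 => i _; rewrite mulr_ge0//; case/andP: (f01 i).
have B_unb t : exists n, t < B n.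
  have m2 : 0 < m1 / 2 by rewrite divr_gt0.
  have /cvgrPdist_lt /(_ _ m2)[n0 _ hn0] := bcv.
  have [n1 hn1] : exists n1 : nat, t / (m1 / 2) < n1%:R.
    exists (Num.truncn `|t / (m1 / 2)|).+1.
    by apply: le_lt_trans (ler_norm _) _; rewrite truncnS_gt.
  exists (maxn n0 n1); set n := maxn n0 n1.
  have h2 : m1 / 2 < B n / (n.+1 ^ 2)%:R.
    have : `|m1 - b n| < m1 / 2 by apply: hn0; exact: leq_maxl.
    by rewrite -/(b n); move: (b n) => z; rewrite ltr_norml => /andP[_]; lra.
  have nn0 : 0 < (n.+1 ^ 2)%:R :> R by rewrite lt0r N0 ler0n.
  move: h2; rewrite ltr_pdivlMr// => /(lt_trans _); apply.
  rewrite mulrC -ltr_pdivrMr//; apply: lt_le_trans hn1 _.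
  rewrite ler_nat; apply: (@leq_trans n); first exact: leq_maxr.
  by apply: (@leq_trans (n.+1 ^ 1)); [rewrite expn1|rewrite leq_pexp2l].
apply/cvgrPdist_lt => e e0.
have /cvgrPdist_lt /(_ _ e0)[n0 _ lo] := lo_cv.
have /cvgrPdist_lt /(_ _ e0)[n1 _ hi] := hi_cv.
have [n2 Bn2] := B_unb 0.
pose m := maxn n0 (maxn n1 n2).
have [m0 [m_1 m_2]] : [/\ (n0 <= m)%N & (n1 <= m)%N /\ (n2 <= m)%N].
  by split; [|split]; rewrite /m !leq_max !leqnn ?orbT.
exists (B m); split; first exact: num_real.
move=> t /ltW tB /=.
have exn : exists n, (m <= n)%N && (t < B n.+1).
  have [n tn] := B_unb t; exists (maxn m n); rewrite leq_maxl/=.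
  by apply: lt_le_trans tn (B_homo _ _ _); rewrite leqW// leq_maxr.
case: (ex_minnP exn) => n /andP[mn tn] nmin.
have Bnt : B n <= t.
  have [->//|nm] := eqVneq n m; rewrite leNgt; apply/negP => tBn.
  have n_gt0 : (0 < n)%N by move: nm mn; lia.
  have := nmin n.-1; rewrite prednK// tBn andbT.
  by move=> /(_ _); move: nm mn; lia.
have Bn0 : 0 < B n.
  by apply: lt_le_trans Bn2 (B_homo _ _ _); exact: leq_trans mn.
have t0 : 0 < t by exact: lt_le_trans Bnt.
have /andP[I1 I2] : A n <= \int[leb]_(s in `[0, t]) g s <= A n.+1.
  by apply: integral_bounds; [exact: kh|rewrite Bnt tn].
have /= L := lo n (leq_trans m0 mn); have /= U := hi n (leq_trans m_1 mn).
set I := \int[leb]_(s in `[0, t]) g s in I1 I2 *.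
have h1 : A n / B n.+1 <= t^-1 * I.
  rewrite mulrC ler_pM// ?invr_ge0// lef_pV2 ?posrE ?(ltW tn)//.
  exact: lt_trans tn.
have h2 : t^-1 * I <= A n.+1 / B n.
  rewrite mulrC ler_pM// ?invr_ge0 ?(ltW t0)//; first exact: le_trans I1.
  by rewrite lef_pV2 ?posrE.
by move: L U; rewrite !ltr_norml; lra.
Qed.

End StepPath.

(** * Configurations in terms of gaps *)

Section Configurations.
Implicit Types (x y : conf) (i j k n : nat) (c : int).

Definition gap x j : nat := absz (x j.+1 - x j - 1)%R.

(** The particles far to the right occupy the sites c + j. The jumps of
particles preserve c, so that these sets are the components of the state space.
*)
Definition settled c : set conf :=
  [set x | XX x /\ exists n, forall j, (n <= j)%N -> x j = c + j%:Z].

Lemma gapE x j : XX x -> (gap x j)%:Z = x j.+1 - x j - 1.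
Proof. by move=> /(_ j); rewrite /gap; lia. Qed.

Lemma XX_dist x i j : XX x -> (i <= j)%N -> x i + (j - i)%N%:Z <= x j.
Proof.
move=> Xx /subnKC <-; elim: (j - i)%N => [|m IH]; first by rewrite addn0 subnn addr0.
have := Xx (i + m)%N; rewrite addnS; move: IH; rewrite !addKn -addnS addKn.
lia.
Qed.

(** Jumps are unobstructed when the gap on the relevant side is not 0; nothing
obstructs the first particle on its left. *)
Definition canL x k : bool := (k == 0%N) || (0 < gap x k.-1)%N.
Definition canR x k : bool := (0 < gap x k)%N.

Lemma free_left x k : XX x -> (~ range x (x k - 1)) <-> canL x k.
Proof.
move=> Xx; rewrite /canL; split.
  case: k => [//|k] /= nr; rewrite lt0n; apply/negP => /eqP g0.
  by apply: nr; exists k => //; have := gapE k Xx; rewrite g0; lia.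
case: k => [|k] /= h [i _ xi].
  by have := XX_dist Xx (leq0n i); lia.
have := gapE k Xx; have [ik|ki] := leqP i k.
  by have := XX_dist Xx ik; lia.
by have := XX_dist Xx ki; lia.
Qed.

Lemma free_right x k : XX x -> (~ range x (x k + 1)) <-> canR x k.
Proof.
move=> Xx; rewrite /canR; split.
  move=> nr; rewrite lt0n; apply/negP => /eqP g0.
  by apply: nr; exists k.+1 => //; have := gapE k Xx; rewrite g0; lia.
move=> h [i _ xi]; have := gapE k Xx; have [ik|ki] := leqP i k.
  by have := XX_dist Xx ik; lia.
by have := XX_dist Xx ki; lia.
Qed.

Lemma moveK x k (d : int) : move (move x k d) k (- d) = x.
Proof. by apply/funext => i; rewrite /move eqxx; case: eqP => [->|]//; lia. Qed.

Lemma move_inj x k k' (d d' : int) : d != 0 -> move x k d = move x k' d' ->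
  k = k' /\ d = d'.
Proof.
move=> d0 e; have := congr1 (fun y => y k) e; rewrite /move eqxx.
by case: eqP => [-> |_]; [split => //; lia|lia].
Qed.

Lemma XX_left x k : XX x -> canL x k -> XX (move x k (-1)).
Proof.
move=> Xx cL j; rewrite /move; have Xj := Xx j.
have gj := gapE j Xx; move: cL; rewrite /canL.
by case: (eqVneq j k) => jk; case: (eqVneq j.+1 k) => jk1; subst => /=; lia.
Qed.

Lemma XX_right x k : XX x -> canR x k -> XX (move x k 1).
Proof.
move=> Xx cR j; rewrite /move; have Xj := Xx j; have Xk := gapE k Xx; move: cR; rewrite /canR => cR.
by case: (eqVneq j k) => jk; case: (eqVneq j.+1 k) => jk1; try lia; subst; lia.
Qed.

Lemma gap_left x k j : XX x -> canL x k -> gap (move x k (-1)) j =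
  if j == k then (gap x k).+1 else if j.+1 == k then (gap x j).-1 else gap x j.
Proof.
move=> Xx cL; have XL := XX_left Xx cL; have := gapE j XL; have := gapE j Xx.
have := gapE k Xx; rewrite /move.
by case: (eqVneq j k) => jk; case: (eqVneq j.+1 k) => jk1; subst;
    move: cL; rewrite /canL /=; try lia.
Qed.

Lemma gap_right x k j : XX x -> canR x k -> gap (move x k 1) j =
  if j == k then (gap x k).-1 else if j.+1 == k then (gap x j).+1 else gap x j.
Proof.
move=> Xx cR; have XR := XX_right Xx cR; have := gapE j XR; have := gapE j Xx.
have := gapE k Xx; rewrite /move; move: cR; rewrite /canR => cR.
by case: (eqVneq j k) => jk; case: (eqVneq j.+1 k) => jk1; subst; try lia.
Qed.

Lemma canR_left x k : XX x -> canL x k -> canR (move x k (-1)) k.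
Proof. by move=> Xx cL; rewrite /canR gap_left// eqxx. Qed.

Lemma canL_right x k : XX x -> canR x k -> canL (move x k 1) k.
Proof.
move=> Xx cR; rewrite /canL; case: k cR => [//|k] cR /=.
by rewrite gap_right// eqxx; case: eqP => [?|]; lia.
Qed.

Lemma settled_move c x k d : settled c x -> XX (move x k d) -> settled c (move x k d).
Proof.
move=> [_ [n hn]] Xy; split => //; exists (maxn n k.+1) => j.
rewrite geq_max => /andP[nj kj]; rewrite /move ifF ?hn//.
by apply/negbTE; rewrite neq_ltn kj orbT.
Qed.

(** The first index from which on all gaps vanish: the particles from this
index on are packed. The default 0 is for configurations where there is none.
*)
Definition level x : nat :=
  if pselect (exists n, `[< forall j, (n <= j)%N -> gap x j = 0%N >]) is left h
  then ex_minn h else 0%N.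

Lemma settled_gap0 c x : settled c x ->
  exists n, `[< forall j, (n <= j)%N -> gap x j = 0%N >].
Proof.
move=> [Xx [n hn]]; exists n; apply/asboolP => j nj.
by have := gapE j Xx; rewrite !hn ?leqW//; lia.
Qed.

Lemma level_gap0 c x j : settled c x -> (level x <= j)%N -> gap x j = 0%N.
Proof.
move=> /settled_gap0 h; rewrite /level; case: pselect => // h'.
by case: ex_minnP => n /asboolP hn _; exact: hn.
Qed.

Lemma ltn_level c x j : settled c x -> (0 < gap x j)%N -> (j < level x)%N.
Proof. by move=> sx gj; rewrite ltnNge; apply/negP => /(level_gap0 sx) g0; rewrite g0 in gj. Qed.

Lemma level_last c x n : settled c x -> level x = n.+1 -> (0 < gap x n)%N.
Proof.
move=> sx; have h := settled_gap0 sx; rewrite /level; case: pselect => // h'.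
case: ex_minnP => m /asboolP hm mmin mn; rewrite lt0n; apply/negP => /eqP gn.
have : (m <= n)%N.
  apply: mmin; apply/asboolP => j; rewrite leq_eqVlt => /orP[/eqP <- //|nj].
  by apply: hm; rewrite mn.
by rewrite mn ltnn.
Qed.

Lemma level_le c x n : settled c x -> (forall j, (n <= j)%N -> gap x j = 0%N) ->
  (level x <= n)%N.
Proof.
move=> sx hn; case E: (level x) => [//|m]; rewrite ltnNge; apply/negP => nm.
by have := level_last sx E; rewrite hn.
Qed.

Lemma settledE c x j : settled c x -> (level x <= j)%N -> x j = c + j%:Z.
Proof.
move=> sx lj; case: (sx) => Xx [n hn].
have H m : x (j + m)%N = x j + m%:Z.
  elim: m => [|m IH]; first by rewrite addn0 addr0.
  have := gapE (j + m) Xx; rewrite (level_gap0 sx) ?(leq_trans lj) ?leq_addr//.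
  by rewrite addnS; lia.
by have := H n; rewrite hn ?leq_addl//; lia.
Qed.

(** A settled configuration is determined by its gaps, read from the right. *)
Lemma settled_tail c x n j : settled c x -> (level x <= n)%N -> (j <= n)%N ->
  x j = c + j%:Z - (\sum_(j <= i < n) gap x i)%N%:Z.
Proof.
move=> sx ln jn; case: (sx) => Xx _.
rewrite -(subKn jn); elim: (n - j)%N (leq_subr j n) => [|m IH] mn.
  by rewrite subn0 big_geq// subr0 (settledE sx).
have := IH (ltnW mn); have := gapE (n - m.+1) Xx.
have e : (n - m.+1).+1 = (n - m)%N by lia.
rewrite (big_ltn (m := (n - m.+1)%N)); last lia.
rewrite e; lia.
Qed.

Lemma settled_ge c x : settled c x -> x 0%N <= c.
Proof. by move=> sx; rewrite (settled_tail sx (leqnn _) (leq0n _)); lia. Qed.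

Lemma gap_le c x j : settled c x -> (gap x j)%:Z <= c - x 0%N.
Proof.
move=> sx; pose n := maxn (level x) j.+1.
rewrite (settled_tail sx (leq_maxl _ j.+1) (leq0n _)) -/n.
rewrite (big_cat_nat (n := j)) ?leq_maxr//=; last first.
  by apply: leq_trans (leq_maxr _ _); exact: ltnW.
rewrite (big_ltn (m := j)); last exact: leq_maxr.
lia.
Qed.

(** The level rises only by the jump of the particle at the level itself, which
is the first of the packed ones; the jumps beyond it are blocked. *)
Lemma level_left c x k : settled c x -> canL x k ->
  (k <= level x)%N /\ level (move x k (-1)) =
     if k == level x then k.+1 else level x.
Proof.
move=> sx cL; case: (sx) => Xx _.
have kl : (k <= level x)%N.
  by case: k cL => [//|k] /=; rewrite /canL /=; exact: (ltn_level sx).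
split => //; have sy := settled_move sx (XX_left Xx cL).
apply/eqP; rewrite eqn_leq; apply/andP; split.
  apply: (level_le sy) => j; rewrite gap_left//.
  case: (eqVneq k (level x)) => [->|kl'] lj.
    by rewrite gtn_eqF// gtn_eqF ?(level_gap0 sx)//; exact: ltnW.
  have kl2 : (k < level x)%N by rewrite ltn_neqAle kl' kl.
  rewrite gtn_eqF ?(leq_trans kl2)// (level_gap0 sx lj).
  by case: eqP.
case: (eqVneq k (level x)) => [kl'|kl'].
  by apply: (ltn_level sy); rewrite gap_left// eqxx.
have kl2 : (k < level x)%N by rewrite ltn_neqAle kl' kl.
case E: (level x) => [//|m]; apply: (ltn_level sy).
have gm := level_last sx E; rewrite gap_left//; case: eqP => // mk.
by rewrite ifF//; apply/negbTE; rewrite E in kl2; lia.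
Qed.

End Configurations.

(** * The reversible weight and the network of the exclusion process *)

Section Model.
Context {R : realType} (a b : nat -> R).
Hypothesis ha : forall k, 0 < a k.
Hypothesis hb : forall k, 0 < b k.
Implicit Types (x y : conf) (i j k n : nat) (c : int).

Lemma alpha_gt0 k : 0 < alpha a b k.
Proof. by rewrite divr_gt0// prodr_gt0. Qed.

Lemma alpha0 : alpha a b 0 = 1.
Proof. by rewrite /alpha !big_ord0 divr1. Qed.

(** Detailed balance in its simplest form: moving particle k to the left
lengthens gap k and shortens gap k - 1. *)
Lemma alphaS k : alpha a b k.+1 * b k = alpha a b k * a k.
Proof.
have B0 : \prod_(i < k) b i != 0 by rewrite gt_eqF// prodr_gt0.
have bk := lt0r_neq0 (hb k).
by rewrite /alpha !big_ord_recr/=; field; rewrite B0 bk.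
Qed.

(** The gaps are independent geometric variables of parameters alpha_1,
alpha_2, ... under the normalised weight. *)
Definition weight x : R := \prod_(j < level x) alpha a b j.+1 ^+ gap x j.

Lemma weight_gt0 x : 0 < weight x.
Proof. by apply: prodr_gt0 => j _; rewrite exprn_gt0// alpha_gt0. Qed.

Lemma weightE c x n : settled c x -> (level x <= n)%N ->
  weight x = \prod_(j < n) alpha a b j.+1 ^+ gap x j.
Proof.
move=> sx ln; rewrite /weight (big_ord_widen _ (fun j => alpha a b j.+1 ^+ gap x j) ln).
rewrite [LHS]big_mkcond; apply: eq_bigr => j _; case: ltnP => // lj.
by rewrite (level_gap0 sx lj) expr0.
Qed.

Lemma weight_left c x k : settled c x -> canL x k ->
  weight (move x k (-1)) * b k = weight x * a k.
Proof.
move=> sx cL; case: (sx) => Xx _; have sy := settled_move sx (XX_left Xx cL).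
set y := move x k (-1) in sy *.
suff H : weight y * alpha a b k = weight x * alpha a b k.+1.
  apply: (mulIf (lt0r_neq0 (alpha_gt0 k))).
  transitivity (weight y * alpha a b k * b k); first by ring.
  by rewrite H -mulrA alphaS; ring.
pose n := maxn (maxn (level x) (level y)) k.+1.
have lx : (level x <= n)%N by rewrite /n !leq_max leqnn.
have ly : (level y <= n)%N by rewrite /n !leq_max leqnn orbT.
have kn : (k < n)%N by rewrite /n !leq_max leqnn !orbT.
rewrite (weightE sy ly) (weightE sx lx).
have gy := gap_left _ Xx cL.
have e1 : \prod_(j < n) (if j.+1 == k then alpha a b j.+1 else 1) = alpha a b k.
  rewrite -big_mkcond; case: (k) kn => [|k'] kn.
    by rewrite big_pred0 ?alpha0.
  by rewrite (big_pred1 (Ordinal (ltnW kn))).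
have e2 : \prod_(j < n) (if nat_of_ord j == k then alpha a b j.+1 else 1) = alpha a b k.+1.
  by rewrite -big_mkcond (big_pred1 (Ordinal kn)).
rewrite -e2 -[in LHS]e1 -!big_split/=; apply: eq_bigr => j _.
rewrite gy; case: (eqVneq (j : nat) k) => [->|jk].
  by rewrite exprSr gtn_eqF// mulr1.
case: (eqVneq j.+1 k) => [jk1|_]; last by rewrite !mulr1.
rewrite mulr1 -exprSr prednK//.
by move: cL; rewrite /canL -jk1.
Qed.

Lemma weight_right c x k : settled c x -> canR x k ->
  weight (move x k 1) * a k = weight x * b k.
Proof.
move=> sx cR; case: (sx) => Xx _; have sy := settled_move sx (XX_right Xx cR).
by rewrite -(weight_left sy (canL_right Xx cR)) moveK.
Qed.

(** The lists stop at the level, beyond which all jumps are blocked. *)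
Definition nbs x : seq conf :=
  [seq move x k (-1) | k <- iota 0 (level x).+1 & canL x k] ++
  [seq move x k 1 | k <- iota 0 (level x) & canR x k].

Lemma mem_nbs c x y : settled c x -> reflect
  (exists k, (canL x k /\ y = move x k (-1)) \/ (canR x k /\ y = move x k 1))
  (y \in nbs x).
Proof.
move=> sx; apply: (iffP idP).
  rewrite mem_cat => /orP[] /mapP[k]; rewrite mem_filter => /andP[ck _] ->; exists k.
    by left.
  by right.
move=> [k [[ck ->]|[ck ->]]]; rewrite mem_cat; apply/orP.
  left; apply/mapP; exists k => //; rewrite mem_filter ck mem_iota /= ltnS.
  by case: (level_left sx ck).
right; apply/mapP; exists k => //; rewrite mem_filter ck mem_iota /=.
exact: (ltn_level sx).
Qed.

Lemma nbs_settled c x y : settled c x -> y \in nbs x -> settled c y.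
Proof.
move=> sx; case: (sx) => Xx _.
by case/(mem_nbs _ sx) => k [[ck ->]|[ck ->]]; apply: settled_move => //;
  [exact: XX_left|exact: XX_right].
Qed.

Lemma nbs_sym_imp c x y : settled c x -> y \in nbs x -> x \in nbs y.
Proof.
move=> sx yx; have sy := nbs_settled sx yx; case: (sx) => Xx _.
apply/(mem_nbs _ sy); case/(mem_nbs _ sx): yx => k [[ck ->]|[ck ->]]; exists k.
  by right; rewrite moveK; split => //; exact: canR_left.
by left; rewrite moveK; split => //; exact: canL_right.
Qed.

Lemma uniq_nbs x : uniq (nbs x).
Proof.
have inj (d : int) : d != 0 -> injective (fun k => move x k d).
  by move=> d0 k k' /(move_inj d0)[].
rewrite cat_uniq !map_inj_uniq ?filter_uniq ?iota_uniq//=; try exact: inj.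
rewrite andbT; apply/hasPn => y /mapP[k _ ->]; apply/negP => h.
have /mapP[k' _] : move x k 1 \in [seq move x k (-1) | k <- iota 0 (level x).+1 & canL x k] by [].
by move/(move_inj (oner_neq0 _))=> [].
Qed.

Lemma nbs0 x : move x 0 (-1) \in nbs x.
Proof. by rewrite mem_cat; apply/orP; left; apply/mapP;
    exists 0%N => //; rewrite mem_filter mem_iota. Qed.

Lemma rate_left c x k : settled c x -> canL x k -> rate a b x (move x k (-1)) = a k.
Proof.
move=> [Xx _] cL; rewrite /rate.
rewrite (_ : [set _ | _] = [set k]); last first.
  apply/seteqP; split => [k' [_ /move_inj[]//]|_ ->] /=.
  by split => //; apply/(free_left _ Xx).
rewrite fsbig_set1 (_ : [set _ | _] = set0) ?fsbig_set0 ?addr0//.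
by apply/seteqP; split => // k' [_ /move_inj[]].
Qed.

Lemma rate_right c x k : settled c x -> canR x k -> rate a b x (move x k 1) = b k.
Proof.
move=> [Xx _] cR; rewrite /rate.
rewrite (_ : [set _ | _] = set0); last first.
  by apply/seteqP; split => // k' [_ /move_inj[]].
rewrite fsbig_set0 add0r (_ : [set _ | _] = [set k]) ?fsbig_set1//.
apply/seteqP; split => [k' [_ /move_inj[]//]|_ ->] /=.
by split => //; apply/(free_right _ Xx).
Qed.

Lemma rate_eq0 c x y : settled c x -> y \notin nbs x -> rate a b x y = 0.
Proof.
move=> sx /negP ny; case: (sx) => Xx _; rewrite /rate.
rewrite (_ : [set _ | _] = set0); last first.
  apply/seteqP; split => // k' [/(free_left _ Xx) ck yk].
  by apply: ny; apply/(mem_nbs _ sx); exists k'; left.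
rewrite fsbig_set0 add0r (_ : [set _ | _] = set0) ?fsbig_set0//.
apply/seteqP; split => // k' [/(free_right _ Xx) ck yk].
by apply: ny; apply/(mem_nbs _ sx); exists k'; right.
Qed.

Lemma rate_gt0 c x y : settled c x -> y \in nbs x -> 0 < rate a b x y.
Proof.
move=> sx /(mem_nbs _ sx)[k [[ck ->]|[ck ->]]].
  by rewrite (rate_left sx).
by rewrite (rate_right sx).
Qed.

(** Detailed balance: a jump to the left and its reverse are both free or both
blocked. *)
Lemma weight_rate_sym c x y : settled c x -> settled c y ->
  weight x * rate a b x y = weight y * rate a b y x.
Proof.
move=> sx sy; have [yx|yx] := boolP (y \in nbs x); last first.
  rewrite (rate_eq0 sx yx) (rate_eq0 sy) ?mulr0//.
  by apply: contra yx; exact: (nbs_sym_imp sy).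
case: (sx) => Xx _; move: sy; case/(mem_nbs _ sx) : yx => k [[ck ->]|[ck ->]] sy.
  rewrite (rate_left sx)// -(weight_left sx ck); congr (_ * _).
  by have := rate_right sy (canR_left Xx ck); rewrite moveK.
rewrite (rate_right sx)// -(weight_right sx ck); congr (_ * _).
by have := rate_left sy (canL_right Xx ck); rewrite moveK.
Qed.

Section Network.
Variable c : int.

(** Configurations outside the component c receive a self-loop. This makes a
network of the whole type of configurations, on which such states are isolated.
*)
Definition exclusion_nbr x : seq conf := if `[< settled c x >] then nbs x else [:: x].
Definition exclusion_cond x y : R :=
  if `[< settled c x >] then weight x * rate a b x y else (x == y)%:R.

Lemma exclusion_nbr_uniq x : uniq (exclusion_nbr x).
Proof. by rewrite /exclusion_nbr; case: ifP => // _; exact: uniq_nbs. Qed.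

Lemma exclusion_nbr_sym x y : (y \in exclusion_nbr x) = (x \in exclusion_nbr y).
Proof.
rewrite /exclusion_nbr; case: asboolP => sx; case: asboolP => sy.
- by apply/idP/idP; [exact: (nbs_sym_imp sx)|exact: (nbs_sym_imp sy)].
- rewrite mem_seq1; apply/idP/eqP => [/(nbs_settled sx)//|xy].
  by rewrite xy in sx.
- rewrite mem_seq1; apply/eqP/idP => [yx|/(nbs_settled sy)//].
  by rewrite yx in sy.
- by rewrite !mem_seq1 eq_sym.
Qed.

Lemma exclusion_nbr_neq0 x : exclusion_nbr x != [::].
Proof.
by rewrite /exclusion_nbr; case: ifP.
Qed.

Lemma exclusion_cond_sym x y : exclusion_cond x y = exclusion_cond y x.
Proof.
rewrite /exclusion_cond; case: asboolP => sx; case: asboolP => sy.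
- exact: weight_rate_sym sx sy.
- rewrite (rate_eq0 sx) ?mulr0; last by apply/negP => /(nbs_settled sx).
  by case: eqP => // yx; rewrite yx in sy.
- rewrite (rate_eq0 sy) ?mulr0; last by apply/negP => /(nbs_settled sy).
  by case: eqP => // xy; rewrite xy in sx.
- by rewrite eq_sym.
Qed.

Lemma exclusion_cond_gt0 x y : y \in exclusion_nbr x -> 0 < exclusion_cond x y.
Proof.
rewrite /exclusion_nbr /exclusion_cond; case: asboolP => sx.
  by move=> yx; rewrite mulr_gt0 ?weight_gt0// (rate_gt0 sx).
by rewrite mem_seq1 => /eqP ->; rewrite eqxx.
Qed.

Lemma exclusion_cond_eq0 x y : y \notin exclusion_nbr x -> exclusion_cond x y = 0.
Proof.
rewrite /exclusion_nbr /exclusion_cond; case: asboolP => sx.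
  by move=> yx; rewrite (rate_eq0 sx)// mulr0.
by rewrite mem_seq1 eq_sym => /negPf ->.
Qed.

Definition exclusion : network R conf := Network exclusion_nbr_uniq
  exclusion_nbr_sym exclusion_nbr_neq0 exclusion_cond_sym exclusion_cond_gt0
  exclusion_cond_eq0.

Definition total_rate x : R := \sum_(y <- nbs x) rate a b x y.

Lemma exclusion_nbrE x : settled c x -> nbr exclusion x = nbs x.
Proof. by rewrite /= /exclusion_nbr => sx; rewrite asboolT. Qed.

Lemma exclusion_condE x y : settled c x -> cond exclusion x y = weight x * rate a b x y.
Proof. by rewrite /= /exclusion_cond => sx; rewrite asboolT. Qed.

Lemma exclusion_wt x : settled c x -> wt exclusion x = weight x * total_rate x.
Proof.
move=> sx; rewrite /wt exclusion_nbrE// mulr_sumr.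
by apply: eq_bigr => y _; exact: exclusion_condE.
Qed.

(** The first particle is always free to jump left. *)
Lemma total_rate_ge x : settled c x -> a 0%N <= total_rate x.
Proof.
move=> sx; rewrite /total_rate (bigD1_seq _ (nbs0 x) (uniq_nbs x)).
rewrite (rate_left sx)// lerDl big_seq_cond; apply: sumr_ge0 => y /andP[yx _].
exact/ltW/(rate_gt0 sx).
Qed.

Lemma exclusion_trans x y : settled c x ->
  trans exclusion x y = rate a b x y / total_rate x.
Proof.
move=> sx; rewrite /trans exclusion_wt// exclusion_condE//.
have w0 := lt0r_neq0 (weight_gt0 x).
have q0 := lt0r_neq0 (lt_le_trans (ha 0%N) (total_rate_ge sx)).
by field; rewrite q0 w0.
Qed.

Lemma settled_XF x : settled c x -> XF x.
Proof.
move=> sx; case: (sx) => Xx _; split => //.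
apply: (sub_finite_set (B := `I_(level x))); last exact: finite_II.
move=> k /= xk; rewrite ltnNge; apply/negP => lk; move: xk.
by rewrite (settledE sx lk) (settledE sx (leqW lk)) => /eqP; apply; lia.
Qed.

Lemma exit_rateE x : settled c x -> exit_rate XF (rate a b) x = total_rate x.
Proof.
move=> sx; rewrite /exit_rate.
have -> : (\esum_(y in XF) (rate a b x y)%:E = \esum_(y in [set` nbs x]) (rate a b x y)%:E)%E.
  rewrite esum_mkcond [RHS]esum_mkcond; apply: eq_esum => y _.
  have [yx|yx] := boolP (y \in nbs x).
    rewrite mem_set; last exact: settled_XF (nbs_settled sx yx).
    by rewrite mem_set.
  by rewrite (rate_eq0 sx yx); do 2!case: ifP.
rewrite esum_fset; last 2 first.
- exact: finite_seq.
- by move=> y; rewrite inE /= => yx; rewrite lee_fin ltW// (rate_gt0 sx).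
by rewrite -fsbig_seq ?uniq_nbs// sumEFin.
Qed.

End Network.
End Model.

(** * Finiteness of the reversible weight *)

Lemma nneseries_unbounded (R : realType) (u : nat -> R) : (forall k, 0 <= u k) ->
  (\sum_(0 <= k <oo) (u k)%:E = +oo)%E -> forall M, exists n, M < \sum_(j < n) u j.
Proof.
move=> u0 uoo M; apply: contrapT => h.
suff : (\sum_(0 <= k <oo) (u k)%:E <= M%:E)%E by rewrite uoo leye_eq.
apply: lime_le; first by apply: is_cvg_nneseries => n _ _; rewrite lee_fin.
apply: nearW => n; rewrite sumEFin lee_fin big_mkord leNgt; apply/negP => Mn.
by apply: h; exists n.
Qed.

Lemma nneseries_bounded (R : realType) (u : nat -> R) : (forall k, 0 <= u k) ->
  (\sum_(0 <= k <oo) (u k)%:E < +oo)%E -> exists M, forall n, \sum_(j < n) u j <= M.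
Proof.
move=> u0 uoo; exists (fine (\sum_(0 <= k <oo) (u k)%:E)%E) => n.
rewrite -lee_fin fineK; last first.
  by rewrite ge0_fin_numE//; apply: nneseries_ge0 => k _ _; rewrite lee_fin.
rewrite -sumEFin -(big_mkord xpredT (fun i => (u i)%:E)).
by apply: nneseries_lim_ge => k _ _; rewrite lee_fin.
Qed.

Section Stationary.
Context {R : realType} (a b : nat -> R).
Hypothesis ha : forall k, 0 < a k.
Hypothesis hb : forall k, 0 < b k.
Implicit Types (x y : conf) (i j k n : nat) (c : int).
Local Notation alpha := (alpha a b).
Local Notation beta := (beta a b).
Local Notation weight := (weight a b).

Let alpha_gt0 k : 0 < alpha k. Proof. exact: alpha_gt0. Qed.

Lemma betaE k : beta k = alpha k * \sum_(j < k) (a j * alpha j)^-1.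
Proof.
rewrite mulr_sumr; apply: eq_bigr => -[j /= jk] _.
have split_prod (u : nat -> R) : \prod_(i < k) u i = (\prod_(i < j) u i) * \prod_(j <= i < k) u i.
  by rewrite -!(big_mkord xpredT u) (big_cat_nat (n := j))// ltnW.
rewrite /Defs.alpha (split_prod a) (split_prod b) (big_ltn jk (F := a)).
have A0 : \prod_(i < j) a i != 0 by rewrite gt_eqF// prodr_gt0.
have B0 : \prod_(i < j) b i != 0 by rewrite gt_eqF// prodr_gt0.
have B1 : \prod_(j <= i < k) b i != 0 by rewrite gt_eqF// prodr_gt0.
have aj := lt0r_neq0 (ha j).
by field; rewrite A0 B0 B1 aj.
Qed.

(** Since beta_k / alpha_k is the sum of the 1 / (a_j alpha_j) for j < k, and
alpha is bounded, this ratio is unbounded. Positivity of alpha_k + v beta_k for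
all k then forces v >= 0, and alpha_k + v beta_k < 1 gives alpha_k < 1. *)
Lemma alpha_lt1 k : (0 < k)%N -> (forall M : R, exists n, M < \sum_(j < n) (a j)^-1) ->
  (exists M : R, forall n, \sum_(j < n) alpha j <= M) -> admissible_v a b !=set0 ->
  alpha k < 1.
Proof.
move=> k0 asum [M alM] [v hv]; suff v0 : 0 <= v.
  have /andP[_] := hv k k0; apply: le_lt_trans; rewrite lerDl mulr_ge0// betaE.
  rewrite mulr_ge0 ?(ltW (alpha_gt0 k))//; apply: sumr_ge0 => j _.
  by rewrite invr_ge0 mulr_ge0// ltW.
rewrite leNgt; apply/negP => v0.
have al_le j : alpha j <= M.
  apply: le_trans (alM j.+1); rewrite big_ord_recr/= lerDr.
  by apply: sumr_ge0 => i _; exact: ltW.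
have M0 : 0 < M by exact: lt_le_trans (al_le 0%N).
have [n hn] := asum (M / - v).
have n0 : (0 < n)%N.
  case: n hn => [|//]; rewrite big_ord0 => h.
  by have := lt_trans h (_ : 0 < M / - v); rewrite ltxx; apply; rewrite divr_gt0// oppr_gt0.
have /andP[pos _] := hv n n0.
move: pos; rewrite betaE mulrCA -{1}(mulr1 (alpha n)) -mulrDr pmulr_rgt0//.
have : \sum_(j < n) (a j)^-1 / M <= \sum_(j < n) (a j * alpha j)^-1.
  apply: ler_sum => j _; rewrite invfM ler_wpM2l ?invr_ge0 ?(ltW (ha j))//.
  by rewrite lef_pV2// posrE.
rewrite -mulr_suml; move: hn; rewrite ltr_pdivrMr ?oppr_gt0// mulrN.
set s := \sum_(j < n) _; set t := \sum_(j < n) _.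
rewrite ler_pdivrMr// => h1 h2; rewrite ltNge => /negP; apply.
have : v * (t * M) <= v * s by rewrite ler_wnM2l// ltW.
have h3 : v * s < - M by lra.
move=> /le_lt_trans /(_ h3); rewrite mulrA -subr_lt0 opprK => h4.
have : (v * t + 1) * M < 0 by lra.
by rewrite pmulr_llt0// => /ltW; rewrite addrC.
Qed.

Lemma geometric_le (r : R) m : 0 <= r < 1 -> \sum_(i < m) r ^+ i <= (1 - r)^-1.
Proof.
move=> /andP[r0 r1]; have d0 : 0 < 1 - r by rewrite subr_gt0.
rewrite -[leRHS]mul1r ler_pdivlMr//.
have -> : (\sum_(i < m) r ^+ i) * (1 - r) = 1 - r ^+ m.
  elim: m => [|m IH]; first by rewrite big_ord0 mul0r expr0 subrr.
  by rewrite big_ord_recr/= mulrDl IH exprSr; ring.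
by rewrite gerBl exprn_ge0.
Qed.

(** The product of the 1 / (1 - alpha_k) converges since alpha is summable and,
as it tends to 0 with all its terms below 1, bounded away from 1. *)
Lemma prod_geometric_bounded : (forall k, alpha k.+1 < 1) ->
  (exists M : R, forall n, \sum_(j < n) alpha j <= M) ->
  exists Z, forall n m, \prod_(j < n) \sum_(i < m) alpha j.+1 ^+ i <= Z.
Proof.
move=> al1 [M alM].
have alM' n : \sum_(j < n) alpha j.+1 <= M.
  apply: le_trans (alM n.+1); rewrite big_ord_recl lerDr.
  exact: ltW.
have ca : cvgn (series (fun j => alpha j.+1)).
  apply: nondecreasing_is_cvgn.
    by apply/nondecreasing_seqP => n; rewrite /series/= big_nat_recr//= lerDl ltW.
  by exists M => _ [n _ <-]; rewrite /series/= big_mkord.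
have /cvgrPdist_lt := cvg_series_cvg_0 ca.
have h2 : 0 < 2^-1 :> R by rewrite invr_gt0.
move=> /(_ _ h2)[n0 _ hn0].
have [rho rho1 hrho] : exists2 rho : R, rho < 1 & forall j, alpha j.+1 <= rho.
  have [r r1 hr] : exists2 r : R, r < 1 & forall j, (j < n0)%N -> alpha j.+1 <= r.
    elim: (n0) => [|n [r r1 hr]]; first by exists 0.
    exists (Num.max r (alpha n.+1)); first by rewrite gt_max r1 al1.
    move=> j; rewrite ltnS leq_eqVlt => /orP[/eqP ->|/hr jr].
      by rewrite le_max lexx orbT.
    by rewrite le_max jr.
  exists (Num.max r 2^-1); first by rewrite gt_max r1 invf_lt1 ?ltr1n.
  move=> j; have [jn|nj] := ltnP j n0; first by rewrite le_max hr.
  rewrite le_max; apply/orP; right; have := hn0 j nj.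
  by rewrite /= sub0r normrN gtr0_norm// => /ltW.
have d0 : 0 < 1 - rho by rewrite subr_gt0.
exists (expR (M / (1 - rho))) => n m.
apply: (@le_trans _ _ (\prod_(j < n) expR (alpha j.+1 / (1 - rho)))).
  apply: ler_prod => j _; apply/andP; split.
    by apply: sumr_ge0 => i _; rewrite exprn_ge0// ltW.
  apply: (@le_trans _ _ (1 - alpha j.+1)^-1).
    by apply: geometric_le; rewrite al1 ltW.
  apply: le_trans (expR_ge1Dx _).
  have e0 : 0 < 1 - alpha j.+1 by rewrite subr_gt0.
  have -> : (1 - alpha j.+1)^-1 = 1 + alpha j.+1 / (1 - alpha j.+1).
    by field; rewrite gt_eqF.
  rewrite lerD2l ler_wpM2l ?(ltW (alpha_gt0 _))// lef_pV2 ?posrE//.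
  by rewrite lerD2l lerN2.
rewrite -expR_sum ler_expR -mulr_suml ler_wpM2r// invr_ge0 ltW//.
Qed.

(** The configurations of a finite list have their gaps in a box, and the sum
of the weights over a box factors. *)
Lemma weight_summable c : (forall k, alpha k.+1 < 1) ->
  (exists M : R, forall n, \sum_(j < n) alpha j <= M) ->
  exists Z, forall D : seq conf, uniq D -> (forall x, x \in D -> settled c x) ->
    \sum_(x <- D) weight x <= Z.
Proof.
move=> al1 alM; have [Z HZ] := prod_geometric_bounded al1 alM.
exists Z => D uD sD.
pose n := \max_(x <- D) level x.
pose m := \max_(x <- D) absz (c - x 0%N)%R.
have ln x : x \in D -> (level x <= n)%N by move=> xD; exact: leq_bigmax_seq.
have gm x j : x \in D -> (gap x j < m.+1)%N.
  move=> xD; rewrite ltnS; apply: leq_trans (_ : absz (c - x 0%N)%R <= _)%N.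
    by have := gap_le j (sD x xD); lia.
  by rewrite /m; apply: (leq_bigmax_seq _ xD).
pose code x : {ffun 'I_n -> 'I_m.+1} := [ffun j : 'I_n => inord (gap x j)].
pose G (f : {ffun 'I_n -> 'I_m.+1}) : R := \prod_(j < n) alpha j.+1 ^+ f j.
have wG x : x \in D -> weight x = G (code x).
  move=> xD; rewrite (weightE a b (sD x xD) (ln x xD)); apply: eq_bigr => j _.
  by rewrite ffunE inordK// gm.
have code_inj : {in D &, injective code}.
  move=> x y xD yD /ffunP e.
  have gxy j : (j < n)%N -> gap x j = gap y j.
    move=> jn; have := congr1 (@nat_of_ord _) (e (Ordinal jn)).
    by rewrite !ffunE !inordK// gm.
  apply/funext => j; have [jn|nj] := leqP j n.
    rewrite (settled_tail (sD x xD) (ln x xD) jn) (settled_tail (sD y yD) (ln y yD) jn).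
    rewrite big_nat [in RHS]big_nat; congr (_ - _%:Z); apply: eq_bigr => i /andP[_ ?].
    exact: gxy.
  have nj' := ltnW nj.
  by rewrite (settledE (sD x xD)) ?(settledE (sD y yD)) ?(leq_trans _ nj')// ln.
rewrite (eq_big_seq _ wG) -(big_map code xpredT G).
apply: (@le_trans _ _ (\sum_(f : {ffun 'I_n -> 'I_m.+1}) G f)).
  rewrite -[leRHS]big_enum; apply: sub_sum_uniq.
  - by rewrite map_inj_in_uniq.
  - exact: enum_uniq.
  - by move=> f _; rewrite mem_enum.
  - by move=> f; apply: prodr_ge0 => j _; rewrite exprn_ge0// ltW.
by rewrite -(bigA_distr_bigA (fun (j : 'I_n) (i : 'I_m.+1) => alpha j.+1 ^+ i)).
Qed.

(** Any configuration is connected to the packed one: as long as some gap is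
not 0, the particle to the left of the last such gap can move right, and the
total displacement decreases. *)
Lemma exclusion_irreducible c (u : conf -> R) o : settled c o ->
  (forall x y, settled c x -> y \in nbs x -> u x = u y) ->
  forall x, settled c x -> u x = u o.
Proof.
move=> so edge.
suff H x : settled c x -> u x = u (fun j => c + j%:Z).
  by move=> x sx; rewrite H// [RHS]H.
pose n := level x; move=> sx.
have : forall s y, settled c y -> (level y <= n)%N ->
    \sum_(j < n) absz (c + j%:Z - y j)%R = s -> u y = u (fun j => c + j%:Z).
  elim=> [|s IH] y sy ly ys.
    congr u; apply/funext => j; have [jn|nj] := ltnP j n; last first.
      by rewrite (settledE sy (leq_trans ly nj)).
    by move/eqP: ys; rewrite sum_nat_eq0 => /forallP/(_ (Ordinal jn)) /=; lia.
  case E: (level y) => [|k].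
    by congr u; apply/funext => j; rewrite (settledE sy)// E.
  have cR : canR y k by exact: (level_last sy E).
  case: (sy) => Xy _; have Xz := XX_right Xy cR; have sz := settled_move sy Xz.
  have yz : move y k 1 \in nbs y by apply/(mem_nbs _ sy); exists k; right.
  rewrite (edge _ _ sy yz); apply: IH => //.
    apply: (level_le sz) => j nj.
    rewrite gap_right// ; have kn : (k < n)%N by rewrite -E.
    rewrite gtn_eqF ?(leq_trans kn)// gtn_eqF; last by rewrite ltnS ltnW// (leq_trans kn).
    by rewrite (level_gap0 sy)// (leq_trans ly).
  have kn : (k < n)%N by rewrite -E.
  move: ys; rewrite (bigD1 (Ordinal kn))//= [in X in _ -> X](bigD1 (Ordinal kn))//=.
  rewrite (eq_bigr (fun j : 'I_n => absz (c + j%:Z - move y k 1 j)%R)); last first.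
    by move=> j; rewrite -val_eqE /= /move => /negPf ->.
  set t := (\sum_(i < n | _) _)%N.
  have yk : y k < c + k%:Z.
    have := gapE k Xy; have := settledE sy (leqnn _ : (level y <= level y)%N).
    by rewrite E; move: cR; rewrite /canR; lia.
  by rewrite /move eqxx; lia.
by move=> /(_ _ x sx (leqnn _) erefl).
Qed.

End Stationary.

(** * Cutoffs for the exclusion process *)

Lemma sum_supported_le (R : realType) (S : eqType) (D : seq S) (y0 : S) (F : S -> R) :
  uniq D -> (forall y, y != y0 -> F y = 0) -> 0 <= F y0 -> \sum_(y <- D) F y <= F y0.
Proof.
move=> uD F0 Fy; have [yD|yD] := boolP (y0 \in D).
  by rewrite (bigD1_seq y0)//= big1 ?addr0// => y /F0.
rewrite big_seq big1// => y yD'; apply: F0; apply: contraNneq yD => <-//.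
Qed.

Section EnergyBounds.
Context {R : realType} {S : choiceType} (N : network R S).

(** Each edge along which phi varies is assigned to its end that is lower for
lt, so that the energy is estimated by looking at the upward edges from each
state. *)
Lemma energy_oriented (phi : S -> R) (lt : rel S) (B : S -> R) D : uniq D ->
  (forall x y, y \in nbr N x -> ~~ lt x y -> ~~ lt y x -> phi x = phi y) ->
  (forall x, \sum_(y <- D) (lt x y)%:R * (cond N x y * (phi x - phi y) ^+ 2) <= B x) ->
  energy N phi D <= 2 * \sum_(x <- D) B x.
Proof.
move=> uD nolt ltB.
pose E := \sum_(x <- D) \sum_(y <- D) (lt x y)%:R * (cond N x y * (phi x - phi y) ^+ 2).
have EE : E = \sum_(x <- D) \sum_(y <- D) (lt y x)%:R * (cond N x y * (phi x - phi y) ^+ 2).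
  rewrite /E exchange_big/=; apply: eq_bigr => x _; apply: eq_bigr => y _.
  by rewrite cond_sym -[in RHS]sqrrN opprB.
apply: (@le_trans _ _ (E + E)).
  rewrite {2}EE /E /energy -big_split/=; apply: ler_sum => x _.
  rewrite -big_split/=; apply: ler_sum => y _.
  have t0 : 0 <= cond N x y * (phi x - phi y) ^+ 2 by rewrite mulr_ge0 ?cond_ge0 ?sqr_ge0.
  have [xy|/cond_eq0 ->] := boolP (y \in nbr N x); last by rewrite !mul0r !mulr0 addr0.
  case: (boolP (lt x y)) => h1; case: (boolP (lt y x)) => h2; rewrite ?mul1r ?mul0r ?addr0 ?add0r//.
    by rewrite lerDl.
  by rewrite (nolt _ _ xy h1 h2) subrr expr0n mulr0.
by rewrite mulr_natl mulr2n lerD//; apply: ler_sum => x _; exact: ltB.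
Qed.

(** The indicator of a union C of components does not vary along edges;
functions with values in [0, 1] are multiplied at the price of the factor 2. *)
Lemma energy_mul (C : pred S) (phi chi psi : S -> R) D :
  (forall x y, y \in nbr N x -> C x = C y) ->
  (forall x y, y \in nbr N x -> ~~ C x -> x = y) ->
  (forall x, 0 <= phi x <= 1) -> (forall x, 0 <= chi x <= 1) ->
  (forall x, psi x = (C x)%:R * (phi x * chi x)) ->
  energy N psi D <= 2 * energy N phi D + 2 * energy N chi D.
Proof.
move=> Cn nC phi01 chi01 psiE; rewrite /energy !mulr_sumr -big_split/=.
apply: ler_sum => x _; rewrite !mulr_sumr -big_split/=; apply: ler_sum => y _.
have [xy|/cond_eq0 ->] := boolP (y \in nbr N x); last by rewrite !mul0r !mulr0 addr0.
have c0 := cond_ge0 N x y.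
have [Cx|/(nC _ _ xy) ->] := boolP (C x); last by rewrite !subrr expr0n !mulr0 addr0.
rewrite !psiE -(Cn _ _ xy) Cx !mul1r.
rewrite [leRHS](_ : _ = cond N x y *
    (2 * (phi x - phi y) ^+ 2 + 2 * (chi x - chi y) ^+ 2)); last by ring.
rewrite ler_wpM2l//.
have /andP[p0 p1] := phi01 x; have /andP[q0 q1] := chi01 y.
have -> : phi x * chi x - phi y * chi y =
  phi x * (chi x - chi y) + chi y * (phi x - phi y) by ring.
set u := chi x - chi y; set v := phi x - phi y.
have h : (phi x * u + chi y * v) ^+ 2 <= 2 * (phi x * u) ^+ 2 + 2 * (chi y * v) ^+ 2.
  have := sqr_ge0 (phi x * u - chi y * v); rewrite -subr_ge0 => H.
  by rewrite -subr_ge0; apply: le_trans H _; rewrite le_eqVlt; apply/orP; left; apply/eqP; ring.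
apply: le_trans h _; rewrite addrC lerD// ler_wpM2l// exprMn ler_piMl ?sqr_ge0//; exact: exprn_ile1.
Qed.

End EnergyBounds.

Section Cutoff.
Context {R : realType} (a b : nat -> R).
Hypothesis ha : forall k, 0 < a k.
Hypothesis hb : forall k, 0 < b k.
Variables (c : int) (Z : R).
Hypothesis HZ : forall D : seq conf, uniq D -> (forall x, x \in D -> settled c x) ->
    \sum_(x <- D) weight a b x <= Z.
Implicit Types (x y : conf) (i j k n : nat).
Local Notation weight := (weight a b).
Local Notation N := (exclusion ha hb c).
Local Notation st x := `[< settled c x >].

(** Resistance of n conductors a_0, ..., a_{n-1} in series. *)
Definition resist n : R := \sum_(j < n) (a j)^-1.

Lemma resist_homo : {homo resist : n m / (n <= m)%N >-> n <= m}.
Proof.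
apply: (@homo_leq _ _ (fun u v : R => u <= v)) => [//|u v w|n]; first exact: le_trans.
by rewrite /resist big_ord_recr/= lerDl invr_ge0 ltW.
Qed.

Lemma resist_ge0 n : 0 <= resist n.
Proof. by apply: sumr_ge0 => j _; rewrite invr_ge0 ltW. Qed.

Lemma sum_settled (D : seq conf) : uniq D -> \sum_(x <- D | st x) weight x <= Z.
Proof.
move=> uD; rewrite -big_filter; apply: HZ; first exact: filter_uniq.
by move=> x; rewrite mem_filter => /andP[/asboolP].
Qed.

(** Potential of the series circuit: its increment at level k is proportional
to the resistance 1 / a_k. *)
Definition level_cut n x : R := 1 - resist (minn (level x) n) / resist n.

Lemma level_cut01 n x : 0 <= level_cut n x <= 1.
Proof.
have [r0|] := eqVneq (resist n) 0.
  by rewrite /level_cut r0 invr0 mulr0 subr0 ler01 lexx.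
move=> rn; have r0 : 0 < resist n by rewrite lt0r rn resist_ge0.
rewrite /level_cut subr_ge0 ler_pdivrMr// mul1r resist_homo ?geq_minr//=.
by rewrite gerBl divr_ge0// resist_ge0.
Qed.

Lemma level_up x y : settled c x -> y \in nbs x -> (level x < level y)%N ->
  y = move x (level x) (-1) /\ level y = (level x).+1.
Proof.
move=> sx yx; have sy := nbs_settled sx yx; case: (sx) => Xx _.
case/(mem_nbs _ sx) : (yx) => k [[ck yE]|[ck yE]] lxy.
  have [_] := level_left sx ck; rewrite -yE; case: eqVneq => [kl|_] ly.
    by rewrite -kl.
  by rewrite ly ltnn in lxy.
have cL : canL y k by rewrite yE; exact: canL_right.
have [_ lx] := level_left sy cL.
have e : move y k (-1) = x by rewrite yE moveK.
by move: lxy; rewrite e in lx; rewrite lx; case: eqP => [->|]; lia.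
Qed.

(** From a state of level k there is one edge to a higher level, of conductance
weight x * a_k, and the increment of the cutoff along it is 1 / (a_k resist n).
The energy is thus at most twice the sum over k < n of Z / (a_k resist n ^ 2).
*)
Lemma energy_level_cut n D : uniq D -> 0 < resist n ->
  energy N (level_cut n) D <= 2 * (Z / resist n).
Proof.
move=> uD r0.
pose B x := if st x && (level x < n)%N then weight x * (a (level x))^-1 / resist n ^+ 2 else 0.
have rn0 := lt0r_neq0 r0.
apply: (@le_trans _ _ (2 * \sum_(x <- D) B x)).
  apply: (energy_oriented (lt := fun x y => [&& st x, st y & (level x < level y)%N])) => //.
    move=> x y; rewrite /= /exclusion_nbr; case: asboolP => [sx yx|_]; last first.
      by rewrite mem_seq1 => /eqP ->.
    have sy := nbs_settled sx yx; rewrite (asboolT sy)/= -!leqNgt => h1 h2.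
    have e : level x = level y by apply/eqP; rewrite eqn_leq h1 h2.
    by rewrite /level_cut e.
  move=> x; have [sx|nsx] := boolP (st x); last first.
    by rewrite big1 /B ?(negPf nsx)// => y _; rewrite /= mul0r.
  move/asboolP: (sx) => sx'.
  pose y0 := move x (level x) (-1).
  pose F y := ([&& true, st y & (level x < level y)%N])%:R *
      (cond N x y * (level_cut n x - level_cut n y) ^+ 2).
  have F0 y : 0 <= F y by rewrite mulr_ge0// mulr_ge0 ?cond_ge0 ?sqr_ge0.
  have FD : \sum_(y <- D) F y <= F y0.
    apply: sum_supported_le => // y yy0; rewrite /F.
    have [yx|/cond_eq0 ->] := boolP (y \in nbr N x); last by rewrite mul0r mulr0.
    rewrite exclusion_nbrE// in yx.
    case: (boolP (level x < level y)%N) => [/(level_up sx' yx)[yE _]|]; last by rewrite andbF mul0r.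
    by rewrite yE eqxx in yy0.
  apply: le_trans FD _.
  have cL : canL x (level x).
    by rewrite /canL; case E: (level x) => [//|k] /=; exact: (level_last sx' E).
  case: (sx') => Xx _.
  have [_ ly] := level_left sx' cL; rewrite eqxx in ly.
  have sy0 : settled c y0 := settled_move sx' (XX_left Xx cL).
  have condE : cond N x y0 = weight x * a (level x).
    by rewrite (exclusion_condE ha hb _ sx') (rate_left _ _ sx' cL).
  rewrite /F /B condE sx ly ltnSn (asboolT sy0)/= mul1r /level_cut.
  case: ltnP => ln; rewrite -/y0 ly; last first.
    by rewrite (minn_idPr (leqW ln)) subrr expr0n mulr0.
  have -> : resist (minn (level x).+1 n) = resist (level x) + (a (level x))^-1.
    by rewrite (minn_idPl ln) /resist big_ord_recr.
  have al := lt0r_neq0 (ha (level x)).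
  by rewrite le_eqVlt; apply/orP; left; apply/eqP; field; rewrite al rn0.
rewrite ler_wpM2l//.
have -> : \sum_(x <- D) B x = \sum_(k < n) ((a k)^-1 / resist n ^+ 2) *
    \sum_(x <- D | st x && (level x == k)) weight x.
  under [RHS]eq_bigr do rewrite mulr_sumr big_mkcond.
  rewrite exchange_big/=; apply: eq_bigr => x _; rewrite /B.
  case: (st x) => /=; last by rewrite big1.
  case: ltnP => ln; last first.
    by rewrite big1// => i _; case: eqP => // li; have := ltn_ord i; rewrite -li ltnNge ln.
  rewrite (bigD1 (Ordinal ln))//= eqxx big1 ?addr0; first by ring.
  by move=> i; rewrite -val_eqE /= eq_sym => /negPf ->.
apply: (@le_trans _ _ (\sum_(k < n) ((a k)^-1 / resist n ^+ 2) * Z)).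
  apply: ler_sum => k _; rewrite ler_wpM2l ?divr_ge0 ?invr_ge0 ?sqr_ge0 ?(ltW (ha _))//.
  apply: le_trans (sum_settled uD); rewrite big_mkcondr; apply: ler_sum => x _.
  by case: ifP => // _; exact/ltW/weight_gt0.
rewrite -!mulr_suml -/(resist n) le_eqVlt; apply/orP; left; apply/eqP.
by field.
Qed.

(** Distance of the first particle from its packed position; it bounds all
gaps. *)
Definition spread x : nat := absz (c - x 0%N)%R.

Definition spread_cut m x : R := Num.max 0 (1 - (spread x)%:R / m.+1%:R).

Lemma spread_cut01 m x : 0 <= spread_cut m x <= 1.
Proof. by rewrite /spread_cut le_max lexx ge_max ler01/= gerBl divr_ge0. Qed.

(** Only the jumps of the first particle to the left, at rate a_0, increase the
spread, by one; the cutoff has slope 1 / (m + 1). *)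
Lemma energy_spread_cut m D : uniq D ->
  energy N (spread_cut m) D <= 2 * (Z * a 0%N / m.+1%:R ^+ 2).
Proof.
move=> uD; pose B x := if st x then weight x * (a 0%N / m.+1%:R ^+ 2) else 0.
apply: (@le_trans _ _ (2 * \sum_(x <- D) B x)); last first.
  rewrite ler_wpM2l// /B -big_mkcond -mulr_suml -mulrA ler_wpM2r ?sum_settled//.
  by rewrite divr_ge0// ltW.
apply: (energy_oriented (lt := fun x y => [&& st x, st y & (spread x < spread y)%N])) => //.
  move=> x y; rewrite /= /exclusion_nbr; case: asboolP => [sx yx|_]; last first.
    by rewrite mem_seq1 => /eqP ->.
  have sy := nbs_settled sx yx; rewrite (asboolT sy)/= -!leqNgt => h1 h2.
  have e : spread x = spread y by apply/eqP; rewrite eqn_leq h1 h2.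
  by rewrite /spread_cut e.
move=> x; have [sx|nsx] := boolP (st x); last first.
  by rewrite big1 /B ?(negPf nsx)// => y _; rewrite /= mul0r.
move/asboolP: (sx) => sx'.
pose y0 := move x 0%N (-1).
pose F y := ([&& true, st y & (spread x < spread y)%N])%:R *
    (cond N x y * (spread_cut m x - spread_cut m y) ^+ 2).
have F0 y : 0 <= F y by rewrite mulr_ge0// mulr_ge0 ?cond_ge0 ?sqr_ge0.
have FD : \sum_(y <- D) F y <= F y0.
  apply: sum_supported_le => // y yy0; rewrite /F.
  have [yx|/cond_eq0 ->] := boolP (y \in nbr N x); last by rewrite mul0r mulr0.
  rewrite exclusion_nbrE// in yx; have sy := nbs_settled sx' yx.
  case: (boolP (spread x < spread y)%N) => [|_]; last by rewrite andbF mul0r.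
  move=> spxy; exfalso; move: spxy.
  have := settled_ge sx'; have := settled_ge sy; rewrite /spread.
  case/(mem_nbs _ sx') : yx => k [[ck yE]|[ck yE]].
    case: k ck yE => [|k] ck yE; first by rewrite yE eqxx in yy0.
    by rewrite yE /move /=; lia.
  by rewrite yE /move; case: eqP => [<-|_]; lia.
apply: le_trans FD _.
have cL : canL x 0 by [].
case: (sx') => Xx _.
have sy0 : settled c y0 := settled_move sx' (XX_left Xx cL).
have sp : spread y0 = (spread x).+1.
  by have := settled_ge sx'; have := settled_ge sy0; rewrite /spread /y0 /move /=; lia.
have condE : cond N x y0 = weight x * a 0%N.
  by rewrite (exclusion_condE ha hb _ sx') (rate_left _ _ sx' cL).
rewrite /F /B condE sx (asboolT sy0) sp ltnSn/= mul1r -mulrA.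
rewrite ler_wpM2l ?(ltW (weight_gt0 _ _ _))// ler_wpM2l ?(ltW (ha _))//.
rewrite -exprVn -real_normK ?num_real// lerXn2r ?nnegrE// ?invr_ge0//.
have e : (spread x).+1%:R / m.+1%:R = (spread x)%:R / m.+1%:R + m.+1%:R^-1 :> R.
  by rewrite -[in LHS]natr1 mulrDl mul1r.
rewrite /spread_cut sp e.
set t := _ / m.+1%:R; set s : R := m.+1%:R^-1.
have s0 : 0 <= s by rewrite invr_ge0.
rewrite ler_norml !maxEle; case: (leP 0 (1 - t)) => h1; case: (leP 0 (1 - (t + s))) => h2;
  by apply/andP; split; lra.
Qed.

(** Bounded level and bounded spread leave finitely many gap sequences. *)
Lemma cutoff_support n m : exists2 D : seq conf, uniq D &
  forall x, settled c x -> (level x <= n)%N -> (spread x <= m)%N -> x \in D.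
Proof.
pose decode (f : {ffun 'I_n -> 'I_m.+1}) : conf :=
  fun j => c + j%:Z - (\sum_(i < n | (j <= i)%N) f i)%N%:Z.
exists (undup [seq decode f | f <- enum {ffun 'I_n -> 'I_m.+1}]); first exact: undup_uniq.
move=> x sx ln sm; rewrite mem_undup; apply/mapP.
exists [ffun i : 'I_n => inord (gap x i)]; first by rewrite mem_enum.
apply/funext => j; rewrite /decode.
have -> : (\sum_(i < n | (j <= i)%N) [ffun i : 'I_n => inord (gap x i) : 'I_m.+1] i =
    \sum_(j <= i < n) gap x i)%N.
  rewrite big_geq_mkord; apply: eq_bigr => i _; rewrite ffunE inordK// ltnS.
  by apply: leq_trans sm; have := gap_le i sx; rewrite /spread; lia.
have [jn|nj] := leqP j n; first exact: settled_tail.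
by rewrite big_geq ?(ltnW nj)// subr0 (settledE sx)// (leq_trans ln)// ltnW.
Qed.

Lemma exclusion_recurrent o : (forall M : R, exists n, M < resist n) -> settled c o ->
  forall x, settled c x -> surv N o k x @[k --> \oo] --> (0 : R).
Proof.
move=> asum so; apply: (recurrence_criterion (C := settled c)) => //.
- by move=> x y sx; rewrite exclusion_nbrE//; exact: nbs_settled.
- move=> u edge; apply: exclusion_irreducible => // x y sx yx.
  by apply: edge => //; rewrite exclusion_nbrE.
move=> eps x y eps0 sx sy.
have Z0 : 0 <= Z by have := HZ (D := [::]) isT; rewrite big_nil; exact.
have [n hn] := asum ((2 * resist (level x) + 2 * resist (level y) + 8 * Z) / eps).
pose r : R := (2 * (spread x)%:R + 2 * (spread y)%:R + 8 * (Z * a 0%N)) / eps.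
have r0 : 0 <= r.
  rewrite divr_ge0 ?(ltW eps0)// !addr_ge0// ?mulr_ge0//; exact: ltW.
pose m := Num.truncn r; have rm : r < m.+1%:R by rewrite truncnS_gt.
have rn : 0 < resist n.
  by apply: le_lt_trans hn; rewrite divr_ge0 ?(ltW eps0)// !addr_ge0 ?mulr_ge0 ?resist_ge0.
have m0 : 0 < m.+1%:R :> R by [].
have [D uD HD] := cutoff_support n m.
pose phi z := (st z)%:R * (level_cut n z * spread_cut m z).
have hn' := hn; rewrite ltr_pdivrMr// in hn'.
have rm' : 2 * (spread x)%:R + 2 * (spread y)%:R + 8 * (Z * a 0%N) < m.+1%:R * eps.
  by rewrite -ltr_pdivrMr.
have near1 z : settled c z -> 2 * resist (level z) <= resist n * eps ->
    2 * (spread z)%:R <= m.+1%:R * eps -> 1 - eps <= phi z <= 1.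
  move=> sz h1 h2; rewrite /phi (asboolT sz) mul1r.
  have /andP[p0 p1] := level_cut01 n z; have /andP[q0 q1] := spread_cut01 m z.
  rewrite mulr_ile1// andbT.
  have h3 : 1 - eps / 2 <= level_cut n z.
    rewrite /level_cut lerD2l lerN2 ler_pdivrMr//.
    apply: (@le_trans _ _ (resist (level z))); first by apply: resist_homo; rewrite geq_minl.
    lra.
  have h4 : 1 - eps / 2 <= spread_cut m z.
    rewrite /spread_cut le_max; apply/orP; right.
    rewrite lerD2l lerN2 ler_pdivrMr//; lra.
  by nra.
have sp0 z : 0 <= (spread z)%:R :> R by [].
have Za : 0 <= Z * a 0%N by rewrite mulr_ge0// ltW.
exists phi, D; split => //.
- move=> z zD; rewrite /phi; case: asboolP => sz; last by rewrite mul0r.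
  rewrite mul1r; have [ln|nl] := leqP (level z) n; last first.
    by rewrite /level_cut (minn_idPr (ltnW nl)) divff ?gt_eqF// subrr mul0r.
  have [sm|ms] := leqP (spread z) m; first by rewrite HD in zD.
  rewrite /spread_cut max_l ?mulr0// subr_le0 ler_pdivlMr// mul1r.
  by rewrite ler_nat.
- apply: near1 => //; first by have := resist_ge0 (level y); lra.
  by have := sp0 y; lra.
- apply: near1 => //; first by have := resist_ge0 (level x); lra.
  by have := sp0 x; lra.
move=> D' uD'.
apply: (@le_trans _ _ (2 * energy N (level_cut n) D' + 2 * energy N (spread_cut m) D')).
  apply: (energy_mul (C := fun z => st z)) => //.
  - move=> z t; rewrite /= /exclusion_nbr; case: asboolP => sz.
      by move=> /(nbs_settled sz)/asboolT ->.
    by rewrite mem_seq1 => /eqP ->; rewrite asboolF.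
  - move=> z t; rewrite /= /exclusion_nbr; case: asboolP => //= sz.
    by rewrite mem_seq1 => /eqP ->.
  - exact: level_cut01.
  - exact: spread_cut01.
have e1 : Z / resist n <= eps / 8.
  rewrite ler_pdivrMr//; have := resist_ge0 (level x); have := resist_ge0 (level y); lra.
have e2 : Z * a 0%N / m.+1%:R ^+ 2 <= eps / 8.
  apply: (@le_trans _ _ (Z * a 0%N / m.+1%:R)).
    rewrite ler_wpM2l// lef_pV2 ?posrE ?exprn_gt0//.
    by rewrite expr2 ler_peMl ?ler1n.
  rewrite ler_pdivrMr// mulrAC ler_pdivlMr// [leRHS]mulrC; apply: le_trans (ltW rm').
  by rewrite [leLHS]mulrC lerDr addr_ge0// mulr_ge0.
have E1 : energy N (level_cut n) D' <= 2 * (eps / 8).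
  by apply: le_trans (energy_level_cut uD' rn) _; rewrite ler_wpM2l.
have E2 : energy N (spread_cut m) D' <= 2 * (eps / 8).
  by apply: le_trans (energy_spread_cut m uD') _; rewrite ler_wpM2l.
by move: E1 E2; lra.
Qed.

End Cutoff.

(** * Sums over countable sets and the limit law *)

Section EsumLists.
Context {R : realType} {S : choiceType} (C : set S) (u : S -> R).

Lemma esum_seq_le (D : seq S) : uniq D -> (forall x, x \in D -> C x) ->
  ((\sum_(x <- D) u x)%:E <= \esum_(x in C) (u x)%:E)%E.
Proof.
move=> uD DC; apply: esum_ge; exists [set` D].
  by split; [exact: finite_seq|move=> x /DC].
by rewrite -fsbig_seq// sumEFin.
Qed.

Lemma esum_le_seq (M : R) :
  (forall D : seq S, uniq D -> (forall x, x \in D -> C x) -> \sum_(x <- D) u x <= M) ->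
  (\esum_(x in C) (u x)%:E <= M%:E)%E.
Proof.
move=> h; apply: ub_ereal_sup => _ [X [fX XC] <-].
rewrite fsbig_finite// sumEFin lee_fin; apply: h; first exact: finmap.fset_uniq.
by move=> x; rewrite in_fset_set// inE => /XC.
Qed.

(** Together with [esum_seq_le], this identifies sums over sets with integrals
as expressed by [has_total]. *)
Lemma esum_approx_seq (e : R) : 0 < e -> (\esum_(x in C) (u x)%:E)%E \is a fin_num ->
  exists D : seq S, [/\ uniq D, forall x, x \in D -> C x &
    fine (\esum_(x in C) (u x)%:E)%E - e <= \sum_(x <- D) u x].
Proof.
move=> e0 fin.
have [_ [X [fX XC] <-] h] := ub_ereal_sup_adherent e0 fin.
exists (finmap.enum_fset (fset_set X)); split.
- exact: finmap.fset_uniq.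
- by move=> x; rewrite in_fset_set// inE => /XC.
- move: h; rewrite fsbig_finite// sumEFin -/(esum _ _) -[X in (X - _)%E](fineK fin).
  by rewrite -EFinB lte_fin => /ltW.
Qed.

End EsumLists.

Lemma esum_scale (R : realType) (S : choiceType) (C : set S) (u : S -> R) (k : R) :
  0 < k -> (\esum_(x in C) (k * u x)%:E = k%:E * \esum_(x in C) (u x)%:E)%E.
Proof.
have le (v : S -> R) (r : R) : 0 < r ->
    (\esum_(x in C) (r * v x)%:E <= r%:E * \esum_(x in C) (v x)%:E)%E.
  move=> r0; apply: ub_ereal_sup => _ [X [fX XC] <-].
  rewrite fsbig_finite// sumEFin -mulr_sumr EFinM lee_wpmul2l ?lee_fin ?(ltW r0)//.
  apply: esum_seq_le; first exact: finmap.fset_uniq.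
  by move=> x; rewrite in_fset_set// inE => /XC.
move=> k0; apply/eqP; rewrite eq_le le//=.
have ki : 0 < k^-1 by rewrite invr_gt0.
have := le (fun x => k * u x) _ ki.
under eq_esum do rewrite mulKf ?gt_eqF//.
by rewrite lee_pdivlMl.
Qed.

Lemma discrete_image_probability (R : realType) (S : choiceType) (C : set S)
    (u : S -> R) (f : S -> int) : (forall x, 0 <= u x) ->
  (\esum_(x in C) (u x)%:E = 1)%E ->
  exists p : probability int R,
    forall A, p A = (\esum_(x in C `&` f @^-1` A) (u x)%:E)%E.
Proof.
move=> u0 u1.
pose m (A : set int) := (\esum_(x in C `&` f @^-1` A) (u x)%:E)%E.
have m0 : m set0 = 0%E by rewrite /m preimage_set0 setI0 esum_set0.
have m_ge0 A : (0 <= m A)%E by apply: esum_ge0 => x _; rewrite lee_fin.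
have m_sigma : semi_sigma_additive m.
  move=> F mF tF mUF; rewrite /m preimage_bigcup setI_bigcupr.
  rewrite nneseries_sum_bigcup; last 2 first.
  - apply/trivIsetP => i j _ _ ij; apply/seteqP; split => // x [[_ Fi] [_ Fj]].
    have : (F i `&` F j) (f x) by [].
    by move/trivIsetP: tF => /(_ i j I I ij) ->.
  - by move=> x; rewrite lee_fin.
  by apply: cvg_toP => //; apply: is_cvg_nneseries => n _ _; exact: m_ge0.
pose mm : {measure set int -> \bar R} := HB.pack m (isMeasure.Build _ _ _ m m0 m_ge0 m_sigma).
have mT : mm setT = 1%E by rewrite /= /m preimage_setT setIT.
pose p : probability int R := HB.pack m (Measure_isProbability.Build _ _ _ mm mT)
    (isMeasure.Build _ _ _ m m0 m_ge0 m_sigma).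
by exists p.
Qed.

Lemma ae_forall_seq d (T : measurableType d) (R : realType) (P : probability T R)
    (I : eqType) (s : seq I) (Q : I -> T -> Prop) :
  (forall i, i \in s -> {ae P, forall w, Q i w}) ->
  {ae P, forall w, forall i, i \in s -> Q i w}.
Proof.
elim: s => [|i s IH] h; first by apply: nearW.
have h1 := h i (mem_head _ _).
have h2 : {ae P, forall w, forall j, j \in s -> Q j w}.
  by apply: IH => j js; apply: h; rewrite inE js orbT.
by apply: filterS2 h1 h2 => w Qi Qs j; rewrite inE => /orP[/eqP ->|/Qs].
Qed.

(** * The exclusion process as a walk with exponential holding times *)

Section Assembly.
Context {R : realType} (a b : nat -> R).
Hypothesis ha : forall k, 0 < a k.
Hypothesis hb : forall k, 0 < b k.
Variables (c : int) (x0 : conf).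
Hypothesis sx0 : settled c x0.
Local Notation N := (exclusion ha hb c).
Local Notation st x := `[< settled c x >].
Local Notation weight := (weight a b).

Lemma path_settled l i : path (step N) x0 l -> settled c (nth x0 (x0 :: l) i).
Proof.
have H x s : settled c x -> path (step N) x s -> forall i, settled c (nth x0 (x :: s) i).
  elim: s x => [|y s IH] x sx /= => [_ [|[|j]]//|/andP[xy ys] [|j]//].
  by apply: IH => //; move: xy; rewrite /step exclusion_nbrE//; exact: nbs_settled.
by move=> pl; exact: H.
Qed.

(** The value outside the component is arbitrary, subject to the bound
[hold_rate_ge]. *)
Definition hold_rate x : R := if st x then total_rate a b x else a 0%N.

Lemma hold_rate_ge x : a 0%N <= hold_rate x.
Proof. by rewrite /hold_rate; case: asboolP => // sx; exact: total_rate_ge sx. Qed.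

Definition first_in (A : set int) x : R := (st x && `[< A (x 0%N) >])%:R.

(** Since wt = weight * total_rate, the integral of 1_A / total_rate against
the reversible measure of the jump chain is the weight of A. *)
Lemma settled_total A :
    (\esum_(x in settled c `&` (fun x => x 0%N) @^-1` A) (weight x)%:E < +oo)%E ->
  has_total N (fun x => first_in A x / hold_rate x)
    (fine (\esum_(x in settled c `&` (fun x => x 0%N) @^-1` A) (weight x)%:E)%E).
Proof.
set CA := _ `&` _; set E := (\esum_(x in CA) _)%E => Efin.
have w0 x : 0 <= weight x by exact/ltW/weight_gt0.
have fE : E \is a fin_num.
  by rewrite ge0_fin_numE//; apply: esum_ge0 => x _; rewrite lee_fin.
have wtE x : wt N x * (first_in A x / hold_rate x) = (x \in CA)%:R * weight x.
  rewrite /first_in /hold_rate; case: asboolP => sx; last first.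
    by rewrite mul0r mulr0 memNset ?mul0r// => -[].
  rewrite (exclusion_wt ha hb sx) /=.
  have q0 := lt0r_neq0 (lt_le_trans (ha 0%N) (total_rate_ge ha hb sx)).
  case: asboolP => Ax; last by rewrite mul0r mulr0 memNset ?mul0r// => -[].
  by rewrite mem_set//= mul1r [RHS]mul1r mulfK.
split.
- move=> D uD; rewrite -lee_fin fineK//.
  under eq_bigr do rewrite wtE.
  apply: le_trans (_ : (\sum_(x <- [seq x <- D | x \in CA]) weight x)%:E <= _)%E.
    rewrite lee_fin big_filter [leRHS]big_mkcond; apply: ler_sum => x _.
    by case: (x \in CA); rewrite ?mul1r ?mul0r.
  apply: esum_seq_le => //; first exact: filter_uniq.
  by move=> x; rewrite mem_filter => /andP[/set_mem].
- move=> e e0; have [D [uD DC De]] := esum_approx_seq e0 fE.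
  exists D => //; apply: le_trans De _; rewrite big_seq [leRHS]big_seq.
  by apply: ler_sum => x /DC xC; rewrite wtE mem_set// mul1r.
Qed.

Section Process.
Context {d : measure_display} {T : measurableType d} (P : probability T R).
Context (Y : nat -> T -> conf) (H : nat -> T -> R).
Hypothesis YXF : forall n w, XF (Y n w).
Hypothesis mY : forall n x, XF x -> measurable [set w | Y n w = x].
Hypothesis mH : forall n, measurable_fun setT (H n).
Hypothesis Y0 : P [set w | Y 0%N w = x0] = 1%E.
Hypothesis Ystep : forall n (y : nat -> conf), (forall i, XF (y i)) ->
  P (starts_with Y n.+1 y) = (P (starts_with Y n y) *
    (rate a b (y n) (y n.+1) / exit_rate XF (rate a b) (y n))%:E)%E.
Hypothesis Hlaw : forall n (y : nat -> conf) (t : nat -> R),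
  (forall i, XF (y i)) -> (forall i, 0 <= t i) ->
  P (starts_with Y n y `&` [set w | forall i, (i <= n)%N -> t i < H i w]) =
  (P (starts_with Y n y) *
    (\prod_(i < n.+1) expR (- (exit_rate XF (rate a b) (y i) * t i)))%:E)%E.

Lemma mfollows l : measurable (follows x0 Y l).
Proof.
rewrite (_ : follows x0 Y l = \bigcap_(i in [set i | (i <= size l)%N])
    [set w | Y i w = nth x0 (x0 :: l) i]).
  apply: bigcap_measurableType => i _.
  have [Xi|nX] := pselect (XF (nth x0 (x0 :: l) i)); first exact: mY.
  rewrite (_ : [set _ | _] = set0)//; apply/seteqP; split => // w /= Yi.
  by apply: nX; rewrite -Yi.
apply/seteqP; split => w /=; rewrite /follows /=.
  by move=> e i il; rewrite -e nth_mkseq.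
move=> h; apply: (@eq_from_nth _ x0); first by rewrite size_mkseq.
by move=> i; rewrite size_mkseq => il; rewrite nth_mkseq// h.
Qed.

Lemma follows_starts l (y : nat -> conf) :
  (forall i, (i <= size l)%N -> y i = nth x0 (x0 :: l) i) ->
  follows x0 Y l = starts_with Y (size l) y.
Proof.
move=> yl; apply/seteqP; split => w /=; rewrite /follows /starts_with /=.
  by move=> e i il; rewrite yl// -e nth_mkseq.
move=> h; apply: (@eq_from_nth _ x0); first by rewrite size_mkseq.
by move=> i; rewrite size_mkseq => il; rewrite nth_mkseq// h// yl.
Qed.

Lemma nth_settled_XF l i : path (step N) x0 l -> XF (nth x0 (x0 :: l) i).
Proof. by move=> pl; apply: settled_XF; exact: path_settled. Qed.

(** Only paths within the component c matter: on them the transition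
probabilities of the jump chain are those of the network. *)
Lemma exclusion_chain : chain_law P N x0 Y.
Proof.
split; first exact: mfollows.
elim/last_ind => [_|l z IH pz].
  rewrite /= -Y0; congr (P _); apply/seteqP; split => w /=;
      rewrite /follows /mkseq /=; first by case.
  by move=> e; rewrite e.
have /andP[pl lz] : path (step N) x0 l && step N (last x0 l) z by rewrite -rcons_path.
pose y := nth x0 (x0 :: rcons l z).
have yl i : (i <= size l)%N -> y i = nth x0 (x0 :: l) i.
  by move=> il; rewrite /y -rcons_cons nth_rcons /= ltnS il.
rewrite (follows_starts (y := y)); last by [].
rewrite size_rcons Ystep; last by move=> i; exact: (nth_settled_XF _ pz).
rewrite -(follows_starts yl) IH// pathw_rcons EFinM; congr (_ * _%:E)%E.
rewrite yl// [nth _ _ (size l)](_ : _ = last x0 l); last by rewrite (last_nth x0).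
have -> : y (size l).+1 = z by rewrite /y /= nth_rcons ltnn eqxx.
have sl : settled c (last x0 l) by rewrite (last_nth x0); exact: path_settled.
by rewrite exclusion_trans// (exit_rateE ha hb sl).
Qed.

(** The holding times are almost surely positive but not everywhere; truncating
them at 0 does not change the events t < H n for t >= 0. *)
Definition Hpos n w : R := Num.max 0 (H n w).

Lemma exclusion_holding : holding_law P N x0 Y hold_rate Hpos.
Proof.
move=> l t pl t0.
have yl i : (i <= size l)%N -> nth x0 (x0 :: l) i = nth x0 (x0 :: l) i by [].
have := Hlaw (size l) (fun i => nth_settled_XF i pl) t0.
rewrite -(follows_starts yl) (exclusion_chain.2 l pl) -EFinM => HH.
rewrite (_ : [set w | _] = [set w | forall i, (i <= size l)%N -> t i < H i w]).
  rewrite HH; congr (_ * _)%:E; apply: eq_bigr => i _.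
  have si := path_settled i pl.
  by rewrite (exit_rateE ha hb si) /hold_rate asboolT.
apply/seteqP; split => w /= h i il; have := h i il; rewrite /Hpos.
  by rewrite lt_max ltNge t0.
by rewrite lt_max => ->; rewrite orbT.
Qed.

Lemma ae_H_gt0 : {ae P, forall w, forall i, 0 < H i w}.
Proof.
suff : {ae P, forall w, forall K, forall l, l \in paths N K x0 -> follows x0 Y l w ->
    forall i, (i <= K)%N -> 0 < H i w}.
  apply: filterS2 (ae_full exclusion_chain) => w fw h n.
  have [l [lK lw _ _]] := full_follows (fw n).
  exact: (h n l lK lw n (leqnn n)).
apply: ae_foralln => K; apply: ae_forall_seq => l.
rewrite mem_paths => /andP[/eqP lK pl].
pose pos := [set w | forall i, (i <= K)%N -> 0 < H i w].
have mpos : measurable pos.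
  rewrite (_ : pos = \bigcap_(i in [set i | (i <= K)%N]) [set w | 0 < H i w]).
    apply: bigcap_measurableType => i _.
    have : measurable_fun setT (fun w => 0 < H i w) by exact: measurable_fun_ltr.
    by move=> /(_ measurableT [set true]); rewrite setTI; exact.
  by apply/seteqP; split => w.
exists (follows x0 Y l `\` pos); split.
- by apply: measurableD => //; exact: mfollows.
- transitivity (P (follows x0 Y l) - P (follows x0 Y l `&` pos))%E.
    apply: measureD => //; first exact: mfollows.
    by rewrite ltey_eq fin_num_measure//; exact: mfollows.
  have -> : P (follows x0 Y l `&` pos) = P (follows x0 Y l).
    have := @Hlaw (size l) _ (fun=> 0) (fun i => nth_settled_XF i pl) (fun=> lexx _).
    rewrite -(follows_starts (l := l))// lK => ->.
    by rewrite big1 ?mule1// => i _; rewrite mulr0 oppr0 expR0.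
  by rewrite (exclusion_chain.2 l pl) subee.
- move=> w /= nh; have [lw|nl] := pselect (follows x0 Y l w); last first.
    by exfalso; apply: nh => lw.
  by split => // pw; apply: nh => _.
Qed.

Hypothesis rec : forall x, settled c x -> surv N x0 k x @[k --> \oo] --> (0 : R).
Hypothesis fin_weight : (\esum_(x in settled c) (weight x)%:E < +oo)%E.

Definition mass (A : set int) : R :=
  fine (\esum_(x in settled c `&` (fun x => x 0%N) @^-1` A) (weight x)%:E)%E.

Lemma fin_mass A : (\esum_(x in settled c `&` (fun x => x 0%N) @^-1` A) (weight x)%:E < +oo)%E.
Proof.
apply: le_lt_trans fin_weight; apply: le_ereal_sup => _ [X [fX XC] <-].
by exists X => //; split => // x /XC[].
Qed.

Lemma mass_gt0 : 0 < mass setT.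
Proof.
rewrite -lte_fin fineK; last first.
  by rewrite ge0_fin_numE ?fin_mass//; apply: esum_ge0 => x _; rewrite lee_fin ltW// weight_gt0.
apply: (@lt_le_trans _ _ (\sum_(x <- [:: x0]) weight x)%:E).
  by rewrite big_seq1 lte_fin weight_gt0.
by apply: esum_seq_le => // x; rewrite mem_seq1 => /eqP ->.
Qed.

(** Apply [time_average] to the indicator of A and to the constant 1 on the
component: the numerator and the denominator of the time average, between which
[sandwich_cvg] interpolates. *)
Lemma occupation_fraction (X : R -> T -> conf) (A : set int) :
  {ae P, forall w, forall n t,
      jump_time H n w <= t < jump_time H n.+1 w -> X t w = Y n w} ->
  {ae P, forall w,
    (t^-1 * \int[lebesgue_measure]_(s in `[0, t]) \1_A (X s w 0%N) : R)
       @[t --> +oo] --> mass A / mass setT}.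
Proof.
move=> XY.
have Yrec : {ae P, forall w, visits_io x0 (fun i => Y i w)}.
  apply: (ae_visits_io exclusion_chain) => l pl; apply: rec.
  by rewrite (last_nth x0); exact: path_settled.
have mHpos n : measurable_fun setT (Hpos n) by exact: measurable_maxr.
have Hpos0 n w : 0 <= Hpos n w by rewrite le_max lexx.
have avgA B : {ae P, forall w,
    (\sum_(i < tauY x0 Y w (n.+1 ^ 2)) first_in B (Y i w) * Hpos i w) / (n.+1 ^ 2)%:R
      @[n --> \oo] --> mass B / wt N x0}.
  apply: (time_average exclusion_chain Yrec mHpos Hpos0 exclusion_holding (ha 0%N) hold_rate_ge).
  - by move=> x; rewrite /first_in ler0n lern1 leq_b1.
  - exact: settled_total (fin_mass B).
  - by move=> x; rewrite /first_in; case: asboolP => [/rec|]; [right|left].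
have aeY : {ae P, forall w, forall n, settled c (Y n w)}.
  apply: filterS (ae_full exclusion_chain) => w fw n.
  have [l [lK _ sl yl]] := full_follows (fw n).
  move: lK; rewrite mem_paths => /andP[_ pl].
  have := path_settled n pl; rewrite -yl nth_mkseq//.
have ae1 : {ae P, forall w, (forall n, settled c (Y n w)) /\ (forall i, 0 < H i w)}.
  by apply: filterS2 aeY ae_H_gt0.
have ae2 : {ae P, forall w, visits_io x0 (fun i => Y i w) /\ forall n t,
      jump_time H n w <= t < jump_time H n.+1 w -> X t w = Y n w}.
  by apply: filterS2 Yrec XY.
have ae3 : {ae P, forall w, ((forall n, settled c (Y n w)) /\ (forall i, 0 < H i w)) /\
    (visits_io x0 (fun i => Y i w) /\ forall n t,
      jump_time H n w <= t < jump_time H n.+1 w -> X t w = Y n w)}.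
  by apply: filterS2 ae1 ae2.
move: ae3 (avgA A) (avgA setT); apply: filterS3 => w [[sY H0] [rw Xw]] cA cT.
have HE i : Hpos i w = H i w by rewrite /Hpos max_r// ltW.
have wo := wt_gt0 N x0.
have -> : mass A / mass setT = (mass A / wt N x0) / (mass setT / wt N x0).
  by have := mass_gt0 => m0; field; rewrite !gt_eqF.
apply: (@sandwich_cvg R (fun i => Hpos i w) (fun i => first_in A (Y i w))
  (fun s => \1_A (X s w 0%N)) _ _ _ (fun n => tauY x0 Y w (n.+1 ^ 2))) => //.
- by move=> i; rewrite /first_in ler0n lern1 leq_b1.
- move=> n t nt; have XnY : X t w = Y n w.
    have eJ k : epoch (fun i => Hpos i w) k = jump_time H k w.
      by apply: eq_bigr => i _; rewrite HE.
    by apply: Xw; rewrite -!eJ.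
  by rewrite XnY indicE /first_in asboolT.
- by rewrite divr_gt0// mass_gt0.
- by move=> n m nm; apply: tau_homo => //; rewrite leq_exp2r.
- move: cT; under eq_fun do under eq_bigr do rewrite /first_in asboolT// asboolT// mul1r.
  exact.
Qed.

End Process.
End Assembly.

Theorem corollary1p13 (R : realType) (a b : nat -> R) (x0 : conf)
  (ha : forall k, 0 < a k) (hb : forall k, 0 < b k)
  (hsuma : (\sum_(0 <= k <oo) ((a k)^-1)%:E = +oo)%E)
  (hV : admissible_v a b !=set0)
  (hsumalpha : (\sum_(0 <= k <oo) (alpha a b k)%:E < +oo)%E)
  (hx0 : XF x0) :
  exists pi_alpha : probability int R,
    forall (d : measure_display) (T : measurableType d) (P : probability T R)
      (X : R -> T -> conf),
      is_ctmc P XF (rate a b) x0 X ->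
      forall A : set int, finite_set A ->
        {ae P, forall w,
          (t^-1 * \int[lebesgue_measure]_(s in `[0, t]) \1_A (X s w 0%N) : R)
            @[t --> +oo] --> fine (pi_alpha A)}.
Proof.
(* Beyond the last of the finitely many k with a gap that is not 0, the
particles are packed. *)
have [c sx0] : exists c, settled c x0.
  case: hx0 => Xx0 /finite_seqP[s sE].
  pose n := (\max_(i <- s) i).+1.
  exists (x0 n - n%:Z); split => //; exists n => j /subnKC <-.
  elim: (j - n)%N => [|i IH]; first by rewrite addn0 subrK.
  have : x0 (n + i).+1 - x0 (n + i)%N = 1.
    apply/eqP; apply: contraT => h.
    have ins : (n + i)%N \in s.
      have : [set` s] (n + i)%N by rewrite -sE.
      by [].
    have : (n + i <= \max_(i <- s) i)%N by exact: (leq_bigmax_seq _ ins).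
    by rewrite /n; lia.
  by rewrite addnS; lia.
have asum : forall M : R, exists n, M < \sum_(j < n) (a j)^-1.
  apply: (@nneseries_unbounded R (fun k => (a k)^-1)) hsuma => k.
  by rewrite invr_ge0 ltW.
have alsum : exists M : R, forall n, \sum_(j < n) alpha a b j <= M.
  by apply: (@nneseries_bounded R (alpha a b)) hsumalpha => k; exact/ltW/alpha_gt0.
have al1 k : alpha a b k.+1 < 1 by exact: alpha_lt1.
have [Z HZ] := weight_summable ha hb c al1 alsum.
have w0 x : 0 <= weight a b x by exact/ltW/weight_gt0.
have rec := exclusion_recurrent ha hb HZ asum sx0.
have fin_w : (\esum_(x in settled c) (weight a b x)%:E < +oo)%E.
  by apply: le_lt_trans (esum_le_seq HZ) _; rewrite ltry.
pose m := mass a b c.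
have m0 : 0 < m setT by exact: (mass_gt0 ha hb sx0 fin_w).
have esum_norm (C : set conf) : (\esum_(x in C) ((m setT)^-1 * weight a b x)%:E =
    ((m setT)^-1)%:E * \esum_(x in C) (weight a b x)%:E)%E.
  by apply: esum_scale => //; rewrite invr_gt0.
have mE A : (\esum_(x in settled c `&` (fun x => x 0%N) @^-1` A) (weight a b x)%:E = (m A)%:E)%E.
  rewrite fineK// ge0_fin_numE; first exact: (fin_mass fin_w).
  by apply: esum_ge0 => x _; rewrite lee_fin.
have u0 x : 0 <= (m setT)^-1 * weight a b x by rewrite mulr_ge0// invr_ge0 ltW.
have u1 : (\esum_(x in settled c) ((m setT)^-1 * weight a b x)%:E = 1)%E.
  have := mE setT; rewrite preimage_setT setIT esum_norm => ->.
  by rewrite -EFinM mulVf ?gt_eqF.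
have [p pE] := discrete_image_probability (fun x : conf => x 0%N) u0 u1.
exists p => d T P X [Y [H [[YXF mY] mH [Y0 Ystep] Hlaw XY]]] A _.
have -> : fine (p A) = mass a b c A / mass a b c setT.
  by rewrite pE esum_norm mE -EFinM /= mulrC.
exact: (occupation_fraction sx0 YXF mY mH Y0 Ystep Hlaw rec fin_w A XY).
Qed.
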